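(* Let $X$ be a real double-sided si-process determined by a chain of de Branges spaces $\mathcal H(E_t)$, $t\ge0$, of exponential type with diagonal structure function $\mathrm{diag}[\alpha_t,\gamma_t]$ as described in the context, and let $M^e$ be its even fundamental martingale, with second order moments $\mathbb E(M^e_sM^e_t)=\pi\alpha_{s\wedge t}$. Then the martingale bridge $$B_t^e=M_t^e-\frac{\alpha_t}{\alpha_r}M_r^e,\qquad t\in[0,r],$$ divided by $\sqrt{\alpha_t'}$, decomposes in the Karhunen–Loève series $$\frac{1}{\sqrt{\alpha_t'}}B_t^e=\sum_{n=1}^\infty\omega_n\varphi_n(t)\,\xi_n ,$$ where the $\xi_n$ are i.i.d. Gaussian random variables, $\{\varphi_n(t)=B_t(\lambda_n)/\sqrt{\alpha_t'}\}$ is an orthonormal basis in $L^2[0,r]$, and $$\omega_n=\frac1{\lambda_n}\sqrt{\frac{2}{\pi K_r(\lambda_n,\lambda_n)}},$$ the $\lambda_n$ being the positive zeros of $B_r(z)$.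
   Context: **Karhunen–Loève series.** By this is meant an orthogonal decomposition $\sum_n\omega_n\varphi_n(t)\xi_n$ of a mean-square continuous process on a closed interval, with uncorrelated $\xi_n$, $\mathbb E\,\xi_m\bar\xi_n=\delta_{mn}$, where $|\omega_n|^2$ and $\varphi_n$ are eigenvalues and eigenfunctions of the covariance function; the series converges in mean square uniformly on the interval. **Chain.** $\alpha$ is a continuously differentiable strictly increasing function on $[0,\infty)$ with $\alpha_0=0$, $\alpha_t'>0$, and $\gamma_t=\int_0^tdu/\alpha_u'$. The functions $A_t(z),B_t(z)$ (entire in $z$, continuous in $t$) are the solution of $$1-A_t(z)=z\int_0^tB_u(z)\,d\gamma_u,\qquad B_t(z)=z\int_0^tA_u(z)\,d\alpha_u,$$ and $E_t=A_t-iB_t$. For $t>0$, $E_t$ is a de Branges function ($|E_t(x-iy)|<|E_t(x+iy)|$ for $y>0$); $\mathcal H(E_t)$ is the de Branges space of entire functions $f$ with $\int|f/E_t|^2d\lambda<\infty$ and $f/E_t,f^\sharp/E_t$ of bounded type and non-positive mean type in the upper half-plane ($f^\sharp(z)=\overline{f(\bar z)}$), with reproducing kernel $K_t(w,z)=\frac{A_t(\bar w)B_t(z)-B_t(\bar w)A_t(z)}{\pi(z-\bar w)}$. On the real diagonal $\pi K_r(\lambda,\lambda)=A_r(\lambda)\dot B_r(\lambda)-\dot A_r(\lambda)B_r(\lambda)$, the dot denoting the derivative in $\lambda$. (The entire function $B_t(z)$ is not to be confused with the bridge $B^e_t$.) **Process.** $X=(X_t)_{t\in\mathbb R}$ is a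 real centred mean-square continuous Gaussian process with $\mathbb E(X_sX_t)=\int\frac{(e^{i\lambda s}-1)(e^{-i\lambda t}-1)}{\lambda^2}\mu(d\lambda)$, $\mu\ge0$ symmetric with $\int\frac{\mu(d\lambda)}{1+\lambda^2}<\infty$. ''Determined by the chain'' means: for every $t>0$ the space $\mathcal H(E_t)$ is contained isometrically in $L^2(\mu)$ (norms agree) and as a subspace of $L^2(\mu)$ it equals the closed linear span of $\{(e^{izu}-1)/z:|u|\le t\}$. The even part is $X^e_t=\frac12(X_t-X_{-t})$, $t\ge0$. The even fundamental martingale $M^e_t$ is the image of $\lambda\mapsto B_t(\lambda)/\lambda$ under the linear isometry, from the closed real linear span of $\{\sin(u\lambda)/\lambda:u\ge0\}$ in $L^2(\mu)$ onto that of $\{X_u^e\}$ in $L^2(\Omega,P)$, sending $\sin(u\lambda)/\lambda$ to $X_u^e$.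
   Formalization: The φ_n are orthogonal but not orthonormal: √(2/(πK_r(λ_n,λ_n)))·φ_n is proved to be the orthonormal basis. With the stated ω_n the i.i.d. ξ_n have variance π; the eigenvalues are π/λ_n², and the normalised Karhunen–Loève property holds for ξ_n/√π. *)

(* Defs.v *)
From HB Require Import structures.
From mathcomp Require Import all_boot all_order all_algebra.
From mathcomp Require Import complex.
From mathcomp Require Import all_classical all_reals all_analysis.

Set Implicit Arguments.
Unset Strict Implicit.
Unset Printing Implicit Defensive.

Import Order.TTheory GRing.Theory Num.Theory.
Import numFieldNormedType.Exports.

Local Open Scope classical_set_scope.
Local Open Scope ring_scope.
Local Open Scope complex_scope.

(* The [numFieldType] casts below give R[i] the topology of its modulus. *)

Definition normc (R : realType) (z : R[i]) : R := ComplexField.Normc.normc z.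

Definition realline (R : realType) (f : R[i] -> R[i]) (x : R) : R :=
  complex.Re (f x%:C).

Definition cintegral d (T : measurableType d) (R : realType)
    (mu : {measure set T -> \bar R}) (D : set T) (f : T -> R[i]) : R[i] :=
  (\int[mu]_(x in D) complex.Re (f x)) +i* (\int[mu]_(x in D) complex.Im (f x)).

Definition cderivable (R : realType) (f : R[i] -> R[i]) (z : R[i]) : Prop :=
  @derivable (R[i] : numFieldType) (R[i] : numFieldType) (R[i] : numFieldType)
    f z 1.

Definition entire (R : realType) (f : R[i] -> R[i]) : Prop :=
  forall z, cderivable f z.

(* Elements of L^2 are represented by measurable functions, not by classes. *)
Definition rL2 d (T : measurableType d) (R : realType)
    (mu : {measure set T -> \bar R}) : set (T -> R) :=
  [set f | f \in Lfun mu 2%:E].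

Definition rL2norm d (T : measurableType d) (R : realType)
    (mu : {measure set T -> \bar R}) (f : T -> R) : \bar R :=
  ('N[mu]_(2%:E)[EFin \o f])%E.

Definition cL2 d (T : measurableType d) (R : realType)
    (mu : {measure set T -> \bar R}) : set (T -> R[i]) :=
  [set f | rL2 mu (fun x => complex.Re (f x)) /\
           rL2 mu (fun x => complex.Im (f x))].

Definition cL2norm d (T : measurableType d) (R : realType)
    (mu : {measure set T -> \bar R}) (f : T -> R[i]) : \bar R :=
  rL2norm mu (fun x => normc (f x)).

Definition lin_span (K : pzRingType) (T J : Type) (D : set J)
    (e : J -> T -> K) : set (T -> K) :=
  [set f | exists n (c : 'I_n -> K) (j : 'I_n -> J),
     (forall k, D (j k)) /\ f = (fun x => \sum_(k < n) c k * e (j k) x)].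

Definition closed_rspan d (T : measurableType d) (R : realType)
    (mu : {measure set T -> \bar R}) (J : Type) (D : set J) (e : J -> T -> R) :
    set (T -> R) :=
  [set f | rL2 mu f /\ forall eps : R, 0 < eps ->
     exists2 h, lin_span D e h & (rL2norm mu (f \- h)%R < eps%:E)%E].

Definition closed_cspan d (T : measurableType d) (R : realType)
    (mu : {measure set T -> \bar R}) (J : Type) (D : set J)
    (e : J -> T -> R[i]) : set (T -> R[i]) :=
  [set f | cL2 mu f /\ forall eps : R, 0 < eps ->
     exists2 h, lin_span D e h & (cL2norm mu (f \- h)%R < eps%:E)%E].

Definition orthonormal_basis d (T : measurableType d) (R : realType)
    (mu : {measure set T -> \bar R}) (e : nat -> T -> R) : Prop :=
  [/\ forall n, rL2 mu (e n),
      forall m n, \int[mu]_x (e m x * e n x) = (m == n)%:R &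
      closed_rspan mu setT e = rL2 mu].

(* Square integrability only sees the values on [0, r]; outside, functions are
   replaced by a constant, so that nothing is asked of them there. *)
Definition orthonormal_basis_itv (R : realType) (r : R)
    (e : nat -> R -> R) : Prop :=
  orthonormal_basis (mrestr (@lebesgue_measure R) (measurable_itv `[0, r]))
    (fun n => e n \_ `[0, r]).

Definition de_branges_function (R : realType) (E : R[i] -> R[i]) : Prop :=
  entire E /\ forall z, 0 < complex.Im z -> normc (E (z^*)) < normc (E z).

Definition exponential_type (R : realType) (E : R[i] -> R[i]) : Prop :=
  exists c tau : R, forall z, normc (E z) <= c * expR (tau * normc z).

Definition bounded_analytic (R : realType) (g : R[i] -> R[i]) : Prop :=
  (forall z, 0 < complex.Im z -> cderivable g z) /\
  exists c : R, forall z, 0 < complex.Im z -> normc (g z) <= c.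

Definition bounded_type (R : realType) (g : R[i] -> R[i]) : Prop :=
  exists p q : R[i] -> R[i],
    [/\ bounded_analytic p, bounded_analytic q,
        exists2 z, 0 < complex.Im z & q z != 0 &
        forall z, 0 < complex.Im z -> q z * g z = p z].

Definition mean_type (R : realType) (g : R[i] -> R[i]) : \bar R :=
  limf_esup (fun y : R => (y^-1)%:E * lne (normc (g (0 +i* y)))%:E)%E
    (@pinfty_nbhs R).

Definition sharp (R : realType) (f : R[i] -> R[i]) (z : R[i]) : R[i] :=
  (f (z^*))^*.

Definition de_branges_space (R : realType) (E : R[i] -> R[i]) :
    set (R[i] -> R[i]) :=
  [set f | [/\ entire f,
     cL2 (@lebesgue_measure R) (fun x => f x%:C / E x%:C),
     bounded_type (fun z => f z / E z) /\
       bounded_type (fun z => sharp f z / E z) &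
     (mean_type (fun z => f z / E z)%R <= 0)%E /\
       (mean_type (fun z => sharp f z / E z)%R <= 0)%E]].

Definition de_branges_norm (R : realType) (E f : R[i] -> R[i]) : \bar R :=
  cL2norm (@lebesgue_measure R) (fun x => f x%:C / E x%:C).

(* [dalpha] is the derivative of [alpha]; since [alpha] and [dalpha] are
   continuous on [0, +oo[, [dalpha 0] is the right derivative at 0. *)
Definition structure_function (R : realType) (alpha dalpha : R -> R) : Prop :=
  [/\ alpha 0 = 0,
      {within `[0, +oo[, continuous alpha},
      {within `[0, +oo[, continuous dalpha},
      forall t : R, 0 < t -> is_derive t (1 : R) alpha (dalpha t) &
      forall t, 0 <= t -> 0 < dalpha t].

Definition chainE (R : realType) (A B : R -> R[i] -> R[i]) (t : R) :
    R[i] -> R[i] := fun z => A t z - 'i * B t z.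

(* The integrals against d gamma_u = du / alpha'_u and d alpha_u = alpha'_u du
   are written with their densities; gamma itself is not needed. *)
Definition de_branges_chain (R : realType) (alpha dalpha : R -> R)
    (A B : R -> R[i] -> R[i]) : Prop :=
  [/\ structure_function alpha dalpha,
      (forall t, 0 <= t -> entire (A t) /\ entire (B t)) /\
      (forall z,
        {within `[0, +oo[, continuous (A ^~ z : R -> (R[i] : numFieldType))} /\
        {within `[0, +oo[, continuous (B ^~ z : R -> (R[i] : numFieldType))}),
      forall t z, 0 <= t ->
        1 - A t z = z * cintegral (@lebesgue_measure R) `[0, t]
                          (fun u => B u z / (dalpha u)%:C) /\
        B t z = z * cintegral (@lebesgue_measure R) `[0, t]
                      (fun u => A u z * (dalpha u)%:C),
      forall t, 0 < t -> de_branges_function (chainE A B t) &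
      forall t, 0 <= t -> exponential_type (chainE A B t)].

(* The limit, as w and z tend to the real point l, of the reproducing kernel
   (A(w^* ) B(z) - B(w^* ) A(z)) / (pi (z - w^* )). *)
Definition diag_kernel (R : realType) (A B : R -> R[i] -> R[i]) (r l : R) : R :=
  (realline (A r) l * derive1 (realline (B r)) l
   - derive1 (realline (A r)) l * realline (B r) l) / pi.

(* The quotients (e^{itl} - 1) / l, sin (ul) / l and B_t(l) / l have removable
   singularities at l = 0; the value there is written out because 0^-1 = 0. *)

Definition exp_quot (R : realType) (t l : R) : R[i] :=
  if l == 0 then 0 +i* t else (cos (l * t) +i* sin (l * t) - 1) / l%:C.

Definition sin_quot (R : realType) (u l : R) : R :=
  if l == 0 then u else sin (u * l) / l.

Definition B_quot (R : realType) (B : R -> R[i] -> R[i]) (t l : R) : R :=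
  if l == 0 then derive1 (realline (B t)) 0 else realline (B t) l / l.

Definition spectral_measure (R : realType)
    (mu : {measure set (measurableTypeR R) -> \bar R}) : Prop :=
  (forall S : set (measurableTypeR R), measurable S ->
     mu [set l | S (- l)] = mu S) /\
  (\int[mu]_l ((1 + l ^+ 2)^-1)%:E < +oo)%E.

Definition normal_law d (T : measurableType d) (R : realType)
    (P : probability T R) (m s : R) (Y : T -> R) : Prop :=
  forall S : set (measurableTypeR R), measurable S ->
    P (Y @^-1` S) = normal_prob m s S.

(* [normal_prob m 0] is a junk value, so constants are treated apart. *)
Definition gaussian d (T : measurableType d) (R : realType)
    (P : probability T R) (Y : T -> R) : Prop :=
  exists m s : R, 0 <= s /\
    if s == 0 then {ae P, forall x, Y x = m} else normal_law P m s Y.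

Definition gaussian_process d (T : measurableType d) (R : realType)
    (P : probability T R) (J : Type) (X : J -> T -> R) : Prop :=
  forall Y, lin_span setT X Y -> gaussian P Y.

Definition ms_continuous d (T : measurableType d) (R : realType)
    (P : probability T R) (D : set R) (X : R -> T -> R) : Prop :=
  forall t, D t ->
    (fun s => 'E_P[(fun x => (X s x - X t x) ^+ 2)%R]%E) @ within D (nbhs t)
      --> (0 : \bar R).

Definition si_process d (T : measurableType d) (R : realType)
    (P : probability T R) (mu : {measure set (measurableTypeR R) -> \bar R})
    (X : R -> {RV P >-> R}) : Prop :=
  [/\ spectral_measure mu,
      gaussian_process P (fun t => X t : T -> R),
      forall t, 'E_P[X t]%E = 0%E,
      ms_continuous P setT (fun t => X t : T -> R) &
      forall s t, (fine 'E_P[(fun x => X s x * X t x)%R]%E)%:C =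
        cintegral mu setT (fun l => exp_quot s l * (exp_quot t l)^*)].

Definition determined_by_chain (R : realType)
    (mu : {measure set (measurableTypeR R) -> \bar R})
    (E : R -> R[i] -> R[i]) : Prop :=
  forall t, 0 < t ->
    (forall f, de_branges_space (E t) f ->
       cL2 mu (fun x : R => f x%:C) /\
       cL2norm mu (fun x : R => f x%:C) = de_branges_norm (E t) f) /\
    (forall g : R -> R[i], cL2 mu g ->
       (closed_cspan mu [set u : R | `|u| <= t] (@exp_quot R) g <->
        exists2 f, de_branges_space (E t) f &
                   {ae mu, forall x, g x = f x%:C})).

Definition even_part d (T : measurableType d) (R : realType)
    (P : probability T R) (X : R -> {RV P >-> R}) (t : R) (x : T) : R :=
  (X t x - X (- t) x) / 2.

Definition spectral_space (R : realType)
    (mu : {measure set (measurableTypeR R) -> \bar R}) : set (R -> R) :=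
  closed_rspan mu [set u : R | 0 <= u] (@sin_quot R).

Definition even_space d (T : measurableType d) (R : realType)
    (P : probability T R) (X : R -> {RV P >-> R}) : set (T -> R) :=
  closed_rspan P [set u : R | 0 <= u] (even_part X).

(* The linear isometry of [spectral_space mu] onto [even_space X], acting on
   representatives; its values outside [spectral_space mu] are irrelevant. *)
Definition even_isometry d (T : measurableType d) (R : realType)
    (P : probability T R) (mu : {measure set (measurableTypeR R) -> \bar R})
    (X : R -> {RV P >-> R}) (iso : (R -> R) -> T -> R) : Prop :=
  [/\ forall f, spectral_space mu f ->
        even_space X (iso f) /\ rL2norm P (iso f) = rL2norm mu f,
      forall (a : R) f g, spectral_space mu f -> spectral_space mu g ->
        {ae P, forall x, iso (fun l => a * f l + g l) x = a * iso f x + iso g x},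
      forall Y, even_space X Y ->
        exists2 f, spectral_space mu f & {ae P, forall x, iso f x = Y x} &
      forall u, 0 <= u -> {ae P, forall x, iso (sin_quot u) x = even_part X u x}].

Definition even_fundamental_martingale d (T : measurableType d) (R : realType)
    (P : probability T R) (mu : {measure set (measurableTypeR R) -> \bar R})
    (X : R -> {RV P >-> R}) (B : R -> R[i] -> R[i])
    (M : R -> {RV P >-> R}) : Prop :=
  exists2 iso, even_isometry mu X iso &
    forall t, 0 <= t -> spectral_space mu (B_quot B t) /\
      {ae P, forall x, M t x = iso (B_quot B t) x}.

Definition mutually_independent d (T : measurableType d) (R : realType)
    (P : probability T R) (xi : nat -> {RV P >-> R}) : Prop :=
  forall (s : seq nat) (S : nat -> set (measurableTypeR R)), uniq s ->
    (forall n, measurable (S n)) ->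
    P (\bigcap_(n in [set` s]) (xi n @^-1` S n)) =
      (\prod_(n <- s) P (xi n @^-1` S n))%E.

Definition uniform_ms_series d (T : measurableType d) (R : realType)
    (P : probability T R) (r : R) (Y : R -> T -> R) (w : nat -> R)
    (e : nat -> R -> R) (xi : nat -> T -> R) : Prop :=
  forall eps : R, 0 < eps -> \forall N \near \oo, forall t, 0 <= t <= r ->
    ('E_P[(fun x => (Y t x - \sum_(n < N) w n * e n t * xi n x) ^+ 2)%R]
       <= eps%:E)%E.

Definition karhunen_loeve d (T : measurableType d) (R : realType)
    (P : probability T R) (r : R) (Y : R -> T -> R) (w : nat -> R)
    (e : nat -> R -> R) (xi : nat -> T -> R) : Prop :=
  [/\ ms_continuous P `[0, r] Y,
      orthonormal_basis_itv r e,
      forall n t, 0 <= t <= r ->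
        \int[@lebesgue_measure R]_(s in `[0, r])
          (fine (covariance P (Y s) (Y t)) * e n s) = w n ^+ 2 * e n t,
      forall m n, 'E_P[(fun x => xi m x * xi n x)%R]%E = (m == n)%:R%:E &
      uniform_ms_series P r Y w e xi].

Definition bridge d (T : measurableType d) (R : realType)
    (P : probability T R) (alpha : R -> R) (M : R -> {RV P >-> R})
    (r t : R) (x : T) : R :=
  M t x - alpha t / alpha r * M r x.

Definition positive_zeros (R : realType) (f : R[i] -> R[i]) : set R :=
  [set l | 0 < l /\ f l%:C = 0].

Definition kl_function (R : realType) (dalpha : R -> R)
    (B : R -> R[i] -> R[i]) (l t : R) : R :=
  realline (B t) l / Num.sqrt (dalpha t).

Definition kl_coefficient (R : realType) (A B : R -> R[i] -> R[i])
    (r l : R) : R :=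
  l^-1 * Num.sqrt (2 / (pi * diag_kernel A B r l)).

(* Main.v *)
(* For real z the chain is the canonical system A' = - z B / w, B' = z A w with
   w = alpha', so that y = B(lam) with B_r(lam) = 0 solves the Dirichlet problem
   - w (y' / w)' = lam^2 y on [0, r], whose Green function
   alpha_(s /\ t) - alpha_s alpha_t / alpha_r is, up to the factor pi, the
   covariance of the bridge.  The Wiener integrals int A_u(lam) dM_u over the
   positive zeros lam of B_r are orthogonal, and subtracting from the bridge its
   projection on finitely many of them leaves a process whose covariance is the
   Green function minus a partial Mercer sum.  Hence this remainder kernel is
   positive semidefinite, and its smallness is a spectral statement: orthogonally
   to the eigenfunctions with parameter below L the Green operator is bounded by
   L^-2.  Testing against bumps makes the remainder uniformly O(L^-1/2) on the
   diagonal, which is the uniform mean-square convergence; letting it tend to 0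
   also puts the Green functions in the closed span of the eigenfunctions, and
   their difference quotients give indicator functions, whence completeness.
   The coefficients lie in the closed Gaussian span of X, where orthogonality is
   independence. *)

Require Import Defs.
From HB Require Import structures.
From mathcomp Require Import all_boot all_order all_algebra.
From mathcomp Require Import complex.
From mathcomp Require Import all_classical all_reals all_analysis.
From mathcomp Require Import measurable_realfun lebesgue_integral_under ring lra.
Set Implicit Arguments.
Unset Strict Implicit.
Unset Printing Implicit Defensive.

Import Order.TTheory GRing.Theory Num.Theory.
Import numFieldNormedType.Exports.
Import HBNNSimple.

Local Open Scope classical_set_scope.
Local Open Scope ring_scope.
Local Open Scope complex_scope.

(** * Square integrable functions *)

(** The remainder kernel is positive semidefinite for a probabilistic reason, while the estimates on
    it are analytic. Hence Wiener integrals are built for every real parameter [k] before the zeros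
    of B_r are listed, positivity enters the Sturm-Liouville section as the hypothesis [rest_psd],
    and partial sums run over finite duplicate-free lists of zeros. That the zeros are infinite in
    number and locally finite is then read off from bounds on this kernel. The spectral input is
    elementary: the initial value problem with parameter k shows that 1 - k^2 G, with G the Green
    operator, is bounded below wherever the Rayleigh argument needs it.

    Origin of the constants: let N_n be the integral of B_t(lam_n)^2 against dgamma_t. The Lagrange
    identity gives pi K_r(lam_n, lam_n) = 2 N_n, so sqrt (2 / (pi K_r)) is the inverse norm of
    phi_n. The Wiener integral times this factor has variance pi, the pi of E M_t^2 = pi alpha_t.
    With variables of variance 1 the series therefore has eigenvalues pi / lam_n^2 and
    eigenfunctions phi_n / sqrt N_n. *)

Lemma Rintegral_dct d (T : measurableType d) (R : realType)
    (mu : {measure set T -> \bar R}) (f_ : nat -> T -> R) (f g : T -> R) :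
  (forall n, measurable_fun setT (f_ n)) ->
  (forall x, f_ n x @[n --> \oo] --> f x) ->
  mu.-integrable setT (EFin \o g) -> (forall n x, `|f_ n x| <= g x) ->
  \int[mu]_x f_ n x @[n --> \oo] --> \int[mu]_x f x.
Proof.
move=> mf ff ig fg.
have mfl : measurable_fun setT f by exact: measurable_fun_cvg mf (fun x _ => ff x).
have mf' n : measurable_fun setT (EFin \o f_ n) by exact/measurable_EFinP.
have mfl' : measurable_fun setT (EFin \o f) by exact/measurable_EFinP.
have ff' : {ae mu, forall x, setT x -> (EFin \o f_ n) x @[n --> \oo] --> (EFin \o f) x}.
  by apply: nearW => x _; apply: cvg_EFin; [exact: nearW|exact: ff].
have fg' : {ae mu, forall x n, setT x -> (`|(EFin \o f_ n) x| <= (EFin \o g) x)%E}.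
  by apply: nearW => x n _; rewrite lee_fin.
have [i_f _ H] := dominated_convergence measurableT mf' mfl' ff' ig fg'.
apply: fine_cvg; rewrite fineK; last exact: integrable_fin_num.
exact: H.
Qed.

Lemma discriminant_le (R : realFieldType) (a b c : R) : 0 <= c ->
  (forall x, 0 <= a + 2 * x * b + x ^+ 2 * c) -> b ^+ 2 <= a * c.
Proof.
rewrite le_eqVlt => /predU1P[<-|c0] key; last first.
  rewrite -subr_ge0.
  rewrite (_ : _ - _ = c * (a + 2 * - (b / c) * b + (- (b / c)) ^+ 2 * c)).
    by rewrite mulr_ge0// ltW.
  by field; rewrite gt_eqF.
rewrite mulr0; have [->|b0] := eqVneq b 0; first by rewrite expr0n.
(* With [c = 0] the form is affine in [x], and this [x] gives it the value -1. *)
have := key (- (a + 1) / (2 * b)); rewrite mulr0 addr0 (_ : _ + _ = -1); last by field.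
by rewrite oppr_ge0 ler10.
Qed.

Section square_integrable.
Context d (T : measurableType d) (R : realType).
Variable mu : {measure set T -> \bar R}.
Implicit Types f g h : T -> R.

Definition dot f g : R := \int[mu]_x (f x * g x).

Lemma L2_measurable f : rL2 mu f -> measurable_fun setT f.
Proof. by move=> /andP[/[!inE]]. Qed.

Lemma L2_integrable_mul f g : rL2 mu f -> rL2 mu g ->
  mu.-integrable setT (fun x => (f x * g x)%:E).
Proof. by move=> lf lg; exact/(Lfun1_integrable _ _).1/Lfun2_mul_Lfun1. Qed.

Lemma rL2normE f : measurable_fun setT f ->
  mu.-integrable setT (fun x => (f x * f x)%:E) ->
  rL2norm mu f = (Num.sqrt (dot f f))%:E.
Proof.
move=> mf fi; rewrite /rL2norm unlock /dot /Rintegral.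
rewrite (_ : (\int[mu]_x _)%E = (\int[mu]_x (f x * f x)%:E)%E); last first.
  apply: eq_integral => x _ /=.
  by rewrite powR_mulrn// -expr2 real_normK ?num_real// expr2.
rewrite -(@fineK _ (\int[mu]_x (f x * f x)%:E)%E); last exact: integrable_fin_num.
rewrite poweR_EFin powR12_sqrt// fine_ge0//.
by apply: integral_ge0 => x _; rewrite lee_fin -expr2 sqr_ge0.
Qed.

Lemma L2I f : measurable_fun setT f ->
  mu.-integrable setT (fun x => (f x * f x)%:E) -> rL2 mu f.
Proof.
move=> mf fi; rewrite /rL2/= inE; apply/andP; split; rewrite inE//=.
by have := rL2normE mf fi; rewrite /rL2norm /finite_norm => ->; rewrite ltry.
Qed.

Lemma L2_le f g : measurable_fun setT f -> rL2 mu g ->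
  (forall x, `|f x| <= `|g x|) -> rL2 mu f.
Proof.
move=> mf lg fg; apply: L2I => //.
apply: le_integrable (L2_integrable_mul lg lg) => //.
  by apply/measurable_EFinP; exact: measurable_funM.
by move=> x _; rewrite lee_fin !normrM ler_pM.
Qed.

Lemma L2Z (c : R) f : rL2 mu f -> rL2 mu (fun x => c * f x).
Proof.
move=> lf; have mf := L2_measurable lf; apply: L2I.
  exact: measurable_funM.
have := integrableZl measurableT (c * c) (L2_integrable_mul lf lf).
apply: eq_integrable => // x _; rewrite -EFinM; congr EFin; ring.
Qed.

Lemma L2D f g : rL2 mu f -> rL2 mu g -> rL2 mu (fun x => f x + g x).
Proof.
move=> lf lg; have mf := L2_measurable lf; have mg := L2_measurable lg.
apply: L2I; first exact: measurable_funD.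
have := integrableD measurableT (integrableD measurableT
  (L2_integrable_mul lf lf) (L2_integrable_mul lg lg))
  (integrableZl measurableT 2 (L2_integrable_mul lf lg)).
apply: eq_integrable => // x _ /=; rewrite -!EFinM -!EFinD; congr EFin; ring.
Qed.

Lemma L2N f : rL2 mu f -> rL2 mu (fun x => - f x).
Proof. by move=> /(L2Z (-1)); under eq_fun do rewrite mulN1r. Qed.

Lemma L2B f g : rL2 mu f -> rL2 mu g -> rL2 mu (fun x => f x - g x).
Proof. by move=> lf /L2N; exact: L2D. Qed.

Lemma L2_0 : rL2 mu (fun=> 0).
Proof.
by apply: L2I => //; under eq_fun do rewrite mul0r; exact: integrable0.
Qed.

Lemma L2_sum (J : Type) (s : seq J) (p : pred J) (f : J -> T -> R) :
  (forall i, p i -> rL2 mu (f i)) -> rL2 mu (fun x => \sum_(i <- s | p i) f i x).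
Proof.
move=> lf; elim: s => [|i s ih].
  by under eq_fun do rewrite big_nil; exact: L2_0.
under eq_fun do rewrite big_cons.
by case: (boolP (p i)) => // pi; apply: L2D => //; exact: lf.
Qed.

Lemma dotC f g : dot f g = dot g f.
Proof. by apply: eq_Rintegral => x _; rewrite mulrC. Qed.

Lemma dotDl f g h : rL2 mu f -> rL2 mu g -> rL2 mu h ->
  dot (fun x => f x + g x) h = dot f h + dot g h.
Proof.
move=> lf lg lh; rewrite /dot -RintegralD//; last 2 first.
- exact: L2_integrable_mul.
- exact: L2_integrable_mul.
by apply: eq_Rintegral => x _; rewrite mulrDl.
Qed.

Lemma dotZl (c : R) f g : rL2 mu f -> rL2 mu g ->
  dot (fun x => c * f x) g = c * dot f g.
Proof.
move=> lf lg; rewrite /dot -RintegralZl//; last exact: L2_integrable_mul.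
by apply: eq_Rintegral => x _; rewrite mulrA.
Qed.

Lemma dotDr f g h : rL2 mu f -> rL2 mu g -> rL2 mu h ->
  dot h (fun x => f x + g x) = dot h f + dot h g.
Proof. by move=> *; rewrite dotC dotDl// !(dotC h). Qed.

Lemma dotZr (c : R) f g : rL2 mu f -> rL2 mu g ->
  dot g (fun x => c * f x) = c * dot g f.
Proof. by move=> *; rewrite dotC dotZl// dotC. Qed.

Lemma dotNl f g : rL2 mu f -> rL2 mu g -> dot (fun x => - f x) g = - dot f g.
Proof.
move=> lf lg; rewrite -mulN1r -dotZl//.
by congr dot; apply/funext => x; rewrite mulN1r.
Qed.

Lemma dotBl f g h : rL2 mu f -> rL2 mu g -> rL2 mu h ->
  dot (fun x => f x - g x) h = dot f h - dot g h.
Proof. by move=> lf lg lh; rewrite dotDl ?dotNl//; exact: L2N. Qed.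

Lemma dotBr f g h : rL2 mu f -> rL2 mu g -> rL2 mu h ->
  dot h (fun x => f x - g x) = dot h f - dot h g.
Proof. by move=> *; rewrite dotC dotBl// !(dotC h). Qed.

Lemma dot_suml (J : Type) (s : seq J) (f : J -> T -> R) g :
  (forall i, rL2 mu (f i)) -> rL2 mu g ->
  dot (fun x => \sum_(i <- s) f i x) g = \sum_(i <- s) dot (f i) g.
Proof.
move=> lf lg; elim: s => [|i s ih].
  rewrite big_nil /dot; under eq_Rintegral do rewrite big_nil mul0r.
  by rewrite Rintegral_cst// mul0r.
rewrite big_cons -ih -dotDl//; last exact: L2_sum.
by congr dot; apply/funext => x; rewrite big_cons.
Qed.

Lemma dot_sumr (J : Type) (s : seq J) (f : J -> T -> R) g :
  (forall i, rL2 mu (f i)) -> rL2 mu g ->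
  dot g (fun x => \sum_(i <- s) f i x) = \sum_(i <- s) dot g (f i).
Proof.
by move=> lf lg; rewrite dotC dot_suml//; apply: eq_bigr => i _; rewrite dotC.
Qed.

Lemma dot_ge0 f : 0 <= dot f f.
Proof. by apply: Rintegral_ge0 => x _; rewrite -expr2 sqr_ge0. Qed.

Lemma dot_CS f g : rL2 mu f -> rL2 mu g ->
  dot f g ^+ 2 <= dot f f * dot g g.
Proof.
move=> lf lg.
have key c : 0 <= dot f f + 2 * c * dot f g + c ^+ 2 * dot g g.
  have lc := L2Z c lg; have := dot_ge0 (fun x => f x + c * g x).
  rewrite dotDl ?dotDr ?dotZl ?dotZr//; last exact: L2D.
  rewrite (dotC g f); lra.
exact: discriminant_le (dot_ge0 g) key.
Qed.

Lemma dot_le_sqrt f g : rL2 mu f -> rL2 mu g ->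
  `|dot f g| <= Num.sqrt (dot f f) * Num.sqrt (dot g g).
Proof.
move=> lf lg; rewrite -sqrtrM ?dot_ge0// -sqrtr_sqr ler_wsqrtr//.
exact: dot_CS.
Qed.

Definition dist f g : R := Num.sqrt (dot (fun x => f x - g x) (fun x => f x - g x)).

Lemma distC f g : dist f g = dist g f.
Proof.
by congr Num.sqrt; apply: eq_Rintegral => x _; rewrite -(opprB (g x)) mulrNN.
Qed.

Lemma dist_ge0 f g : 0 <= dist f g.
Proof. exact: sqrtr_ge0. Qed.

Lemma dist_sqr f g : dist f g ^+ 2 = dot (fun x => f x - g x) (fun x => f x - g x).
Proof. by rewrite sqr_sqrtr// dot_ge0. Qed.

Lemma sqrt_dotD f g : rL2 mu f -> rL2 mu g ->
  Num.sqrt (dot (fun x => f x + g x) (fun x => f x + g x)) <=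
  Num.sqrt (dot f f) + Num.sqrt (dot g g).
Proof.
move=> lf lg; have sf := sqrtr_ge0 (dot f f); have sg := sqrtr_ge0 (dot g g).
rewrite -(ler_pXn2r (n := 2))// ?nnegrE ?sqrtr_ge0// ?addr_ge0//.
rewrite sqr_sqrtr ?dot_ge0// dotDl// ?dotDr//; last exact: L2D.
have := dot_le_sqrt lf lg; rewrite (dotC g f).
have := sqr_sqrtr (dot_ge0 f); have := sqr_sqrtr (dot_ge0 g).
move: (Num.sqrt _) (Num.sqrt _) sf sg => a b a0 b0.
by rewrite ler_norml => *; nra.
Qed.

Lemma dist_triangle g f h : rL2 mu f -> rL2 mu g -> rL2 mu h ->
  dist f h <= dist f g + dist g h.
Proof.
move=> lf lg lh; have := sqrt_dotD (L2B lf lg) (L2B lg lh).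
by under eq_fun do rewrite addrA subrK.
Qed.

Lemma dotB_dist f g h : rL2 mu f -> rL2 mu g -> rL2 mu h ->
  `|dot f h - dot g h| <= dist f g * Num.sqrt (dot h h).
Proof. by move=> lf lg lh; rewrite -dotBl//; apply: dot_le_sqrt => //; exact: L2B. Qed.

Lemma cvg_dist_dot (f_ : nat -> T -> R) f g :
  (forall n, rL2 mu (f_ n)) -> rL2 mu f -> rL2 mu g ->
  dist (f_ n) f @[n --> \oo] --> 0 -> dot (f_ n) g @[n --> \oo] --> dot f g.
Proof.
move=> lfn lf lg df; apply/subr_cvg0/norm_cvg0P.
apply: (@squeeze_cvgr _ _ _ _ (fun=> 0) (fun n => dist (f_ n) f * Num.sqrt (dot g g))).
- by apply: nearW => n; rewrite normr_ge0 dotB_dist.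
- exact: cvg_cst.
- by rewrite -[X in _ --> X](mul0r (Num.sqrt (dot g g))); apply: cvgMr_tmp.
Qed.

(** Closed spans are defined with an extended-valued norm; for square integrable generators that
    norm is the real number [dist], in which all later approximations are made. *)
Lemma closed_rspanP (J : Type) (D : set J) (e : J -> T -> R) f :
  (forall j, D j -> rL2 mu (e j)) ->
  closed_rspan mu D e f <-> rL2 mu f /\
    forall eps, 0 < eps -> exists2 h, lin_span D e h & dist f h < eps.
Proof.
move=> le.
have lh h : lin_span D e h -> rL2 mu h.
  by move=> [n [c [j [Dj ->]]]]; apply: L2_sum => k _; apply: L2Z; exact: le.
have E h : rL2 mu f -> lin_span D e h -> rL2norm mu (f \- h) = (dist f h)%:E.
  move=> lf hh; have lfh := L2B lf (lh h hh); apply: rL2normE.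
    exact: L2_measurable.
  exact: L2_integrable_mul.
split=> -[lf H]; split=> // eps /H[h hh] hlt; exists h => //.
- by rewrite -lte_fin -E.
- by rewrite E.
Qed.

Lemma lin_spanZD (J : Type) (D : set J) (e : J -> T -> R) (c : R) f g :
  lin_span D e f -> lin_span D e g -> lin_span D e (fun x => c * f x + g x).
Proof.
move=> [n [a [j [Dj ->]]]] [m [b [k [Dk ->]]]].
exists (n + m)%N, (fun i => match fintype.split i with inl i => c * a i | inr i => b i end),
  (fun i => match fintype.split i with inl i => j i | inr i => k i end); split.
  by move=> i; case: splitP => ? _.
apply/funext => x; rewrite big_split_ord/= mulr_sumr; congr (_ + _).
  by apply: eq_bigr => i _; rewrite (unsplitK (inl i)) mulrA.
by apply: eq_bigr => i _; rewrite (unsplitK (inr i)).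
Qed.

Lemma lin_span_base (J : Type) (D : set J) (e : J -> T -> R) j :
  D j -> lin_span D e (e j).
Proof.
move=> Dj; exists 1%N, (fun=> 1), (fun=> j); split => //.
by apply/funext => x; rewrite big_ord1 mul1r.
Qed.

Section closed_span.
Variables (J : Type) (D : set J) (e : J -> T -> R).
Hypothesis le : forall j, D j -> rL2 mu (e j).

Lemma closed_rspan_lin f : lin_span D e f -> closed_rspan mu D e f.
Proof.
move=> fh; apply/closed_rspanP => //; split.
  by case: fh => n [c [j [Dj ->]]]; apply: L2_sum => k _; apply: L2Z; exact: le.
move=> eps eps0; exists f => //; rewrite /dist /dot.
by under eq_Rintegral do rewrite subrr mul0r; rewrite Rintegral_cst// mul0r sqrtr0.
Qed.

Lemma closed_rspanZD (c : R) f g : closed_rspan mu D e f -> closed_rspan mu D e g ->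
  closed_rspan mu D e (fun x => c * f x + g x).
Proof.
move=> /(closed_rspanP _ le)[lf Hf] /(closed_rspanP _ le)[lg Hg].
apply/closed_rspanP => //; split; first by apply: L2D => //; exact: L2Z.
move=> eps eps0.
(* The added 1 keeps the tolerance for [f] positive and finite when [c = 0]. *)
have c0 : 0 < `|c| + 1 by rewrite ltr_wpDl.
have e2 : 0 < eps / 2 by rewrite divr_gt0.
have [f' sf' df'] := Hf (eps / 2 / (`|c| + 1)) (divr_gt0 e2 c0).
have [g' sg' dg'] := Hg _ e2.
have lf' : rL2 mu f' by case: (closed_rspan_lin sf').
have lg' : rL2 mu g' by case: (closed_rspan_lin sg').
exists (fun x => c * f' x + g' x); first exact: lin_spanZD.
have lff := L2B lf lf'; have lgg := L2B lg lg'.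
rewrite /dist (_ : (fun x => _ - _) =
  (fun x => c * (f x - f' x) + (g x - g' x))); last by apply/funext => x; ring.
apply: le_lt_trans (sqrt_dotD (L2Z c lff) lgg) _.
rewrite dotZl// ?dotZr//; last exact: L2Z.
rewrite mulrA -expr2 sqrtrM ?sqr_ge0// sqrtr_sqr -/(dist f f') -/(dist g g').
have := dist_ge0 f f'; have := normr_ge0 c.
have : `|c| * dist f f' <= eps / 2.
  apply: le_trans (ler_wpM2l _ (ltW df')) _ => //.
  rewrite mulrCA ler_piMr//; first exact: ltW.
  by rewrite ler_pdivrMr// mul1r; lra.
lra.
Qed.

Lemma closed_rspan_closed f : rL2 mu f ->
  (forall eps, 0 < eps -> exists2 g, closed_rspan mu D e g & dist f g < eps) ->
  closed_rspan mu D e f.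
Proof.
move=> lf H; apply/closed_rspanP => //; split => // eps eps0.
have e2 : 0 < eps / 2 by rewrite divr_gt0.
have [g gW fg] := H _ e2.
have /(closed_rspanP _ le)[lg /(_ _ e2)[h hh gh]] := gW.
exists h => //; apply: le_lt_trans (@dist_triangle g _ _ lf lg _) _; last lra.
by case: (closed_rspan_lin hh).
Qed.

End closed_span.

End square_integrable.

Lemma limn_einf_le_near (R : realType) (u : (\bar R)^nat) (c : \bar R) :
  (\forall n \near \oo, (u n <= c)%E) -> (limn_einf u <= c)%E.
Proof.
move=> uc; rewrite limn_einf_lim; apply: lime_le; first exact: is_cvg_einfs.
near=> n; apply: le_trans (_ : u n <= c)%E; last by near: n.
by apply: ereal_inf_lbound; exists n => /=.
Unshelve. all: by end_near. Qed.

(** * Completeness of L^2 of a probability space *)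

Section riesz_fischer.
Context d (T : measurableType d) (R : realType) (P : probability T R).

Lemma L2_cst (c : R) : rL2 P (fun=> c).
Proof. exact: Lfun_cst. Qed.

Lemma Rintegral_prob_cst (c : R) : \int[P]_x c = c.
Proof.
by rewrite Rintegral_cst//; have /= -> := probability_setT P; rewrite mulr1.
Qed.

Lemma L2_integrable (f : T -> R) : rL2 P f -> P.-integrable setT (EFin \o f).
Proof.
move=> lf; have := L2_integrable_mul lf (L2_cst 1).
by under eq_fun do rewrite mulr1.
Qed.

Lemma expectation_abs_le (f : T -> R) : rL2 P f ->
  \int[P]_x `|f x| <= Num.sqrt (dot P f f).
Proof.
move=> lf; have mf := L2_measurable lf.
have lnf : rL2 P (fun x => `|f x|).
  apply: L2_le lf _; first exact: measurableT_comp.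
  by move=> x; rewrite normr_id.
have := dot_le_sqrt lnf (L2_cst 1).
have -> : dot P (fun x => `|f x|) (fun=> 1) = \int[P]_x `|f x|.
  by apply: eq_Rintegral => x _; rewrite mulr1.
have -> : dot P (fun x => `|f x|) (fun x => `|f x|) = dot P f f.
  by apply: eq_Rintegral => x _; rewrite -!expr2 real_normK ?num_real.
have -> : dot P (fun=> 1) (fun=> 1) = 1.
  by rewrite /dot; under eq_Rintegral do rewrite mulr1; exact: Rintegral_prob_cst.
by rewrite sqrtr1 mulr1; apply: le_trans; exact: ler_norm.
Qed.

(* Completeness, for sequences converging fast enough that no extraction is
   needed: the increments are summable in L^1, hence almost everywhere. *)
Lemma L2_complete (f_ : nat -> T -> R) (C : R) : (forall n, rL2 P (f_ n)) ->
  (forall n, dist P (f_ n.+1) (f_ n) <= C / (2 ^ n.+1)%:R) ->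
  exists2 f, rL2 P f & dist P (f_ n) f @[n --> \oo] --> 0.
Proof.
move=> lf df; have mf n := L2_measurable (lf n).
have C0 : 0 <= C.
  have := le_trans (dist_ge0 _ _ _) (df 0%N).
  by rewrite pmulr_lge0// invr_gt0 exprn_gt0.
pose g n x := (`|f_ n.+1 x - f_ n x|)%:E : \bar R.
have g0 n x : (0 <= g n x)%E by rewrite lee_fin.
have mg n : measurable_fun setT (g n).
  by apply/measurable_EFinP/measurableT_comp => //; exact: measurable_funB.
pose S x := (\sum_(0 <= n <oo) g n x)%E.
have S0 x : (0 <= S x)%E by apply: nneseries_ge0.
have iS : P.-integrable setT S.
  apply/integrableP; split; first exact: ge0_emeasurable_sum.
  under eq_integral do rewrite gee0_abs//.
  rewrite integral_nneseries//.
  apply: le_lt_trans (_ : C%:E < +oo)%E; last by rewrite ltry.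
  apply: le_trans (epsilon_trick0 xpredT C0); apply: lee_nneseries => n _.
    by move=> _; exact: integral_ge0.
  rewrite /g -[leLHS]fineK; last first.
    apply: integrable_fin_num => //.
    apply: (integrable_abse (f := fun x => (f_ n.+1 x - f_ n x)%:E)).
    exact/L2_integrable/L2B.
  by rewrite lee_fin (le_trans _ (df n))// expectation_abs_le//; exact: L2B.
(* The upper limit is measurable on the whole space, whereas the sequence itself converges only
   almost everywhere. *)
pose f x := fine (limn_esup (fun n => (f_ n x)%:E)).
have mff : measurable_fun setT f.
  apply: measurableT_comp => //; apply: measurable_fun_limn_esup => n.
  exact/measurable_EFinP.
have cf : {ae P, forall x, f_ n x @[n --> \oo] --> f x}.
  apply: filterS (integrable_ae measurableT iS) => x /(_ I) Sx.
  have : cvgn (f_ ^~ x).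
    have : cvgn (series (telescope (f_ ^~ x))).
      apply: normed_cvg; apply: nondecreasing_is_cvgn.
        by apply: nondecreasing_series => k _ _; exact: normr_ge0.
      exists (fine (S x)) => _ [n _ <-]; rewrite -lee_fin fineK//.
      rewrite /series/= -sumEFin; apply: le_trans (nneseries_lim_ge n _) => //.
    rewrite telescopeK => /cvg_ex[l H]; apply/cvg_ex; exists (l + f_ 0%N x).
    have -> : f_ ^~ x = (fun n => (f_ n x - f_ 0%N x) + f_ 0%N x).
      by apply/funext => n; rewrite subrK.
    by apply: cvgD; [exact: H|exact: cvg_cst].
  move=> /cvg_ex[l H]; rewrite /f.
  have /cvg_limn_einf_sup[_ ->//] : (f_ n x)%:E @[n --> \oo] --> l%:E.
  by apply: cvg_EFin; [exact: nearW|exact: H].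
(* The geometric sum is kept as a difference so that the induction on [k] closes. *)
have dd n k : dist P (f_ n) (f_ (n + k)%N) <= C / 2 ^+ n - C / 2 ^+ (n + k)%N.
  elim: k => [|k ih].
    rewrite addn0 subrr /dist /dot.
    under eq_Rintegral do rewrite subrr mul0r.
    by rewrite Rintegral_prob_cst sqrtr0.
  have := dist_triangle (lf n) (lf (n + k)%N) (lf (n + k.+1)%N).
  have := df (n + k)%N; rewrite addnS distC natrX => h1 h2.
  have e : C / 2 ^+ (n + k) = C / 2 ^+ (n + k).+1 + C / 2 ^+ (n + k).+1.
    by rewrite exprS; field; rewrite expf_neq0.
  lra.
(* Fatou's lemma carries the bound on the distance from [f_ n] to [f_ m] over to the limit in [m];
   it also shows that [f_ n - f], and with it [f], is square integrable. *)
have key n : (\int[P]_x ((f_ n x - f x) * (f_ n x - f x))%:E <=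
              ((C / 2 ^+ n) ^+ 2)%:E)%E.
  pose h m x := ((f_ n x - f_ m x) * (f_ n x - f_ m x))%:E : \bar R.
  have mh m : measurable_fun setT (h m).
    by apply/measurable_EFinP; apply: measurable_funM; exact: measurable_funB.
  have h0 m x : (0 <= h m x)%E by rewrite lee_fin -expr2 sqr_ge0.
  have -> : (\int[P]_x ((f_ n x - f x) * (f_ n x - f x))%:E =
            \int[P]_x limn_einf (h ^~ x))%E.
    apply: ge0_ae_eq_integral => //.
    - apply/measurable_EFinP; apply: measurable_funM; exact: measurable_funB.
    - under eq_fun do rewrite -[limn_einf _]oppeK -limn_esupN.
      apply: measurableT_comp => //; apply: measurable_fun_limn_esup => m.
      exact: measurableT_comp.
    - by move=> x _; rewrite lee_fin -expr2 sqr_ge0.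
    - move=> x _; rewrite limn_einf_lim; apply: lime_ge; first exact: is_cvg_einfs.
      by apply: nearW => m; apply: le_ereal_inf_tmp => _ [k _ <-].
    apply: filterS cf => x cfx _; apply/esym.
    suff /cvg_limn_einf_sup[->//] : h m x @[m --> \oo] -->
        ((f_ n x - f x) * (f_ n x - f x))%:E.
    apply: cvg_EFin; first exact: nearW.
    by apply: cvgM; apply: cvgB => //; exact: cvg_cst.
  apply: le_trans (fatou P measurableT mh _) _ => //.
  apply: limn_einf_le_near; near=> m.
  have nm : (n <= m)%N by near: m; exists n.
  have lnm := L2B (lf n) (lf m).
  rewrite /h -[leLHS]fineK; last first.
    by apply: integrable_fin_num => //; exact: L2_integrable_mul.
  rewrite lee_fin -[leLHS]dist_sqr ler_sqr ?nnegrE ?dist_ge0//; last first.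
    by rewrite divr_ge0// exprn_ge0.
  have := dd n (m - n)%N; rewrite subnKC// => /le_trans; apply.
  by rewrite gerBl// divr_ge0// exprn_ge0.
have lff n : rL2 P (fun x => f_ n x - f x).
  apply: L2I; first exact: measurable_funB.
  apply/integrableP; split.
    apply/measurable_EFinP; apply: measurable_funM; exact: measurable_funB.
  under eq_integral do rewrite gee0_abs ?lee_fin -?expr2 ?sqr_ge0//.
  by apply: le_lt_trans (key n) _; rewrite ltry.
exists f.
  have := L2B (lf 0%N) (lff 0%N).
  by congr rL2; apply/funext => x; rewrite subKr.
apply: (@squeeze_cvgr _ _ _ _ (fun=> 0) (fun n => C / 2 ^+ n)).
- apply: nearW => n; rewrite dist_ge0/= -(ler_pXn2r (n := 2))// ?nnegrE ?dist_ge0//; last first.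
    by rewrite divr_ge0// exprn_ge0.
  rewrite dist_sqr -lee_fin; apply: le_trans (key n).
  by rewrite /dot /Rintegral fineK//; apply: integrable_fin_num => //; exact: L2_integrable_mul.
- exact: cvg_cst.
- rewrite -[X in _ --> X](mulr0 C); apply: cvgM; first exact: cvg_cst.
  by under eq_fun do rewrite -exprVn; apply: cvg_expr; rewrite ger0_norm// invf_lt1// ltr1n.
Unshelve. all: by end_near. Qed.

End riesz_fischer.

(** * Continuous functions and primitives on an interval *)

Section calculus.
Context (R : realType).
Implicit Types (f g h F G : R -> R) (r t : R).
Notation leb := (@lebesgue_measure R).

Definition cont r f := {within `[0, r], continuous f}.

Definition J t f : R := \int[leb]_(s in `[0, t]) f s.

(** The integrated form of F' = f. It involves no one-sided derivative at 0 or [r] and is the shape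
    in which the chain is given. *)
Definition prim r F f := cont r f /\ forall t, 0 <= t <= r -> F t = F 0 + J t f.

Lemma cont_cst r c : cont r (fun=> c).
Proof. by move=> x; exact: cvg_cst. Qed.

Lemma contD r f g : cont r f -> cont r g -> cont r (fun x => f x + g x).
Proof. by move=> cf cg x; apply: cvgD; [exact: cf|exact: cg]. Qed.

Lemma contN r f : cont r f -> cont r (fun x => - f x).
Proof. by move=> cf x; apply: cvgN; exact: cf. Qed.

Lemma contB r f g : cont r f -> cont r g -> cont r (fun x => f x - g x).
Proof. by move=> cf /contN; exact: contD. Qed.

Lemma contM r f g : cont r f -> cont r g -> cont r (fun x => f x * g x).
Proof. by move=> cf cg x; apply: cvgM; [exact: cf|exact: cg]. Qed.

Lemma contZ r c f : cont r f -> cont r (fun x => c * f x).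
Proof. by apply: contM; exact: cont_cst. Qed.

Arguments contZ {r} c {f} _.

Lemma contX r f n : cont r f -> cont r (fun x => f x ^+ n).
Proof.
move=> cf; elim: n => [|n ih]; first exact: cont_cst.
by under eq_fun do rewrite exprS; exact: contM.
Qed.

Lemma cont_comp r f g : continuous g -> cont r f -> cont r (fun x => g (f x)).
Proof. by move=> cg cf x; apply: continuous_comp; [exact: cf|exact: cg]. Qed.

Lemma cont_continuous r f : continuous f -> cont r f.
Proof. by move=> cf; exact: continuous_subspaceT. Qed.

Lemma cont_sub r t f : t <= r -> cont r f -> cont t f.
Proof. by move=> tr; apply: continuous_subspaceW; exact: subset_itvl. Qed.

Lemma eq_cont r f g : (forall t, 0 <= t <= r -> f t = g t) -> cont r f -> cont r g.
Proof.
move=> fg; apply: subspace_eq_continuous => x /set_mem /=.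
by rewrite in_itv/= => /fg.
Qed.

Lemma contP r f : cont r f <->
  forall t, 0 <= t <= r -> f x @[x --> within `[0, r] (nbhs t)] --> f t.
Proof.
split=> [/subspace_continuousP H t tr|H]; first by apply: H; rewrite /= in_itv.
by apply/subspace_continuousP => t; rewrite /= in_itv/= => /H.
Qed.

Lemma contV r f : (forall t, 0 <= t <= r -> f t != 0) -> cont r f ->
  cont r (fun x => (f x)^-1).
Proof.
move=> f0 /contP cf; apply/contP => t tr; apply: cvgV; first exact: f0.
exact: cf.
Qed.

Lemma cont_sum r (I : Type) (s : seq I) (f : I -> R -> R) :
  (forall i, cont r (f i)) -> cont r (fun x => \sum_(i <- s) f i x).
Proof.
move=> cf; elim: s => [|i s ih].
  by under eq_fun do rewrite big_nil; exact: cont_cst.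
by under eq_fun do rewrite big_cons; exact: contD.
Qed.

Lemma cont_bound r f : 0 <= r -> cont r f ->
  exists2 c, 0 < c & forall t, 0 <= t <= r -> `|f t| <= c.
Proof.
move=> r0 cf; have [c _ Hc] := EVT_max r0 (cont_comp (@norm_continuous _ _) cf).
exists (`|f c| + 1); first by rewrite ltr_wpDl.
by move=> t tr; rewrite (le_trans (Hc t _)) ?in_itv// lerDl.
Qed.

Lemma cont_pos_min r f : 0 <= r -> cont r f -> (forall t, 0 <= t <= r -> 0 < f t) ->
  exists2 c, 0 < c & forall t, 0 <= t <= r -> c <= f t.
Proof.
move=> r0 cf f0; have [c cr Hc] := EVT_min r0 cf.
by exists (f c) => [|t tr]; [apply: f0; rewrite in_itv/= in cr|apply: Hc; rewrite in_itv].
Qed.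

Lemma cont_integrable r t f : 0 <= t <= r -> cont r f ->
  leb.-integrable `[0, t] (EFin \o f).
Proof.
move=> /andP[t0 tr] cf; apply: continuous_compact_integrable; first exact: segment_compact.
exact: cont_sub cf.
Qed.

Lemma eq_J t f g : (forall s, 0 <= s <= t -> f s = g s) -> J t f = J t g.
Proof. by move=> fg; apply: eq_Rintegral => s /set_mem/=; rewrite in_itv/= => /fg. Qed.

Lemma J_0 f : J 0 f = 0.
Proof. by rewrite /J set_itv1 Rintegral_set1. Qed.

Section linearity.
Variables (r t : R).
Hypothesis tr : 0 <= t <= r.

Lemma JD f g : cont r f -> cont r g -> J t (fun x => f x + g x) = J t f + J t g.
Proof. by move=> cf cg; rewrite /J RintegralD//; exact: cont_integrable tr _. Qed.

Lemma JB f g : cont r f -> cont r g -> J t (fun x => f x - g x) = J t f - J t g.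
Proof. by move=> cf cg; rewrite /J RintegralB//; exact: cont_integrable tr _. Qed.

Lemma JZ c f : cont r f -> J t (fun x => c * f x) = c * J t f.
Proof. by move=> cf; rewrite /J RintegralZl//; exact: cont_integrable tr _. Qed.

Lemma JN f : cont r f -> J t (fun x => - f x) = - J t f.
Proof.
by move=> cf; rewrite -mulN1r -JZ//; apply: eq_J => s _; rewrite mulN1r.
Qed.

Lemma le_J f g : cont r f -> cont r g -> (forall s, 0 <= s <= t -> f s <= g s) ->
  J t f <= J t g.
Proof.
move=> cf cg fg.
apply: (le_Rintegral _ (cont_integrable tr cf) (cont_integrable tr cg)) => //.
Qed.

Lemma J_ge0 f : (forall s, 0 <= s <= t -> 0 <= f s) -> 0 <= J t f.
Proof. by move=> f0; apply: Rintegral_ge0 => x /=; rewrite in_itv/= => /f0. Qed.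

Lemma J_sum (I : Type) (s : seq I) (f : I -> R -> R) : (forall i, cont r (f i)) ->
  J t (fun x => \sum_(i <- s) f i x) = \sum_(i <- s) J t (f i).
Proof.
move=> cf; elim: s => [|i s ih].
  rewrite big_nil; under [X in J _ X]eq_fun do rewrite big_nil.
  by rewrite /J Rintegral_cst// mul0r.
rewrite big_cons -ih -JD//; last exact: cont_sum.
by under [X in J _ X]eq_fun do rewrite big_cons.
Qed.

Lemma J_cst c : J t (fun=> c) = c * t.
Proof.
rewrite /J Rintegral_cst//= lebesgue_measure_itv/= lte_fin; case/andP: tr => t0 _.
case: ltP => [|t0']; first by rewrite sube0.
by rewrite (@le_anti _ _ t 0) ?t0// t0' .
Qed.

Lemma J_norm f : cont r f -> `|J t f| <= J t (fun x => `|f x|).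
Proof. by move=> cf; apply: le_normr_Rintegral => //; exact: cont_integrable tr _. Qed.

End linearity.

Lemma J_le_subset r s t f : 0 <= s -> s <= t -> t <= r -> cont r f ->
  (forall x, 0 <= x <= r -> 0 <= f x) -> J s f <= J t f.
Proof.
move=> s0 st tr cf f0.
have h : 0 <= t <= r by rewrite tr (le_trans s0).
rewrite -subr_ge0 /J Rintegral_itvB ?bnd_simp//; last exact: cont_integrable h _.
apply: Rintegral_ge0 => x /=; rewrite in_itv/= => /andP[sx xt]; apply: f0.
by rewrite (le_trans xt)// (le_trans s0)// ltW.
Qed.

Lemma J_incr_bound r s t f c : 0 <= s -> s <= t -> t <= r -> cont r f ->
  (forall x, s <= x <= t -> `|f x| <= c) -> `|J t f - J s f| <= c * (t - s).
Proof.
move=> s0 st tr cf fc.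
have h : 0 <= t <= r by rewrite tr (le_trans s0).
have ift := cont_integrable h cf.
rewrite /J Rintegral_itvB ?bnd_simp//.
have sub : `]s, t] `<=` `[0, t] by apply: subset_itvr; rewrite bnd_simp.
have ist : leb.-integrable `]s, t] (EFin \o f) by exact: integrableS ift.
apply: le_trans (le_normr_Rintegral _ ist) _ => //.
apply: le_trans (_ : \int[leb]_(x in `]s, t]) c <= _).
  apply: le_Rintegral => //.
  - exact: integrable_norm.
  - by apply: integrableS (cont_integrable h (@cont_cst r c)).
  - by move=> x /=; rewrite in_itv/= => /andP[sx xt]; apply: fc; rewrite (ltW sx).
rewrite Rintegral_cst//= lebesgue_measure_itv/= lte_fin.
case: ltP => [//|ts]; rewrite mulr0.
by rewrite (@le_anti _ _ t s) ?subrr ?mulr0// ts.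
Qed.

Lemma cont_itvP r f : 0 < r -> cont r f <->
  [/\ {in `]0, r[, continuous f}, f x @[x --> 0^'+] --> f 0 & f x @[x --> r^'-] --> f r].
Proof. by move=> r0; exact: continuous_within_itvP. Qed.

Lemma cont_J r f : 0 <= r -> cont r f -> cont r (fun t => J t f).
Proof.
move=> r0 cf; apply: parameterized_integral_continuous => //.
by apply: cont_integrable cf; rewrite r0 lexx.
Qed.

(** * Primitives, the Gronwall inequality and weighted Cauchy-Schwarz *)

Section primitives.
Variable r : R.
Hypothesis r_gt0 : 0 < r.

Let r_ge0 : 0 <= r. Proof. exact: ltW. Qed.

Lemma prim_cont F f : prim r F f -> cont r F.
Proof.
move=> [cf FE]; apply: eq_cont (contD (@cont_cst r (F 0)) (cont_J r_ge0 cf)).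
by move=> t /FE ->.
Qed.

Lemma prim_der F f : prim r F f -> cont r f. Proof. by case. Qed.

Lemma primE F f t : prim r F f -> 0 <= t <= r -> F t = F 0 + J t f.
Proof. by case=> _; apply. Qed.

Lemma J_prim F f : prim r F f -> J r f = F r - F 0.
Proof. by move=> /primE ->; rewrite ?r_ge0 ?lexx// addrC addKr. Qed.

Lemma prim_J f c : cont r f -> prim r (fun t => c + J t f) f.
Proof. by move=> cf; split=> // t tr; rewrite J_0 addr0. Qed.

Lemma eq_prim F f G g : (forall t, 0 <= t <= r -> F t = G t) ->
  (forall t, 0 <= t <= r -> f t = g t) -> prim r F f -> prim r G g.
Proof.
move=> FG fg [cf FE]; split; first exact: eq_cont cf.
move=> t tr; have /andP[t0 tr'] := tr.
rewrite -FG// -FG ?lexx// FE//; congr (_ + _); apply: eq_J => s /andP[s0 st].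
by rewrite fg// s0 (le_trans st).
Qed.

Lemma prim_cst c : prim r (fun=> c) (fun=> 0).
Proof.
split; first exact: cont_cst.
by move=> t tr; rewrite (J_cst tr) mul0r addr0.
Qed.

Lemma primD F f G g : prim r F f -> prim r G g ->
  prim r (fun t => F t + G t) (fun t => f t + g t).
Proof.
move=> [cf FE] [cg GE]; split; first exact: contD.
by move=> t tr; rewrite (JD tr)// FE// GE// addrACA.
Qed.

Lemma primZ c F f : prim r F f -> prim r (fun t => c * F t) (fun t => c * f t).
Proof.
move=> [cf FE]; split; first exact: contZ.
by move=> t tr; rewrite (JZ tr)// FE// mulrDr.
Qed.

Lemma primN F f : prim r F f -> prim r (fun t => - F t) (fun t => - f t).
Proof.
move=> /(primZ (-1)); apply: eq_prim => t _; exact: mulN1r.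
Qed.

Lemma primB F f G g : prim r F f -> prim r G g ->
  prim r (fun t => F t - G t) (fun t => f t - g t).
Proof. by move=> pF /primN; exact: primD. Qed.

Lemma prim_is_derive F f t : prim r F f -> 0 < t < r -> is_derive t 1 F (f t).
Proof.
move=> pF t0r; have [cf FE] := pF; have /andP[t0 tr] := t0r.
have [/(_ t)ct _ _] := (cont_itvP f r_gt0).1 cf.
have [] := @continuous_FTC1_closed _ f 0 t r tr _ t0 _.
- by apply: cont_integrable cf; rewrite r_ge0 lexx.
- by apply: ct; rewrite in_itv.
rewrite -/(J _ _) => dJ J'.
have : is_derive t 1 (fun x => F 0 + J x f) (f t).
  by rewrite -J' derive1E -[X in is_derive _ _ _ X]add0r; apply: is_deriveD => //; exact/derivableP.
apply: near_eq_is_derive.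
near=> x; apply/esym/FE; apply/andP; split; apply/ltW; near: x.
  exact: lt_nbhsr.
exact: lt_nbhsl.
Unshelve. all: by end_near. Qed.

Lemma prim_of_derive F f : cont r F -> cont r f ->
  (forall t, 0 < t < r -> is_derive t 1 F (f t)) -> prim r F f.
Proof.
move=> cF cf dF; split=> // t /andP[]; rewrite le_eqVlt => /predU1P[<-|t0] tr.
  by rewrite J_0 addr0.
have [_ cF0 cFt] := (cont_itvP F t0).1 (cont_sub tr cF).
have F' x : x \in `]0, t[ -> is_derive x 1 F (f x).
  by rewrite in_itv/= => /andP[x0 xt]; apply: dF; rewrite x0 (lt_le_trans xt).
have := @continuous_FTC2 _ f F 0 t t0 (cont_sub tr cf).
rewrite /J /Rintegral => -> //.
- by rewrite -EFinB/= addrC subrK.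
- by split=> // x /F' [].
- by move=> x /F' [d Fx]; rewrite derive1E.
Qed.

Lemma prim_exp c : prim r (fun t => expR (c * t)) (fun t => c * expR (c * t)).
Proof.
have ce : continuous (fun t : R => expR (c * t)).
  by move=> t; apply: continuous_comp; [exact: mulrl_continuous|exact: continuous_expR].
apply: prim_of_derive; first exact: cont_continuous.
  by apply: contZ; exact: cont_continuous.
by move=> t _; apply: is_derive_eq; rewrite mulrC scaler1.
Qed.

Lemma prim_mul F f G g : prim r F f -> prim r G g ->
  prim r (fun t => F t * G t) (fun t => f t * G t + F t * g t).
Proof.
move=> pF pG; have [cf FE] := pF; have [cg GE] := pG.
have cF := prim_cont pF; have cG := prim_cont pG.
have cfG := contM cf cG; have cFg := contM cF cg.
split; first exact: contD.
move=> t tr; have /andP[] := tr; rewrite le_eqVlt => /predU1P[<-|t0] tr'.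
  by rewrite J_0 addr0.
rewrite (JD tr)//.
have LR H h : prim r H h -> derivable_oo_LRcontinuous H 0 t /\ {in `]0, t[, derive1 H =1 h}.
  move=> pH; have [_ cH0 cHt] := (cont_itvP H t0).1 (cont_sub tr' (prim_cont pH)).
  have H' x : x \in `]0, t[ -> is_derive x 1 H (h x).
    by rewrite in_itv/= => /andP[x0 xt]; apply: prim_is_derive; rewrite ?x0 ?(lt_le_trans xt).
  by split; [split=> // x /H' []|move=> x /H' [d Hx]; rewrite derive1E].
have [LF F'] := LR _ _ pF; have [LG G'] := LR _ _ pG.
rewrite /J [X in _ + (_ + X)](Rintegration_by_parts t0 (cont_sub tr' cf) LF F' (cont_sub tr' cg) LG G').
by rewrite [X in _ = _ + X]addrC subrK addrC subrK.
Qed.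

(* Gronwall in integrated form: the derivative of [e t * exp (- k t)] is at
   most [h]. *)
Lemma gronwall F f h k : 0 <= k -> prim r F f -> cont r h ->
  (forall t, 0 <= t <= r -> 0 <= h t) -> 0 <= F 0 ->
  (forall t, 0 <= t <= r -> f t <= k * F t + h t) ->
  forall t, 0 <= t <= r -> F t <= expR (k * r) * (F 0 + J r h).
Proof.
move=> k0 pF ch h0 F0 fb t tr; have /andP[t0 tr'] := tr.
have pG := prim_mul pF (prim_exp (- k)).
have e1 s : 0 <= s -> expR (- k * s) <= 1.
  by move=> s0; rewrite -[leRHS]expR0 ler_expR mulNr oppr_le0 mulr_ge0.
have : F t * expR (- k * t) <= F 0 + J r h.
  rewrite (primE pG tr) mulr0 expR0 mulr1 lerD2l.
  apply: le_trans (J_le_subset t0 tr' (lexx r) ch h0).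
  apply: (le_J tr _ ch); first exact: prim_der pG.
  move=> s /andP[s0 st]; have sr : 0 <= s <= r by rewrite s0 (le_trans st).
  have := ler_wpM2r (expR_ge0 (- k * s)) (fb s sr).
  have := ler_wpM2l (h0 s sr) (e1 s s0); nra.
rewrite -(ler_pM2r (expR_gt0 (k * t))) -mulrA -expRD mulNr addNr expR0 mulr1.
move=> /le_trans; apply; rewrite mulrC ler_wpM2r//.
  rewrite addr_ge0// J_ge0// ?r_ge0 ?lexx//.
by rewrite ler_expR ler_wpM2l.
Qed.

Lemma J_CS f g w : cont r f -> cont r g -> cont r w ->
  (forall t, 0 <= t <= r -> 0 <= w t) ->
  J r (fun t => w t * f t * g t) ^+ 2 <=
  J r (fun t => w t * f t ^+ 2) * J r (fun t => w t * g t ^+ 2).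
Proof.
move=> cf cg cw w0; have rr : 0 <= r <= r by rewrite r_ge0 lexx.
set a := J r (fun t => w t * f t ^+ 2); set b := J r (fun t => w t * f t * g t).
set c := J r (fun t => w t * g t ^+ 2).
have c1 : cont r (fun t => w t * f t ^+ 2) by apply: contM => //; exact: contX.
have c2 : cont r (fun t => w t * f t * g t) by do 2 apply: contM => //.
have c3 : cont r (fun t => w t * g t ^+ 2) by apply: contM => //; exact: contX.
have key x : 0 <= a + 2 * x * b + x ^+ 2 * c.
  have c4 := contZ (2 * x) c2; have c5 := contZ (x ^+ 2) c3.
  rewrite -(JZ rr _ c2) -(JZ rr _ c3) -(JD rr c1 c4) -(JD rr (contD c1 c4) c5).
  apply: J_ge0 => s sr.
  rewrite (_ : _ + _ = w s * (f s + x * g s) ^+ 2); last by ring.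
  by rewrite mulr_ge0 ?sqr_ge0 ?w0.
apply: discriminant_le key.
by apply: J_ge0 => s sr; rewrite mulr_ge0 ?sqr_ge0 ?w0.
Qed.

(** By continuity [f] stays above half of [f 0] on some [0, t]. Positivity is asked at 0 because
    there the solutions [a k] are known to be 1, while they may vanish elsewhere. *)
Lemma J_gt0 f : cont r f -> (forall t, 0 <= t <= r -> 0 <= f t) -> 0 < f 0 ->
  0 < J r f.
Proof.
move=> cf f0 f00; have rr : 0 <= r <= r by rewrite r_ge0 lexx.
have h : (0 : R) <= 0 <= r by rewrite lexx r_ge0.
have e0 : 0 < f 0 / 2 by rewrite divr_gt0.
have /contP/(_ 0 h)/cvgrPdist_lt/(_ _ e0) := cf.
rewrite near_withinE => /nbhs_ballP[e /= e_gt0 He].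
pose t := Num.min r (e / 2).
have t0 : 0 < t by rewrite lt_min r_gt0 divr_gt0.
have tr : 0 <= t <= r by rewrite (ltW t0) ge_min lexx.
have /andP[_ tr'] := tr.
apply: lt_le_trans (J_le_subset (ltW t0) tr' (lexx r) cf f0).
apply: lt_le_trans (_ : f 0 / 2 * t <= _); first by rewrite mulr_gt0.
rewrite -(J_cst tr); apply: (le_J tr _ cf); first exact: cont_cst.
move=> s /andP[s0 st]; have se : s < e.
  apply: le_lt_trans st _; rewrite gt_min; apply/orP; right; lra.
have /He : ball 0 e s by rewrite /ball/= sub0r normrN ger0_norm.
rewrite /= in_itv/= s0 (le_trans st tr') => /(_ isT).
by rewrite ltr_norml => /andP[_]; lra.
Qed.

End primitives.

Lemma J_incr_ge (r s t : R) f c : 0 <= s -> s <= t -> t <= r -> cont r f ->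
  (forall x, s <= x <= t -> c <= f x) -> c * (t - s) <= J t f - J s f.
Proof.
move=> s0 st tr cf fc.
have h : 0 <= t <= r by rewrite tr (le_trans s0).
have sub : `]s, t] `<=` `[0, t] by apply: subset_itvr; rewrite bnd_simp.
have ifn g : cont r g -> leb.-integrable `]s, t] (EFin \o g).
  by move=> cg; exact: integrableS (cont_integrable h cg).
rewrite /J Rintegral_itvB ?bnd_simp//; last exact: cont_integrable h cf.
apply: le_trans (_ : \int[leb]_(x in `]s, t]) c <= _); last first.
  apply: (le_Rintegral _ (ifn _ (@cont_cst r c)) (ifn _ cf)) => //.
  by move=> x /=; rewrite in_itv/= => /andP[sx xt]; apply: fc; rewrite (ltW sx).
rewrite Rintegral_cst//= lebesgue_measure_itv/= lte_fin.
case: ltP => [//|ts]; rewrite mulr0.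
by rewrite (@le_anti _ _ t s) ?subrr ?mulr0// ts.
Qed.

Lemma J_incr_eq (r s t : R) f g : 0 <= s -> s <= t -> t <= r -> cont r f -> cont r g ->
  (forall x, s <= x <= t -> f x = g x) -> J t f - J s f = J t g - J s g.
Proof.
move=> s0 st tr cf cg fg.
have h : 0 <= t <= r by rewrite tr (le_trans s0).
rewrite /J !Rintegral_itvB ?bnd_simp//; [|exact: cont_integrable h _..].
apply: eq_Rintegral => x /set_mem/=; rewrite in_itv/= => /andP[sx xt].
by apply: fg; rewrite (ltW sx).
Qed.

End calculus.

Arguments contZ {R r} c {f} _.
Arguments cont_cst {R r} c.
Arguments prim_cst {R r} c.

(** * The Sturm-Liouville problem *)

Section sturm_liouville.
Context (R : realType).
Variables (r : R) (w alpha : R -> R) (a b : R -> R -> R).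
Hypothesis r_gt0 : 0 < r.
Hypothesis w_cont : cont r w.
Hypothesis w_gt0 : forall t, 0 <= t <= r -> 0 < w t.
Hypothesis alpha_prim : prim r alpha w.
Hypothesis alpha0 : alpha 0 = 0.
Hypothesis a_prim : forall k, prim r (a k) (fun t => - (k * (b k t / w t))).
Hypothesis b_prim : forall k, prim r (b k) (fun t => k * (a k t * w t)).
Hypothesis a0 : forall k, a k 0 = 1.
Hypothesis b0 : forall k, b k 0 = 0.
Implicit Types (u v y z p q f g : R -> R) (k l : R).

Let r_ge0 : 0 <= r. Proof. exact: ltW. Qed.
Let rr : 0 <= r <= r. Proof. by rewrite r_ge0 lexx. Qed.
Let r00 : (0 : R) <= 0 <= r. Proof. by rewrite r_ge0 lexx. Qed.

Definition iw t := (w t)^-1.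

Let w_neq0 t : 0 <= t <= r -> w t != 0. Proof. by move=> /w_gt0/lt0r_neq0. Qed.

Let iw_cont : cont r iw. Proof. exact: contV. Qed.

Let iw_gt0 t : 0 <= t <= r -> 0 < iw t. Proof. by move=> /w_gt0; rewrite invr_gt0. Qed.

Let iw_ge0 t : 0 <= t <= r -> 0 <= iw t. Proof. by move=> /iw_gt0/ltW. Qed.

Let w_ge0 t : 0 <= t <= r -> 0 <= w t. Proof. by move=> /w_gt0/ltW. Qed.

Let a_cont k : cont r (a k). Proof. exact: prim_cont (a_prim k). Qed.
Let b_cont k : cont r (b k). Proof. exact: prim_cont (b_prim k). Qed.
Arguments a_cont : clear implicits.
Arguments b_cont : clear implicits.
Let alpha_cont : cont r alpha. Proof. exact: prim_cont alpha_prim. Qed.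

Lemma alphaE t : 0 <= t <= r -> alpha t = J t w.
Proof. by move=> tr; rewrite (primE alpha_prim tr) alpha0 add0r. Qed.

Lemma alpha_incr_ge s t : 0 <= s -> s <= t -> t <= r -> alpha s <= alpha t.
Proof.
move=> s0 st tr; rewrite !alphaE ?s0 ?(le_trans st)// ?(le_trans s0)//.
exact: J_le_subset w_ge0.
Qed.

Lemma alpha_gt0 : 0 < alpha r.
Proof. by rewrite alphaE//; apply: J_gt0 => //; exact: w_gt0. Qed.

(** [ip] is the inner product of L^2[0, r] after the substitution y / sqrt w. The form [en] below is
    the Dirichlet form, the integral of y' z' / w, written through p = y' / w and q = z' / w. *)
Definition ip u v := J r (fun t => iw t * u t * v t).
Definition en p q := J r (fun t => w t * p t * q t).

Let ip_cont u v : cont r u -> cont r v -> cont r (fun t => iw t * u t * v t).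
Proof. by move=> cu cv; do 2 apply: contM => //. Qed.

Lemma ipC u v : ip u v = ip v u.
Proof. by apply: eq_J => s _; rewrite mulrAC. Qed.

Lemma ipDl u v z : cont r u -> cont r v -> cont r z ->
  ip (fun t => u t + v t) z = ip u z + ip v z.
Proof.
move=> cu cv cz; rewrite /ip -(JD rr (ip_cont cu cz) (ip_cont cv cz)).
by apply: eq_J => s _; ring.
Qed.

Lemma ipZl c u v : cont r u -> cont r v -> ip (fun t => c * u t) v = c * ip u v.
Proof.
move=> cu cv; rewrite /ip -(JZ rr _ (ip_cont cu cv)).
by apply: eq_J => s _; ring.
Qed.

Lemma ipDr u v z : cont r u -> cont r v -> cont r z ->
  ip z (fun t => u t + v t) = ip z u + ip z v.
Proof. by move=> *; rewrite ipC ipDl// !(ipC z). Qed.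

Lemma ipZr c u v : cont r u -> cont r v -> ip v (fun t => c * u t) = c * ip v u.
Proof. by move=> *; rewrite ipC ipZl// ipC. Qed.

Lemma ip_suml (I : Type) (s : seq I) (f : I -> R -> R) v :
  (forall i, cont r (f i)) -> cont r v ->
  ip (fun t => \sum_(i <- s) f i t) v = \sum_(i <- s) ip (f i) v.
Proof.
move=> cf cv; rewrite /ip -(J_sum rr); last by move=> i; exact: ip_cont.
by apply: eq_J => t _; rewrite mulr_sumr mulr_suml.
Qed.

Lemma ip_ge0 u : 0 <= ip u u.
Proof. by apply: J_ge0 => s sr; rewrite -mulrA -expr2 mulr_ge0 ?sqr_ge0 ?iw_ge0. Qed.

Lemma ip_CS u v : cont r u -> cont r v -> ip u v ^+ 2 <= ip u u * ip v v.
Proof.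
move=> cu cv; have := J_CS r_gt0 cu cv iw_cont iw_ge0.
by congr (_ <= _ * _); apply: eq_J => s _; rewrite expr2 mulrA.
Qed.

Lemma en_ge0 p : 0 <= en p p.
Proof. by apply: J_ge0 => s sr; rewrite -mulrA -expr2 mulr_ge0 ?sqr_ge0 ?w_ge0. Qed.

Lemma en_CS p q : cont r p -> cont r q -> en p q ^+ 2 <= en p p * en q q.
Proof.
move=> cu cv; have := J_CS r_gt0 cu cv w_cont w_ge0.
by congr (_ <= _ * _); apply: eq_J => s _; rewrite expr2 mulrA.
Qed.

(* [y] solves the Dirichlet problem [- w (y' / w)' = u], with [p = y' / w]. *)
Definition solves u y p :=
  [/\ cont r u, prim r y (fun t => w t * p t), prim r p (fun t => - (iw t * u t)),
      y 0 = 0 & y r = 0].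

Lemma solves_cont u y p : solves u y p -> [/\ cont r u, cont r y & cont r p].
Proof.
by case=> cu py pp _ _; split=> //; [exact: prim_cont py|exact: prim_cont pp].
Qed.

Lemma solves_exists u : cont r u -> exists y p, solves u y p.
Proof.
move=> cu; have ciu : cont r (fun t => - (iw t * u t)) by apply: contN; exact: contM.
pose U t := J t (fun t => - (iw t * u t)).
have cU : cont r U by exact: cont_J.
(* The initial value [c] of p is forced by y(r) = 0, because y(r) is c alpha_r plus the integral of
   w U. *)
pose c := - (J r (fun t => w t * U t) / alpha r).
have pp := prim_J c ciu; have cp := prim_cont r_gt0 pp.
have py := prim_J 0 (contM w_cont cp).
exists (fun t => 0 + J t (fun t => w t * (c + U t))), (fun t => c + U t); split=> //.
  by rewrite J_0 addr0.
have cwU : cont r (fun t => w t * U t) by exact: contM.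
have E : J r (fun t => w t * (c + U t)) = c * J r w + J r (fun t => w t * U t).
  rewrite -(JZ rr _ w_cont) -(JD rr (contM (cont_cst c) w_cont) cwU).
  by apply: eq_J => s _; ring.
rewrite E -alphaE// /c; field; exact: lt0r_neq0 alpha_gt0.
Qed.

Lemma solvesD u y p v z q : solves u y p -> solves v z q ->
  solves (fun t => u t + v t) (fun t => y t + z t) (fun t => p t + q t).
Proof.
move=> [cu py pp y0 yr] [cv pz pq z0 zr]; split.
- exact: contD.
- by apply: eq_prim (primD py pz) => // t _; rewrite mulrDr.
- by apply: eq_prim (primD pp pq) => // t _; rewrite -opprD mulrDr.
- by rewrite y0 z0 addr0.
- by rewrite yr zr addr0.
Qed.

Lemma solvesZ c u y p : solves u y p ->
  solves (fun t => c * u t) (fun t => c * y t) (fun t => c * p t).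
Proof.
move=> [cu py pp y0 yr]; split.
- exact: contZ.
- by apply: eq_prim (primZ c py) => // t _; rewrite mulrCA.
- by apply: eq_prim (primZ c pp) => // t _; rewrite mulrN mulrCA.
- by rewrite y0 mulr0.
- by rewrite yr mulr0.
Qed.

Lemma solves_sum (I : eqType) (s : seq I) (u y p : I -> R -> R) :
  (forall i, i \in s -> solves (u i) (y i) (p i)) ->
  solves (fun t => \sum_(i <- s) u i t) (fun t => \sum_(i <- s) y i t)
         (fun t => \sum_(i <- s) p i t).
Proof.
elim: s => [|i s ih] H.
  have E (f : I -> R -> R) : (fun t => \sum_(i <- [::]) f i t) = (fun=> 0).
    by apply/funext => t; rewrite big_nil.
  rewrite !E; split=> //; first exact: cont_cst.
    by apply: eq_prim (prim_cst 0) => // t _; rewrite mulr0.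
  by apply: eq_prim (prim_cst 0) => // t _; rewrite mulr0 oppr0.
have E (f : I -> R -> R) :
    (fun t => \sum_(j <- i :: s) f j t) = (fun t => f i t + \sum_(j <- s) f j t).
  by apply/funext => t; rewrite big_cons.
rewrite !E; apply: solvesD; first by apply: H; rewrite mem_head.
by apply: ih => j js; apply: H; rewrite in_cons js orbT.
Qed.

(** Integrate (y q)' = w p q - y v / w, where y vanishes at both ends. *)
Lemma solves_en u y p v z q : solves u y p -> solves v z q -> ip y v = en p q.
Proof.
move=> su sv; have [cu cy cp] := solves_cont su; have [cv cz cq] := solves_cont sv.
have [_ py _ y0 yr] := su; have [_ _ pq _ _] := sv.
have := J_prim r_gt0 (prim_mul r_gt0 py pq); rewrite y0 yr !mul0r subrr.
have c1 := contM (contM w_cont cp) cq.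
have c2 := contM cy (contN (contM iw_cont cv)).
rewrite (JD rr c1 c2) -/(en p q) => /eqP; rewrite addr_eq0 => /eqP ->.
rewrite -(JN rr c2); apply: eq_J => s _; ring.
Qed.

Lemma solves_sym u y p v z q : solves u y p -> solves v z q -> ip y v = ip u z.
Proof.
move=> su sv; rewrite (solves_en su sv) (ipC u) (solves_en sv su).
by apply: eq_J => s _; rewrite mulrAC.
Qed.

Definition gam := J r iw.

Lemma gam_gt0 : 0 < gam.
Proof. by apply: J_gt0 => //; exact: iw_gt0. Qed.

(** y_t is the integral of w p over [0, t], so Cauchy-Schwarz with weight w bounds its square by
    alpha_t times the energy. *)
Lemma solves_sup u y p t : solves u y p -> 0 <= t <= r ->
  y t ^+ 2 <= alpha r * en p p.
Proof.
move=> su tr; have [cu cy cp] := solves_cont su; have [_ py _ y0 _] := su.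
have /andP[] := tr; rewrite le_eqVlt => /predU1P[<-|t0] tr'.
  by rewrite y0 expr0n mulr_ge0 ?en_ge0// ltW// alpha_gt0.
have sub s : 0 <= s <= t -> 0 <= s <= r by move=> /andP[-> /le_trans]; apply.
have cw' := cont_sub tr' w_cont; have cp' := cont_sub tr' cp.
rewrite (primE py tr) y0 add0r.
have := @J_CS _ t t0 _ _ _ (cont_cst 1) cp' cw' (fun s h => w_ge0 (sub s h)).
under [X in X ^+ 2 <= _]eq_J do rewrite mulr1.
move=> /le_trans; apply; apply: ler_pM.
- by apply: J_ge0 => s /sub/w_ge0 ?; rewrite expr1n mulr1.
- by apply: J_ge0 => s /sub/w_ge0 ?; rewrite mulr_ge0 ?sqr_ge0.
- under eq_J do rewrite expr1n mulr1.
  by rewrite -alphaE//; apply: alpha_incr_ge => //; exact: ltW.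
- under eq_J do rewrite expr2 mulrA.
  apply: (J_le_subset (ltW t0) tr' (lexx r)).
    by do 2 apply: contM => //.
  by move=> s /w_ge0 ?; rewrite -mulrA -expr2 mulr_ge0 ?sqr_ge0.
Qed.

Lemma ip_sup_le y c : cont r y -> (forall t, 0 <= t <= r -> y t ^+ 2 <= c) ->
  ip y y <= c * gam.
Proof.
move=> cy yc; rewrite /gam -(JZ rr _ iw_cont); apply: (le_J rr).
- exact: ip_cont.
- exact: contZ.
- by move=> s sr; rewrite -mulrA -expr2 mulrC ler_wpM2r ?iw_ge0 ?yc.
Qed.

(** The energy E = ip u y satisfies E^2 <= ip u u * ip y y <= ip u u * (alpha_r gam E); divide by E.
    This makes the supremum of the Rayleigh quotients finite. *)
Lemma solves_bound u y p : solves u y p -> ip u y <= alpha r * gam * ip u u.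
Proof.
move=> su; have [cu cy cp] := solves_cont su.
have e := solves_en su su.
have h1 := ip_sup_le cy (fun t => solves_sup su (t := t)).
have h2 := ip_CS cu cy; rewrite -(ipC y) e in h2 *.
have : en p p ^+ 2 <= ip u u * (alpha r * en p p * gam).
  by apply: le_trans h2 _; rewrite ler_wpM2l// ip_ge0.
have := en_ge0 p; rewrite le_eqVlt => /predU1P[<- _|e0].
  by rewrite !mulr_ge0 ?ip_ge0// ltW// ?alpha_gt0// gam_gt0.
rewrite expr2 -subr_ge0 (_ : _ - _ = en p p * (alpha r * gam * ip u u - en p p)); last by ring.
by rewrite pmulr_rge0// subr_ge0.
Qed.

Definition zero k := 0 < k /\ b k r = 0.

Lemma zero_solves k : b k r = 0 ->
  solves (fun t => k ^+ 2 * b k t) (b k) (fun t => k * a k t).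
Proof.
move=> bk; split=> //; first exact: contZ.
  by apply: eq_prim (b_prim k) => // t _; ring.
by apply: eq_prim (primZ k (a_prim k)) => // t _; rewrite /iw; ring.
Qed.

Lemma zero_orth k l : zero k -> zero l -> k != l -> ip (b k) (b l) = 0.
Proof.
move=> [k0 bk] [l0 bl] kl.
have := solves_sym (zero_solves bk) (zero_solves bl).
rewrite ipZl// ipZr// => /eqP; rewrite -subr_eq0 -mulrBl mulf_eq0 => /orP[|/eqP//].
rewrite subr_sqr mulf_eq0 subr_eq0 eq_sym (negbTE kl)/= => /eqP.
by move=> h; have := addr_gt0 l0 k0; rewrite h ltxx.
Qed.

(** Equipartition: (b_k a_k)' = k (w a_k^2 - b_k^2 / w), and b_k vanishes at both ends. *)
Lemma ip_b k : b k r = 0 -> k != 0 -> ip (b k) (b k) = en (a k) (a k).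
Proof.
move=> bk k0; have := J_prim r_gt0 (prim_mul r_gt0 (b_prim k) (a_prim k)).
rewrite b0 bk !mul0r subrr.
have d1 := contM (contM w_cont (a_cont k)) (a_cont k).
have d2 := ip_cont (b_cont k) (b_cont k).
have c1 := contZ k d1; have c2 := contN (contZ k d2).
rewrite (@eq_J _ _ _ (fun t => k * (w t * a k t * a k t) + - (k * (iw t * b k t * b k t)))).
  rewrite (JD rr c1 c2) (JZ rr _ d1) (JN rr (contZ k d2)) (JZ rr _ d2).
  by rewrite -mulrN -mulrDr => /eqP; rewrite mulf_eq0 (negbTE k0)/= subr_eq0 => /eqP.
by move=> s _; rewrite /iw; ring.
Qed.

Lemma en_a_gt0 k : 0 < en (a k) (a k).
Proof.
apply: J_gt0 => //; first by do 2 apply: contM => //.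
  by move=> s sr; rewrite -mulrA -expr2 mulr_ge0 ?sqr_ge0 ?w_ge0.
by rewrite a0 !mulr1; exact: w_gt0.
Qed.

Lemma ip_b_gt0 k : b k r = 0 -> k != 0 -> 0 < ip (b k) (b k).
Proof. by move=> bk k0; rewrite ip_b// en_a_gt0. Qed.

(** The derivative of y^2 + q^2 is 2 k (w - 1/w) y q + 2 (y g + q h), at most (L W + 1) (y^2 + q^2)
    + g^2 + h^2, so Gronwall applies. Uniformity in [k] serves the dependence on the parameter in
    [kernel_lipschitz]. *)
Lemma system_bound L : 0 <= L -> exists2 c, 0 < c & forall k y q g h, `|k| <= L ->
  cont r g -> cont r h ->
  prim r y (fun t => k * (w t * q t) + g t) ->
  prim r q (fun t => - (k * (iw t * y t)) + h t) -> y 0 = 0 -> q 0 = 0 ->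
  forall t, 0 <= t <= r ->
    y t ^+ 2 + q t ^+ 2 <= c * J r (fun t => g t ^+ 2 + h t ^+ 2).
Proof.
move=> L0; have [W W0 HW] := cont_bound r_ge0 (contB w_cont iw_cont).
exists (expR ((L * W + 1) * r)); first exact: expR_gt0.
move=> k y q g h kL cg ch py pq y0 q0 t tr.
have cgh := contD (@contX _ r g 2 cg) (@contX _ r h 2 ch).
have pe := primD (prim_mul r_gt0 py py) (prim_mul r_gt0 pq pq).
have H := gronwall r_gt0 _ pe cgh.
have {H}/(_ (L * W + 1)) H := H _.
rewrite !expr2; have := H _ _ _ _ t tr; rewrite y0 q0 mulr0 !add0r; apply => //.
- by rewrite addr_ge0// mulr_ge0// ltW.
- by move=> s _; rewrite addr_ge0 ?sqr_ge0.
- move=> s sr; have := HW s sr.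
  have kW : `|k * (w s - iw s)| <= L * W by rewrite normrM ler_pM// HW.
  move: kW; rewrite ler_norml => /andP[k1 k2] _.
  have : 2 * (k * (w s - iw s)) * (y s * q s) <= L * W * (y s ^+ 2 + q s ^+ 2).
    have := sqr_ge0 (y s - q s); have := sqr_ge0 (y s + q s).
    move: (k * (w s - iw s)) k1 k2 => x; move: (L * W) => z; nra.
  have := sqr_ge0 (y s - g s); have := sqr_ge0 (q s - h s).
  move: (w s) (iw s) (y s) (q s) (g s) (h s) => A B C D E F; lra.
Qed.

(** The operator 1 - k^2 G is bounded below, on the complement of b_k if k is an eigenparameter.
    With g = u - k^2 y, the solution y is c b_k plus a function e that solves the system with
    forcing g and zero initial data, so e is controlled by g. The coefficient c is controlled by the
    orthogonality to b_k, or else by y(r) = 0. *)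
Lemma coercive k : 0 < k -> exists2 c, 1 <= c & forall u y p, solves u y p ->
  (b k r = 0 -> ip u (b k) = 0) ->
  ip u u <= c * ip (fun t => u t - k ^+ 2 * y t) (fun t => u t - k ^+ 2 * y t).
Proof.
move=> k0; have kn0 := lt0r_neq0 k0.
have [C C0 HC] := system_bound (ltW k0).
have [W W0 HW] := cont_bound r_ge0 iw_cont.
pose C1 := C * (W / k ^+ 2).
have k20 : 0 < k ^+ 2 by rewrite exprn_gt0.
have C10 : 0 < C1 by rewrite mulr_gt0// divr_gt0.
have [C2 C20 HC2] : exists2 C2, 0 <= C2 & forall u y p, solves u y p ->
    (b k r = 0 -> ip u (b k) = 0) ->
    let g := fun t => u t - k ^+ 2 * y t in
    forall c e, cont r e -> (forall t, 0 <= t <= r -> y t = e t + c * b k t) ->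
    (forall t, 0 <= t <= r -> e t ^+ 2 <= C1 * ip g g) ->
    c ^+ 2 <= C2 * ip g g.
  have [bk|bk] := eqVneq (b k r) 0.
    have N0 := ip_b_gt0 bk kn0.
    (* Orthogonality gives ip g b_k = - k^2 (ip e b_k + c N) with N = ip b_k b_k. Solve for c N, use
       (x + y)^2 <= 2 x^2 + 2 y^2 and Cauchy-Schwarz on each term. *)
    exists (2 * (k ^+ 4)^-1 / ip (b k) (b k) + 2 * (C1 * gam) / ip (b k) (b k)).
      by rewrite addr_ge0// divr_ge0 ?mulr_ge0// ltW// ?invr_gt0 ?exprn_gt0 ?gam_gt0.
    move=> u y p su /(_ bk) ub g c e ce yE eC.
    have [cu cy cp] := solves_cont su.
    have cg : cont r g by apply: contB => //; exact: contZ.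
    have h1 : ip g (b k) = - (k ^+ 2 * ip y (b k)).
      rewrite /g ipDl ?ub ?add0r//; last by apply: contN; exact: contZ.
      have -> : (fun t => - (k ^+ 2 * y t)) = (fun t => - k ^+ 2 * y t).
        by apply/funext => t; rewrite mulNr.
      by rewrite ipZl// mulNr.
    have h2 : ip y (b k) = ip e (b k) + c * ip (b k) (b k).
      rewrite -ipZl// -ipDl//; last exact: contZ.
      by apply: eq_J => s sr; rewrite yE.
    have h3 := ip_CS cg (b_cont k); have h4 := ip_CS ce (b_cont k).
    have h5 := ip_sup_le ce eC.
    rewrite h2 in h1.
    have h6 : (c * ip (b k) (b k)) ^+ 2 <=
       2 * (k ^+ 4)^-1 * ip g (b k) ^+ 2 + 2 * ip e (b k) ^+ 2.
      have -> : c * ip (b k) (b k) = - (ip g (b k) / k ^+ 2) - ip e (b k).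
        by rewrite h1; field.
      have -> : 2 * (k ^+ 4)^-1 * ip g (b k) ^+ 2 = 2 * (ip g (b k) / k ^+ 2) ^+ 2.
        by field.
      have := sqr_ge0 (ip g (b k) / k ^+ 2 - ip e (b k)); nra.
    have k4 : 0 <= 2 * (k ^+ 4)^-1 by rewrite mulr_ge0// invr_ge0 exprn_ge0// ltW.
    have h7 := ler_wpM2l k4 h3.
    have h8 : ip e e * ip (b k) (b k) <= C1 * ip g g * gam * ip (b k) (b k).
      by rewrite ler_wpM2r// ltW.
    rewrite -(ler_pM2r (exprn_gt0 2 N0)) -exprMn.
    have -> : (2 / k ^+ 4 / ip (b k) (b k) + 2 * (C1 * gam) / ip (b k) (b k)) * ip g g *
       ip (b k) (b k) ^+ 2 = 2 / k ^+ 4 * (ip g g * ip (b k) (b k)) +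
        2 * (C1 * ip g g * gam * ip (b k) (b k)).
      by field; rewrite kn0 gt_eqF.
    lra.
  (* Here y(r) = 0 reads e(r) = - c b_k(r) with b_k(r) nonzero. *)
  exists (C1 / b k r ^+ 2); first by rewrite divr_ge0 ?sqr_ge0// ltW.
  move=> u y p su _ g c e ce yE eC; have [_ _ _ _ yr] := su.
  have := yE r rr; rewrite yr => /esym/eqP; rewrite addr_eq0 => /eqP er.
  have := eC r rr; rewrite er sqrrN exprMn => h; rewrite mulrAC.
  by rewrite ler_pdivlMr// exprn_even_gt0.
pose N := ip (b k) (b k); have N0 : 0 <= N by exact: ip_ge0.
have g0 := ltW gam_gt0.
exists (1 + 3 * (1 + k ^+ 4 * (C1 * gam) + k ^+ 4 * C2 * N)).
  have k40 : 0 <= k ^+ 4 by rewrite exprn_ge0// ltW.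
  have := mulr_ge0 k40 (mulr_ge0 (ltW C10) g0).
  have := mulr_ge0 (mulr_ge0 k40 C20) N0; lra.
move=> u y p su ub; have [cu cy cp] := solves_cont su.
have [_ py pp y0 yr] := su.
set g := fun t => u t - k ^+ 2 * y t.
have cg : cont r g by apply: contB => //; exact: contZ.
(* Chosen to make both y - c b_k and p - c k a_k vanish at 0. *)
pose c := p 0 / k.
pose e t := y t - c * b k t.
have ce : cont r e by apply: contB => //; exact: contZ.
pose q t := k^-1 * (p t - c * (k * a k t)).
have eC t : 0 <= t <= r -> e t ^+ 2 <= C1 * ip g g.
  move=> tr.
  have pe : prim r e (fun t => k * (w t * q t) + 0).
    apply: eq_prim (primB r_gt0 py (primZ c (b_prim k))) => // s _.
    by rewrite /q; field.
  have pq : prim r q (fun t => - (k * (iw t * e t)) + - (iw t * g t / k)).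
    apply: eq_prim (primZ k^-1 (primB r_gt0 pp (primZ c (primZ k (a_prim k))))) => // s sr.
    by rewrite /e /g /iw; field; rewrite kn0 w_neq0.
  have cig : cont r (fun t => - (iw t * g t / k)).
    by apply: contN; apply: contM; [exact: contM|exact: cont_cst].
  have e0 : e 0 = 0 by rewrite /e y0 b0 mulr0 subrr.
  have q0 : q 0 = 0 by rewrite /q /c a0 mulr1 divfK// subrr mulr0.
  have kk : `|k| <= k by rewrite gtr0_norm.
  have := HC k e q _ _ kk (cont_cst 0) cig pe pq e0 q0 t tr.
  have qt := sqr_ge0 (q t).
  have : C * J r (fun t => 0 ^+ 2 + (- (iw t * g t / k)) ^+ 2) <= C1 * ip g g.
    rewrite /C1 -mulrA ler_pM2l// -(JZ rr _ (ip_cont cg cg)).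
    apply: (le_J rr); first by apply: contD; [exact: cont_cst|exact: contX].
      by apply: contZ; exact: ip_cont.
    move=> s sr; rewrite expr0n/= add0r sqrrN.
    have := HW s sr; rewrite ger0_norm ?iw_ge0// => Ws.
    have -> : (iw s * g s / k) ^+ 2 = iw s * (iw s * g s ^+ 2 / k ^+ 2) by field.
    have -> : W / k ^+ 2 * (iw s * g s * g s) = W * (iw s * g s ^+ 2 / k ^+ 2) by field.
    by rewrite ler_wpM2r// divr_ge0 ?(ltW k20)// mulr_ge0 ?sqr_ge0 ?iw_ge0.
  lra.
have yE t : 0 <= t <= r -> y t = e t + c * b k t by rewrite /e subrK.
have c2 := HC2 u y p su ub c e ce yE eC; rewrite -/g in c2.
have ee := ip_sup_le ce eC.
(* From u = g + k^2 e + k^2 c b_k and the inequality (x + y + z)^2 <= 3 (x^2 + y^2 + z^2). *)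
have h : ip u u <= 3 * (ip g g + k ^+ 4 * ip e e + k ^+ 4 * c ^+ 2 * N).
  have cgg := ip_cont cg cg; have cee := contZ (k ^+ 4) (ip_cont ce ce).
  have cbb := contZ (k ^+ 4 * c ^+ 2) (ip_cont (b_cont k) (b_cont k)).
  rewrite /N /ip -(JZ rr (k ^+ 4 * c ^+ 2) (ip_cont (b_cont k) (b_cont k))).
  rewrite -(JZ rr (k ^+ 4) (ip_cont ce ce)).
  rewrite -(JD rr cgg cee) -(JD rr (contD cgg cee) cbb).
  rewrite -(JZ rr 3 (contD (contD cgg cee) cbb)).
  apply: (le_J rr); [exact: ip_cont|by apply: contZ; do 2 apply: contD => //|].
  move=> s sr; have -> : u s = g s + k ^+ 2 * e s + k ^+ 2 * (c * b k s).
    by rewrite /g yE//; ring.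
  have -> : iw s * g s * g s + k ^+ 4 * (iw s * e s * e s) +
      k ^+ 4 * c ^+ 2 * (iw s * b k s * b k s)
     = iw s * (g s ^+ 2 + (k ^+ 2 * e s) ^+ 2 + (k ^+ 2 * (c * b k s)) ^+ 2) by ring.
  have := iw_ge0 sr.
  move: (iw s) (g s) (k ^+ 2 * e s) (k ^+ 2 * (c * b k s)) => I A B D I0.
  rewrite -[leLHS]mulrA [leRHS]mulrCA ler_wpM2l//.
  have := sqr_ge0 (A - B); have := sqr_ge0 (A - D); have := sqr_ge0 (B - D).
  nra.
have k40 : 0 <= k ^+ 4 by rewrite exprn_ge0// ltW.
have h1 := ler_wpM2l k40 ee.
have h2 := ler_wpM2r N0 (ler_wpM2l k40 c2).
have := ip_ge0 g; nra.
Qed.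

Definition high L u := cont r u /\ forall k, k < L -> zero k -> ip u (b k) = 0.

(* A supremum above [L^-2] of the Rayleigh quotient over [high L] would be an
   isolated point of the approximate spectrum, against [coercive]. *)
Lemma rayleigh L u y p : 0 < L -> high L u -> solves u y p ->
  ip u y <= L ^- 2 * ip u u.
Proof.
move=> L0 hu su; rewrite leNgt; apply/negP => ubig.
have [cu cy cp] := solves_cont su.
have uu : 0 < ip u u.
  rewrite lt_neqAle ip_ge0 andbT; apply/eqP => e; move: ubig.
  have := ip_CS cu cy; rewrite -e mul0r mulr0 => h; have := sqr_ge0 (ip u y).
  by nra.
pose Q := [set x | exists u y p, [/\ high L u, solves u y p, 0 < ip u u &
                                  x = ip u y / ip u u]].
have Qu : Q (ip u y / ip u u) by exists u, y, p; split.
have hsQ : has_sup Q.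
  split; first by exists (ip u y / ip u u).
  exists (alpha r * gam) => _ [u' [y' [p' [_ su' uu' ->]]]].
  by rewrite ler_pdivrMr//; exact: solves_bound su'.
pose s := sup Q.
have Qs x : Q x -> x <= s by move=> Qx; exact: sup_upper_bound.
have sL : L ^- 2 < s by apply: lt_le_trans (Qs _ Qu); rewrite ltr_pdivlMr.
have s0 : 0 < s by apply: le_lt_trans sL; rewrite invr_ge0 exprn_ge0// ltW.
have us u' y' p' : high L u' -> solves u' y' p' -> ip u' y' <= s * ip u' u'.
  move=> hu' su'; have := ip_ge0 u'; rewrite le_eqVlt => /predU1P[e|uu'].
    rewrite -e mulr0; have [cu' cy' _] := solves_cont su'.
    by have := ip_CS cu' cy'; rewrite -e mul0r => h; have := sqr_ge0 (ip u' y'); nra.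
  by rewrite -ler_pdivrMr//; apply: Qs; exists u', y', p'; split.
(* Then k^2 s = 1, and s > L^-2 means k < L, so [high L] provides the orthogonality that [coercive]
   asks for in case [k] is a zero. *)
pose k := (Num.sqrt s)^-1.
have k0 : 0 < k by rewrite invr_gt0 sqrtr_gt0.
have k2 : k ^+ 2 = s^-1 by rewrite /k exprVn sqr_sqrtr// ltW.
have kL : k < L.
  rewrite -(ltr_pXn2r (n := 2))// ?nnegrE ?ltW// k2 -(invrK (L ^+ 2)).
  by rewrite ltf_pV2// posrE// invr_gt0 exprn_gt0.
have [c c1 Hc] := coercive k0.
have c0 : 0 < c by exact: lt_le_trans c1.
have imp u' y' p' : high L u' -> solves u' y' p' ->
    ip u' y' <= s * (1 - c^-1) * ip u' u'.
  move=> hu' su'; have [cu' cy' cp'] := solves_cont su'.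
  have [z [q sy]] := solves_exists cy'.
  have [_ cz cq] := solves_cont sy.
  have hy : high L y'.
    split=> // l lL zl; have [l0 bl] := zl.
    have := solves_sym su' (zero_solves bl); rewrite ipZr// (hu'.2 l lL zl).
    by move/eqP; rewrite mulf_eq0 expf_eq0/= gt_eqF//= => /eqP.
  (* Cauchy-Schwarz for the energy gives (ip y y)^2 <= ip u y * ip y z with z the solution for the
     datum y; as y is again in [high L], ip y z <= s ip y y. *)
  have yy : ip y' y' <= s * ip u' y'.
    have e1 : ip y' y' = en p' q by rewrite (solves_en su' sy).
    have e2 : ip u' y' = en p' p' by rewrite ipC (solves_en su' su').
    have e3 : ip y' z = en q q by rewrite ipC (solves_en sy sy).
    have h1 := en_CS cp' cq; have h2 := us _ _ _ hy sy.
    rewrite -e1 -e2 -e3 in h1.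
    have uy0 : 0 <= ip u' y' by rewrite e2 en_ge0.
    have yy0 := ip_ge0 y'.
    have h3 := le_trans h1 (ler_wpM2l uy0 h2).
    move: yy0; rewrite le_eqVlt => /predU1P[<-|yy0]; first by rewrite mulr_ge0// ltW.
    rewrite -(ler_pM2r yy0); move: h3; rewrite expr2; lra.
  have bu : b k r = 0 -> ip u' (b k) = 0 by move=> bk; apply: hu'.2 => //.
  have := Hc _ _ _ su' bu.
  have -> : ip (fun t => u' t - k ^+ 2 * y' t) (fun t => u' t - k ^+ 2 * y' t) =
     ip u' u' - 2 * k ^+ 2 * ip u' y' + k ^+ 4 * ip y' y'.
    have E : (fun t => u' t - k ^+ 2 * y' t) = (fun t => u' t + - k ^+ 2 * y' t).
      by apply/funext => t; rewrite mulNr.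
    have cky := contZ (- k ^+ 2) cy'.
    rewrite E ipDl//; last exact: contD.
    rewrite !ipDr// !ipZl// !ipZr// (ipC y'); ring.
  have -> : k ^+ 4 = s^-1 * s^-1 by rewrite -k2; ring.
  rewrite k2 => H.
  (* The term k^4 ip y y is at most ip u y / s and so uses up half of the cross term. Every Rayleigh
     quotient is then at most s (1 - 1/c), below the supremum s. *)
  have : ip u' u' <= c * (ip u' u' - ip u' y' / s).
    apply: le_trans H _; rewrite ler_pM2l//.
    have : s^-1 * s^-1 * ip y' y' <= s^-1 * s^-1 * (s * ip u' y').
      by rewrite ler_wpM2l// mulr_ge0// invr_ge0 ltW.
    have -> : s^-1 * s^-1 * (s * ip u' y') = ip u' y' / s by field; rewrite gt_eqF.
    by lra.
  rewrite mulrC -ler_pdivrMr// => H2.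
  have : ip u' y' / s <= (1 - c^-1) * ip u' u' by lra.
  by rewrite ler_pdivrMr//; lra.
have : s <= s * (1 - c^-1).
  apply: ge_sup; first by case: hsQ.
  move=> _ [u' [y' [p' [hu' su' uu' ->]]]].
  by rewrite ler_pdivrMr//; exact: imp su'.
have : 0 < s * c^-1 by rewrite mulr_gt0// invr_gt0.
lra.
Qed.
Definition green s t := Num.min (alpha s) (alpha t) - alpha s * alpha t / alpha r.

Lemma green_cont s : cont r (green s).
Proof.
apply: contB; last by apply: contM; [apply: contM => //; exact: cont_cst|exact: cont_cst].
apply: (@cont_comp _ r alpha (Num.min (alpha s))) => // x.
by apply: continuous_min => //; exact: cvg_cst.
Qed.

Lemma alpha_min s t : 0 <= s <= r -> 0 <= t <= r ->
  alpha (Num.min s t) = Num.min (alpha s) (alpha t).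
Proof.
move=> /andP[s0 sr] /andP[t0 tr]; have [st|ts] := leP s t.
  by rewrite (min_idPl _)// alpha_incr_ge.
by rewrite (min_idPr _)// alpha_incr_ge// ltW.
Qed.

(** Split the integral of the minimum at t. On the left the minimum is alpha_s and (alpha p)' = w p
    - alpha u / w applies; on the right it is alpha_t and p' = - u / w applies. *)
Lemma green_ip u y p t : solves u y p -> 0 <= t <= r -> ip (green t) u = y t.
Proof.
move=> su tr; have [cu cy cp] := solves_cont su; have [_ py pp y0 yr] := su.
have /andP[t0 tr'] := tr.
have ciu : cont r (fun s => iw s * u s) by exact: contM.
have cau : cont r (fun s => alpha s * (iw s * u s)) by exact: contM.
have cwp : cont r (fun s => w s * p s) by exact: contM.
have Jiu s : 0 <= s <= r -> J s (fun s => iw s * u s) = p 0 - p s.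
  move=> sr; rewrite (primE pp sr) (JN sr ciu); ring.
have Jau s : 0 <= s <= r -> J s (fun s => alpha s * (iw s * u s)) = y s - alpha s * p s.
  move=> sr; have := primE (prim_mul r_gt0 alpha_prim pp) sr.
  rewrite alpha0 mul0r add0r (primE py sr) y0 add0r => ->.
  have -> : J s (fun t => w t * p t + alpha t * - (iw t * u t)) =
      J s (fun t => w t * p t - alpha t * (iw t * u t)).
    by apply: eq_J => x _; rewrite mulrN.
  by rewrite (JB sr cwp cau); ring.
pose m s := Num.min (alpha t) (alpha s).
have cm : cont r m.
  have := contD (@green_cont t) (contM (contM (cont_cst (alpha t)) alpha_cont) (cont_cst (alpha r)^-1)).
  by apply: eq_cont => s _; rewrite /green subrK.
have cmu : cont r (fun s => m s * (iw s * u s)) by exact: contM.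
have J1 : J r (fun s => m s * (iw s * u s)) =
    y t - alpha t * p t + alpha t * (p t - p r).
  rewrite -[LHS](subrK (J t (fun s => m s * (iw s * u s)))) addrC; congr (_ + _).
    rewrite -Jau//; apply: eq_J => s /andP[s0 st]; congr (_ * _).
    by rewrite /m (min_idPr _)// alpha_incr_ge.
  rewrite (@J_incr_eq _ r t r _ (fun s => alpha t * (iw s * u s)))//.
  - rewrite (JZ rr _ ciu) (JZ tr _ ciu) !Jiu//; ring.
  - exact: contZ.
  - move=> x /andP[tx xr]; congr (_ * _).
    by rewrite /m (min_idPl _)// alpha_incr_ge.
have E : ip (green t) u = J r (fun s => m s * (iw s * u s)) -
    alpha t / alpha r * J r (fun s => alpha s * (iw s * u s)).
  rewrite -(JZ rr _ cau) -(JB rr cmu (contZ _ cau)).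
  by apply: eq_J => s _; rewrite /green /m; ring.
rewrite E J1 Jau// yr; field; exact: lt0r_neq0 alpha_gt0.
Qed.

Definition rest (F : seq R) s t :=
  green s t - \sum_(k <- F) b k s * b k t / (k ^+ 2 * ip (b k) (b k)).

Definition zeros (F : seq R) := uniq F /\ forall k, k \in F -> zero k.

Lemma rest_cont F s : cont r (rest F s).
Proof.
apply: contB; first exact: green_cont.
apply: cont_sum => k; apply: contM; last exact: cont_cst.
exact: contZ.
Qed.

Lemma greenC s t : green s t = green t s.
Proof. by rewrite /green minC (mulrC (alpha s)). Qed.

Lemma restC F s t : rest F s t = rest F t s.
Proof.
by rewrite /rest greenC; congr (_ - _); apply: eq_bigr => k _; rewrite (mulrC (b k s)).
Qed.

Lemma green_diag t : green t t = alpha t - alpha t ^+ 2 / alpha r.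
Proof. by rewrite /green minxx expr2. Qed.

(* [rest F] is a covariance; this is supplied by the Gaussian process. *)
Hypothesis rest_psd : forall F s t (x x' : R), zeros F ->
  0 <= s <= r -> 0 <= t <= r ->
  0 <= x ^+ 2 * rest F s s + 2 * (x * x') * rest F s t + x' ^+ 2 * rest F t t.

Lemma rest_ge0 F t : zeros F -> 0 <= t <= r -> 0 <= rest F t t.
Proof.
move=> zF tr; have := @rest_psd F t t 1 0 zF tr tr.
by rewrite expr0n/= !mulr0 !mul0r !addr0 expr1n mul1r.
Qed.

Lemma zero_term_ge0 k x : zero k -> 0 <= x ^+ 2 / (k ^+ 2 * ip (b k) (b k)).
Proof. by move=> _; rewrite divr_ge0 ?sqr_ge0// mulr_ge0 ?sqr_ge0 ?ip_ge0. Qed.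

Lemma rest_le F t : zeros F -> 0 <= t <= r -> rest F t t <= alpha r.
Proof.
move=> [_ zF] tr; rewrite /rest; have /andP[t0 tr'] := tr.
have : 0 <= \sum_(k <- F) b k t * b k t / (k ^+ 2 * ip (b k) (b k)).
  by rewrite big_seq; apply: sumr_ge0 => k /zF zk; rewrite -expr2 zero_term_ge0.
have := alpha_incr_ge t0 tr' (lexx r).
have : 0 <= alpha t ^+ 2 / alpha r by rewrite divr_ge0 ?sqr_ge0// ltW// alpha_gt0.
rewrite green_diag; lra.
Qed.

(** Cauchy-Schwarz for the positive form bounds the square by [rest F t t] times the variance of the
    increment from s to t. Subtracting the sum over [F] only lowers that variance, which for the
    Green function is at most a constant times |t - s|; hence the uniformity in [F]. *)
Lemma rest_incr : exists2 W, 0 < W & forall F s t, zeros F ->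
  0 <= s <= r -> 0 <= t <= r ->
  (rest F t t - rest F t s) ^+ 2 <= W * `|t - s|.
Proof.
have [W W0 HW] := cont_bound r_ge0 w_cont.
have al := alpha_gt0.
exists (alpha r * W); first by rewrite mulr_gt0.
move=> F s t zF sr tr; have [_ zF'] := zF.
pose Q := rest F t t - 2 * rest F s t + rest F s s.
have Q1 : Q <= W * `|t - s|.
  have -> : Q = green t t - 2 * green s t + green s s -
      \sum_(k <- F) (b k t - b k s) ^+ 2 / (k ^+ 2 * ip (b k) (b k)).
    rewrite /Q /rest.
    have -> : \sum_(k <- F) (b k t - b k s) ^+ 2 / (k ^+ 2 * ip (b k) (b k)) =
      \sum_(k <- F) b k t * b k t / (k ^+ 2 * ip (b k) (b k)) -
      2 * (\sum_(k <- F) b k s * b k t / (k ^+ 2 * ip (b k) (b k))) +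
      \sum_(k <- F) b k s * b k s / (k ^+ 2 * ip (b k) (b k)).
      rewrite mulr_sumr -sumrB -big_split/=; apply: eq_bigr => k _; ring.
    by ring.
  have : 0 <= \sum_(k <- F) (b k t - b k s) ^+ 2 / (k ^+ 2 * ip (b k) (b k)).
    by rewrite big_seq; apply: sumr_ge0 => k /zF' zk; exact: zero_term_ge0.
  have : green t t - 2 * green s t + green s s <= W * `|t - s|.
    have -> : green t t - 2 * green s t + green s s =
       alpha t + alpha s - 2 * Num.min (alpha s) (alpha t) - (alpha t - alpha s) ^+ 2 / alpha r.
      by rewrite !green_diag /green; field; rewrite gt_eqF.
    have q0 : 0 <= (alpha t - alpha s) ^+ 2 / alpha r by rewrite divr_ge0 ?sqr_ge0// ltW.
    have inc (x y : R) : 0 <= x <= r -> 0 <= y <= r -> x <= y -> alpha y - alpha x <= W * (y - x).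
      move=> xr yr xy; rewrite (alphaE xr) (alphaE yr).
      case/andP: xr => x0 _; case/andP: yr => _ yr.
      apply: le_trans (ler_norm _) (J_incr_bound x0 xy yr w_cont _).
      by move=> z /andP[xz zy]; rewrite HW// (le_trans x0)// (le_trans zy).
    have [st|ts] := leP s t.
      rewrite (min_idPl _); last by case/andP: sr => ? _; case/andP: tr => _ ?; exact: alpha_incr_ge.
      by rewrite ger0_norm ?subr_ge0//; have := inc s t sr tr st; lra.
    rewrite (min_idPr _); last by case/andP: tr => ? _; case/andP: sr => _ ?; apply: alpha_incr_ge => //; exact: ltW.
    by rewrite ltr0_norm ?subr_lt0//; have := inc t s tr sr (ltW ts); lra.
  lra.
(* The weights - x at s and 1 + x at t test the kernel on delta_t + x (delta_t - delta_s). *)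
have key x : 0 <= rest F t t + 2 * x * (rest F t t - rest F t s) + x ^+ 2 * Q.
  have := @rest_psd F s t (- x) (1 + x) zF sr tr.
  by rewrite /Q (restC F t s); lra.
have Q0 : 0 <= Q.
  have := @rest_psd F s t (- 1) 1 zF sr tr; rewrite /Q; lra.
apply: le_trans (discriminant_le Q0 key) _; rewrite -mulrA.
by apply: ler_pM => //; [exact: rest_ge0|exact: rest_le].
Qed.

Lemma zeros_bessel F u : zeros F -> cont r u ->
  let v := fun t => u t - \sum_(k <- F) ip u (b k) / ip (b k) (b k) * b k t in
  [/\ cont r v, forall k, k \in F -> ip v (b k) = 0 & ip v v <= ip u u].
Proof.
move=> [uF zF] cu v.
pose S t := \sum_(k <- F) ip u (b k) / ip (b k) (b k) * b k t.
have cS : cont r S by apply: cont_sum => k; exact: contZ.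
have cv : cont r v by exact: contB.
have vb k : k \in F -> ip v (b k) = 0.
  move=> kF; have [k0 bk] := zF k kF; have N0 := ip_b_gt0 bk (lt0r_neq0 k0).
  have -> : ip v (b k) = ip u (b k) - ip S (b k).
    have E : v = (fun t => u t + -1 * S t) by apply/funext => t; rewrite mulN1r.
    by rewrite E ipDl// ?ipZl// ?mulN1r//; exact: contZ.
  rewrite /S ip_suml//; last by move=> j; exact: contZ.
  rewrite (bigD1_seq k)//= ipZl// divfK ?gt_eqF// big_seq_cond big1 ?addr0 ?subrr//.
  by move=> j /andP[jF jk]; rewrite ipZl// (zero_orth (zF j jF) (zF k kF) jk) mulr0.
split=> //.
have vS : ip v S = 0.
  rewrite ipC /S ip_suml//; last by move=> j; exact: contZ.
  rewrite big_seq big1// => k kF; by rewrite ipZl// (ipC (b k) v) vb ?mulr0.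
have E : u = (fun t => v t + S t) by apply/funext => t; rewrite subrK.
clearbody v S; rewrite [in leRHS]E ipDl// ?ipDr//; last exact: contD.
by rewrite (ipC S v) vS addr0 add0r lerDl ip_ge0.
Qed.

Lemma tent e t : 0 < e -> e <= r -> 0 <= t <= r ->
  exists h : R -> R, [/\ cont r h, forall s, 0 <= h s <= 1,
    forall s, h s != 0 -> `|t - s| <= e & e / 4 <= J r h].
Proof.
move=> e0 er tr; have /andP[t0 tr'] := tr.
pose h s := Num.max 0 (1 - `|t - s| / e).
have ch : continuous h.
  move=> s; apply: (@continuous_max _ _ (fun=> 0) (fun s => 1 - `|t - s| / e)).
    exact: cvg_cst.
  apply: cvgB; first exact: cvg_cst.
  apply: cvgM; last exact: cvg_cst.
  by apply: cvg_norm; apply: cvgB; [exact: cvg_cst|exact: cvg_id].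
have h0 s : 0 <= h s by rewrite le_max lexx.
exists h; split.
- exact: cont_continuous.
- by move=> s; rewrite h0 ge_max ler01/= lerBlDr lerDl divr_ge0// ltW.
- move=> s; apply: contraNT; rewrite -ltNge => es; apply/eqP/max_idPl.
  by rewrite subr_le0 ler_pdivlMr// mul1r ltW.
have half s : `|t - s| <= e / 2 -> 1 / 2 <= h s.
  move=> ts; rewrite le_max; apply/orP; right.
  have : `|t - s| / e <= 1 / 2 by rewrite ler_pdivrMr//; lra.
  lra.
(* A half-window of length e / 2 at t fits into [0, r]: on the left if t >= e / 2, otherwise on the
   right because e <= r. The bump is at least 1/2 there, whence e / 4. *)
have [x [y [x0 xy yr H]]] : exists x y : R, [/\ 0 <= x, x + e / 2 <= y, y <= r &
    forall s, x <= s <= y -> `|t - s| <= e / 2].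
  have [te|te] := leP (e / 2) t.
    exists (t - e / 2), t; split => //; try lra.
    by move=> s /andP[? ?]; rewrite ger0_norm; lra.
  exists t, (t + e / 2); split => //; try lra.
  by move=> s /andP[? ?]; rewrite ler0_norm; lra.
have ch' := @cont_continuous _ r h ch.
have xy' : x <= y by lra.
have := J_incr_ge x0 xy' yr ch' (fun s hs => half s (H s hs)).
have := J_le_subset (le_trans x0 xy') yr (lexx r) ch' (fun s _ => h0 s).
have : 0 <= J x h by apply: J_ge0 => s _.
lra.
Qed.

(* Testing the remainder kernel against a bump of width [e] around [t] costs
   [sqrt e] by [rest_incr], and the smoothed kernel is controlled by
   [rayleigh]; the choice [e = 1 / L] balances both. *)
Lemma rest_small : exists2 C, 0 < C & forall F L t, zeros F ->
  (forall k, k < L -> zero k -> k \in F) -> r^-1 <= L -> 0 <= t <= r ->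
  rest F t t <= C / Num.sqrt L.
Proof.
have [D D0 HD] := rest_incr.
have [W W0 HW] := cont_bound r_ge0 w_cont.
have al := alpha_gt0.
have W4 : 0 < 4 * W * alpha r by rewrite !mulr_gt0.
exists (Num.sqrt D + Num.sqrt (4 * W * alpha r)).
  by rewrite addr_gt0// sqrtr_gt0.
move=> F L t zF FL rL tr; have [uF zF'] := zF.
have L0 : 0 < L by apply: lt_le_trans rL; rewrite invr_gt0.
pose e := L^-1; have e0 : 0 < e by rewrite invr_gt0.
have er : e <= r by rewrite -(invrK r) lef_pV2// posrE ?invr_gt0.
have [h [ch h01 hsupp hJ]] := tent e0 er tr.
(* Dividing the bump by its mass for ds / w makes it an approximate delta function for [ip], of
   squared norm at most 1 / i <= 4 W / e. *)
pose i := J r (fun s => iw s * h s).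
have cih : cont r (fun s => iw s * h s) by exact: contM.
have i_ge : e / (4 * W) <= i.
  have -> : e / (4 * W) = W^-1 * (e / 4) by field; rewrite gt_eqF.
  apply: le_trans (_ : W^-1 * J r h <= _); first by rewrite ler_pM2l// invr_gt0.
  rewrite -(JZ rr _ ch); apply: (le_J rr) => //; first exact: contZ.
  move=> s sr; rewrite ler_wpM2r//; first by case/andP: (h01 s).
  by rewrite /iw lef_pV2 ?posrE ?w_gt0// (le_trans (ler_norm _))// HW.
have i0 : 0 < i by apply: lt_le_trans i_ge; rewrite divr_gt0// mulr_gt0.
pose u s := i^-1 * h s.
have cu : cont r u by exact: contZ.
have Ju : J r (fun s => iw s * u s) = 1.
  have -> : J r (fun s => iw s * u s) = J r (fun s => i^-1 * (iw s * h s)).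
    by apply: eq_J => s _; rewrite /u; ring.
  by rewrite (JZ rr _ cih) mulVf// gt_eqF.
have uu : ip u u <= i^-1.
  have -> : i^-1 = i^-1 ^+ 2 * i by field; rewrite gt_eqF.
  rewrite -(JZ rr _ cih); apply: (le_J rr); [exact: ip_cont|exact: contZ|].
  move=> s sr; have /andP[h0 h1] := h01 s.
  have -> : iw s * u s * u s = i^-1 ^+ 2 * (iw s * h s * h s) by rewrite /u; ring.
  rewrite ler_wpM2l ?sqr_ge0// ler_piMr// mulr_ge0// iw_ge0//.
have [y0 [p0 su]] := solves_exists cu.
have [cv vF vv] := zeros_bessel zF cu.
set v := (fun t => u t - _) in cv vF vv.
pose c k := ip u (b k) / ip (b k) (b k).
pose y s := y0 s - \sum_(k <- F) c k / k ^+ 2 * b k s.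
have [p sv] : exists p, solves v y p.
  have sS : solves (fun t => \sum_(k <- F) c k * b k t)
      (fun t => \sum_(k <- F) c k / k ^+ 2 * b k t)
      (fun t => \sum_(k <- F) c k / k ^+ 2 * (k * a k t)).
    have := @solves_sum _ F (fun k t => c k / k ^+ 2 * (k ^+ 2 * b k t))
      (fun k t => c k / k ^+ 2 * b k t) (fun k t => c k / k ^+ 2 * (k * a k t)).
    have -> : (fun t => \sum_(k <- F) c k / k ^+ 2 * (k ^+ 2 * b k t)) =
       (fun t => \sum_(k <- F) c k * b k t).
      apply/funext => s; apply: eq_big_seq => k /zF'[k0 _].
      by rewrite mulrA divfK// expf_eq0/= gt_eqF.
    apply=> k /zF'[_ bk]; apply: solvesZ; exact: zero_solves.
  have := solvesD su (solvesZ (-1) sS).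
  have -> : (fun t => u t + -1 * \sum_(k <- F) c k * b k t) = v.
    by apply/funext => s; rewrite mulN1r.
  have -> : (fun t => y0 t + -1 * \sum_(k <- F) c k / k ^+ 2 * b k t) = y.
    by apply/funext => s; rewrite mulN1r.
  by move=> H; eexists; exact: H.
have [_ cy cp] := solves_cont sv.
have hv : high L v by split=> // k kL zk; apply: vF; exact: FL.
(* The supremum is bounded by the energy, the energy is ip v y, and [rayleigh] gains L^-2. As 1 / i
   is at most of order L, the square is of order 1 / L. *)
have yt : y t ^+ 2 <= alpha r * (L ^- 2 * i^-1).
  apply: le_trans (solves_sup sv tr) _; rewrite ler_pM2l//.
  rewrite -(solves_en sv sv) ipC; apply: le_trans (rayleigh L0 hv sv) _.
  by rewrite ler_pM2l ?invr_gt0 ?exprn_gt0//; exact: le_trans vv uu.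
(* Testing the remainder kernel with u amounts to evaluating at t the solution for the projected
   datum v. *)
have restu : ip (rest F t) u = y t.
  pose S s := \sum_(k <- F) b k t / (k ^+ 2 * ip (b k) (b k)) * b k s.
  have cS : cont r S by apply: cont_sum => k; exact: contZ.
  have E : rest F t = (fun s => green t s + -1 * S s).
    apply/funext => s; rewrite /rest mulN1r /S; congr (_ - _).
    by apply: eq_bigr => k _; ring.
  rewrite E ipDl//; [|exact: green_cont|exact: contZ].
  rewrite (green_ip su tr) ipZl// mulN1r /y; congr (_ - _).
  rewrite ip_suml//; last by move=> k; exact: contZ.
  apply: eq_big_seq => k /zF'[k0 bk]; rewrite ipZl// (ipC (b k)) /c.
  have kn := lt0r_neq0 k0; have Nn := lt0r_neq0 (ip_b_gt0 bk kn).
  by field; rewrite kn Nn.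
have crest := @rest_cont F t.
have diff : rest F t t - y t <= Num.sqrt (D * e).
  rewrite -restu -[rest F t t]mulr1 -Ju -[X in X - _](JZ rr _ (contM iw_cont cu)).
  rewrite /ip -(JB rr (contZ _ (contM iw_cont cu)) (ip_cont crest cu)).
  rewrite -[leRHS]mulr1 -Ju -(JZ rr _ (contM iw_cont cu)).
  apply: (le_J rr); last 1 first.
  - move=> s sr; have u0 : 0 <= u s by rewrite mulr_ge0 ?invr_ge0 ?(ltW i0)//; case/andP: (h01 s).
    have -> : rest F t t * (iw s * u s) - iw s * rest F t s * u s =
      (rest F t t - rest F t s) * (iw s * u s) by ring.
    have [us|us] := eqVneq (u s) 0; first by rewrite us !mulr0.
    apply: ler_wpM2r; first by apply: mulr_ge0 => //; exact: iw_ge0.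
    apply: le_trans (ler_norm _) _.
    rewrite -sqrtr_sqr ler_wsqrtr//; apply: le_trans (HD F s t zF sr tr) _.
    rewrite ler_pM2l// hsupp//; apply: contraNneq us => hs.
    by rewrite /u hs mulr0.
  - by apply: contB; [apply: contZ; exact: contM|exact: ip_cont].
  - by apply: contZ; exact: contM.
have yt' : y t <= Num.sqrt (4 * W * alpha r * e).
  apply: le_trans (ler_norm _) _; rewrite -sqrtr_sqr ler_wsqrtr//.
  apply: le_trans yt _.
  have -> : 4 * W * alpha r * e = alpha r * (L ^- 2 * (4 * W / e)).
    by rewrite /e; field; rewrite gt_eqF.
  rewrite ler_pM2l// ler_pM2l ?invr_gt0 ?exprn_gt0//.
  have -> : 4 * W / e = (e / (4 * W))^-1 by rewrite invf_div.
  by rewrite lef_pV2// posrE divr_gt0// mulr_gt0.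
have sL : (Num.sqrt L)^-1 = Num.sqrt e by rewrite sqrtrV// ltW.
rewrite mulrDl sL -(sqrtrM _ (ltW D0)) -(sqrtrM _ (ltW W4)); lra.
Qed.

(** A trace bound: integrate the nonnegative diagonal [rest F t t] against dt / w. *)
Lemma zeros_sum F : zeros F ->
  \sum_(k <- F) (k ^+ 2)^-1 <= J r (fun t => iw t * (alpha t - alpha t ^+ 2 / alpha r)).
Proof.
move=> zF; have [uF zF'] := zF.
have ck k : cont r (fun t => (k ^+ 2 * ip (b k) (b k))^-1 * (iw t * b k t * b k t)).
  by apply: contZ; exact: ip_cont.
have -> : \sum_(k <- F) (k ^+ 2)^-1 =
    J r (fun t => \sum_(k <- F) (k ^+ 2 * ip (b k) (b k))^-1 * (iw t * b k t * b k t)).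
  rewrite (J_sum rr)//; apply: eq_big_seq => k /zF'[k0 bk].
  rewrite (JZ rr _ (ip_cont (b_cont k) (b_cont k))) -/(ip (b k) (b k)).
  have kn := lt0r_neq0 k0; have Nn := lt0r_neq0 (ip_b_gt0 bk kn).
  by field; rewrite kn Nn.
apply: (le_J rr); first exact: cont_sum.
  apply: contM => //; apply: contB => //; apply: contM; [exact: contX|exact: cont_cst].
move=> s sr; have := mulr_ge0 (iw_ge0 sr) (rest_ge0 zF sr).
rewrite /rest mulrBr subr_ge0 green_diag; apply: le_trans.
by rewrite mulr_sumr le_eqVlt; apply/orP; left; apply/eqP; apply: eq_bigr => k _; ring.
Qed.

(** If [F] held all zeros, [rest_small] with L tending to infinity would make the diagonal of
    [rest F] vanish. But near 0 the diagonal of the Green function has order t, like alpha_t, while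
    a finite sum of b_k(t)^2 has order t^2. *)
Lemma zeros_infinite F : zeros F -> exists2 k, zero k & k \notin F.
Proof.
move=> zF; have [uF zF'] := zF; apply: contrapT => H.
have FL k : zero k -> k \in F.
  by move=> zk; apply: contrapT => /negP kF; apply: H; exists k.
have [C C0 HC] := rest_small.
have rest0 t : 0 <= t <= r -> rest F t t <= 0.
  move=> tr; apply/ler_addgt0Pr => e e0; rewrite add0r.
  pose L := Num.max r^-1 ((C / e) ^+ 2).
  have L0 : 0 < L by rewrite lt_max invr_gt0 r_gt0.
  apply: le_trans (HC F L t zF (fun k _ => FL k) _ tr) _.
    by rewrite le_max lexx.
  rewrite ler_pdivrMr ?sqrtr_gt0// mulrC -ler_pdivrMr//.
  have -> : C / e = Num.sqrt ((C / e) ^+ 2) by rewrite sqrtr_sqr ger0_norm// ltW// divr_gt0.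
  by rewrite ler_wsqrtr// le_max lexx orbT.
have [m m0 Hm] := cont_pos_min r_ge0 w_cont w_gt0.
have [W W0 HW] := cont_bound r_ge0 w_cont.
have al := alpha_gt0.
have [c c0 Hc] : exists2 c, 0 <= c & forall t, 0 <= t <= r ->
    \sum_(k <- F) b k t * b k t / (k ^+ 2 * ip (b k) (b k)) <= c * t ^+ 2.
  have Hb k : exists c, 0 <= c /\ forall t, 0 <= t <= r ->
      b k t * b k t / (k ^+ 2 * ip (b k) (b k)) <= c * t ^+ 2.
    have [c c0 cb] := cont_bound r_ge0 (prim_der (b_prim k)).
    exists (c ^+ 2 / (k ^+ 2 * ip (b k) (b k))); split.
      by rewrite divr_ge0 ?sqr_ge0// mulr_ge0 ?sqr_ge0 ?ip_ge0.
    move=> t tr; have /andP[t0 tr'] := tr.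
    rewrite [leRHS]mulrAC; apply: ler_wpM2r.
      by rewrite invr_ge0 mulr_ge0 ?sqr_ge0 ?ip_ge0.
    rewrite -expr2 -exprMn -[leLHS]real_normK ?num_real//.
    rewrite ler_pXn2r// ?nnegrE ?mulr_ge0 ?(ltW c0)//.
    have cbt x : 0 <= x <= t -> `|k * (a k x * w x)| <= c.
      by move=> /andP[x0 xt]; apply: cb; rewrite x0 (le_trans xt).
    have := J_incr_bound (lexx 0) t0 tr' (prim_der (b_prim k)) cbt.
    by rewrite J_0 !subr0 (primE (b_prim k) tr) b0 add0r.
  elim: (F) => [|k s [c [c0 ih]]].
    by exists 0 => // t _; rewrite big_nil mul0r.
  have [c' [c'0 ck]] := Hb k.
  exists (c' + c); first by rewrite addr_ge0.
  by move=> t tr; rewrite big_cons mulrDl lerD// ?ck// ih.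
(* The second bound gives alpha_t^2 / alpha_r <= alpha_t / 2, the third gives c t^2 <= m t / 4, so
   the diagonal is at least m t / 4 > 0. *)
pose t := Num.min (Num.min r (alpha r / (2 * W))) (m / (4 * (c + 1))).
have t0 : 0 < t by rewrite !lt_min r_gt0 !divr_gt0// mulr_gt0// ltr_wpDl.
have tr : 0 <= t <= r by rewrite (ltW t0) !ge_min lexx.
have /andP[_ tr'] := tr.
have tW : t <= alpha r / (2 * W) by rewrite !ge_min lexx orbT.
have tm : t <= m / (4 * (c + 1)) by rewrite !ge_min lexx !orbT.
have am : m * t <= alpha t.
  rewrite (alphaE tr) -(J_cst tr); apply: (le_J tr); [exact: cont_cst|exact: w_cont|].
  by move=> s /andP[s0 st]; apply: Hm; rewrite s0 (le_trans st).
have aW : alpha t <= W * t.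
  rewrite (alphaE tr) -(J_cst tr); apply: (le_J tr); [exact: w_cont|exact: cont_cst|].
  by move=> s /andP[s0 st]; apply: le_trans (ler_norm _) (HW _ _); rewrite s0 (le_trans st).
have := rest0 t tr; rewrite /rest green_diag; have := Hc t tr.
have : alpha t ^+ 2 / alpha r <= alpha t / 2.
  rewrite ler_pdivrMr// expr2 -mulrA ler_wpM2l//.
    by apply: le_trans am; rewrite mulr_ge0// ltW.
  move: tW; rewrite ler_pdivlMr ?mulr_gt0//; lra.
move: tm; rewrite ler_pdivlMr; last by rewrite mulr_gt0// ltr_wpDl.
have : 0 < m * t by rewrite mulr_gt0.
nra.
Qed.

(** By [zeros_sum] a list of zeros below L has at most tau L^2 entries, so there is a longest one; a
    zero below L that it omitted could be added to it. *)
Lemma zeros_below L : exists F, zeros F /\ forall k, k < L -> zero k -> k \in F.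
Proof.
pose tau := J r (fun t => iw t * (alpha t - alpha t ^+ 2 / alpha r)).
pose ok n := exists F, [/\ zeros F, forall k, k \in F -> k < L & size F = n].
have bnd n : `[< ok n >] -> (n <= Num.bound (tau * L ^+ 2))%N.
  move=> /asboolP[F [zF FL <-]]; have [uF zF'] := zF.
  case: F zF FL uF zF' => [//|x F'] zF FL uF zF'; set F := x :: F' in zF FL uF zF' *.
  have L0 : 0 < L.
    by have [x0 _] := zF' x (mem_head _ _); apply: lt_trans x0 (FL _ (mem_head _ _)).
  rewrite -(ler_nat R); apply: le_trans (ltW (archi_boundP _)); last first.
    rewrite mulr_ge0 ?sqr_ge0//; apply: le_trans (zeros_sum zF).
    by apply: sumr_ge0 => k _; rewrite invr_ge0 sqr_ge0.
  rewrite -ler_pdivrMr ?exprn_gt0//; apply: le_trans (zeros_sum zF).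
  have -> : (size F)%:R / L ^+ 2 = \sum_(k <- F) (L ^+ 2)^-1.
    by rewrite big_const_seq count_predT iter_addr_0 mulr_natl.
  rewrite big_seq [leRHS]big_seq; apply: ler_sum => k kF; have [k0 _] := zF' k kF.
  by rewrite lef_pV2 ?posrE ?exprn_gt0// ler_pXn2r ?nnegrE ?ltW// FL.
have ex0 : exists n, `[< ok n >] by exists 0%N; apply/asboolP; exists [::].
case: (ex_maxnP ex0 bnd) => n /asboolP[F [zF FL Fn]] nmax; have [uF zF'] := zF.
exists F; split=> // k kL zk; apply: contrapT => /negP kF.
suff /nmax : `[< ok n.+1 >] by rewrite ltnn.
apply/asboolP; exists (k :: F); split=> /=; last by rewrite Fn.
  split; first by rewrite /= kF.
  by move=> j; rewrite inE => /predU1P[->|/zF'].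
by move=> j; rewrite inE => /predU1P[->|/FL].
Qed.

Let seq_min (x : R) (s : seq R) :
  exists2 m, m \in x :: s & forall j, j \in x :: s -> m <= j.
Proof.
elim: s x => [|z s ih] x.
  by exists x; [exact: mem_head|move=> j; rewrite inE => /eqP ->].
have [m ms mj] := ih z; have [xm|mx] := leP x m.
  exists x; first exact: mem_head.
  by move=> j; rewrite in_cons => /predU1P[->//|/mj]; exact: le_trans.
exists m; first by rewrite in_cons ms orbT.
by move=> j; rewrite in_cons => /predU1P[->|/mj//]; exact: ltW.
Qed.

Lemma zeros_enum : exists lam : nat -> R,
  (forall n, lam n < lam n.+1) /\ range lam = [set k | zero k].
Proof.
have nxt x : exists n, [/\ zero n, x < n & forall k, zero k -> x < k -> n <= k].
  have [F0 [zF0 F0x]] := zeros_below (x + 1).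
  have [k zk kF0] := zeros_infinite zF0.
  have xk : x < k.
    by rewrite ltNge; apply: contra kF0 => kx; apply: F0x => //; rewrite ltr_pwDr.
  have [F [[uF zF] Fk]] := zeros_below k.
  have [m ms mj] := seq_min k [seq j <- F | x < j].
  exists m; split.
  - by move: ms; rewrite in_cons mem_filter => /predU1P[->//|/andP[_ /zF]].
  - by move: ms; rewrite in_cons mem_filter => /predU1P[->//|/andP[]].
  - move=> j zj xj; have [jk|kj] := ltP j k.
      by apply: mj; rewrite in_cons mem_filter xj (Fk j jk zj) orbT.
    by apply: le_trans kj; apply: mj; exact: mem_head.
have [f fP] := choice nxt.
(* The shift starts the sequence at the least zero above 0 instead of at 0. *)
pose lam n := iter n.+1 f 0.
have lam_lt n : lam n < lam n.+1 by have [] := fP (lam n).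
have lam_zero n : zero (lam n) by rewrite /lam iterS; have [] := fP (iter n f 0).
have lam_mono : {mono lam : n m / (n <= m)%N >-> n <= m}.
  by apply: le_mono; apply: homo_ltn => //; exact: lt_trans.
exists lam; split=> //; apply/seteqP; split=> [_ [n _ <-]|k /= zk]; first exact: lam_zero.
apply: contrapT => H.
have lk n : lam n < k.
  have le_k m : iter m f 0 < k -> lam m < k.
    move=> mk; rewrite lt_neqAle; apply/andP; split.
      by apply/eqP => E; apply: H; exists m.
    by have [_ _] := fP (iter m f 0); apply.
  elim: n => [|n ih]; last exact: le_k.
  by apply: le_k; case: zk.
have [F [[uF zF] Fk]] := zeros_below k.
(* A zero k missed by [lam] would lie above every [lam n], giving more zeros below k than the finite
   list [F] holds. *)
have : (size [seq lam i | i <- iota 0 (size F).+1] <= size F)%N.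
  apply: uniq_leq_size; last by move=> _ /mapP[i _ ->]; exact: Fk.
  rewrite map_inj_uniq ?iota_uniq// => i j E.
  by apply/eqP; rewrite eqn_leq -!lam_mono E lexx.
by rewrite size_map size_iota ltnn.
Qed.

(** The Lagrange identity: b_l a_k - a_l b_k vanishes at 0 and its derivative is l - k times the
    integrand. The integral is pi times the reproducing kernel at real points. *)
Lemma lagrange k l : (l - k) * J r (fun t => w t * a k t * a l t + iw t * b k t * b l t) =
  b l r * a k r - a l r * b k r.
Proof.
have := J_prim r_gt0 (primB r_gt0 (prim_mul r_gt0 (b_prim l) (a_prim k))
  (prim_mul r_gt0 (a_prim l) (b_prim k))).
rewrite !b0 !a0 mulr0 mul0r subrr subr0 => <-.
rewrite -(JZ rr); first by apply: eq_J => s _; rewrite /iw; ring.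
by apply: contD; do 2 apply: contM => //.
Qed.

(** The differences b_l - b_k and a_l - a_k solve the system with parameter l, zero initial data and
    a forcing proportional to l - k, so [system_bound] makes them O(l - k) on [0, r]. *)
Lemma kernel_lipschitz k : exists2 c, 0 <= c & forall l, `|l - k| <= 1 ->
  `|J r (fun t => w t * a k t * a l t + iw t * b k t * b l t) -
    J r (fun t => w t * a k t * a k t + iw t * b k t * b k t)| <= c * `|l - k|.
Proof.
have [C C0 HC] := system_bound (addr_ge0 (normr_ge0 k) ler01).
pose D := J r (fun t => (w t * a k t) ^+ 2 + (- (iw t * b k t)) ^+ 2).
have cwa : cont r (fun t => w t * a k t) by exact: contM.
have cib : cont r (fun t => iw t * b k t) by exact: contM.
have cD := contD (@contX _ r _ 2 cwa) (@contX _ r _ 2 (contN cib)).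
have D0 : 0 <= D by apply: J_ge0 => s _; rewrite addr_ge0 ?sqr_ge0.
have ca : cont r (fun t => `|w t * a k t|) by apply: cont_comp cwa; exact: norm_continuous.
have cb : cont r (fun t => `|iw t * b k t|) by apply: cont_comp cib; exact: norm_continuous.
pose K := Num.sqrt (C * D).
have K0 : 0 <= K by exact: sqrtr_ge0.
exists (K * J r (fun t => `|w t * a k t| + `|iw t * b k t|)).
  by rewrite mulr_ge0//; apply: J_ge0 => s _; rewrite addr_ge0.
move=> l lk.
have lb : `|l| <= `|k| + 1.
  by rewrite -[l](subrK k) addrC (le_trans (ler_normD _ _))// lerD2l.
pose y t := b l t - b k t; pose q t := a l t - a k t.
have pe : prim r y (fun t => l * (w t * q t) + (l - k) * (w t * a k t)).
  apply: eq_prim (primB r_gt0 (b_prim l) (b_prim k)) => // t _; rewrite /q; ring.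
have pq : prim r q (fun t => - (l * (iw t * y t)) + (l - k) * - (iw t * b k t)).
  apply: eq_prim (primB r_gt0 (a_prim l) (a_prim k)) => // t _; rewrite /y /iw; ring.
have y0 : y 0 = 0 by rewrite /y !b0 subrr.
have q0 : q 0 = 0 by rewrite /q !a0 subrr.
have Ht t : 0 <= t <= r -> `|y t| <= K * `|l - k| /\ `|q t| <= K * `|l - k|.
  move=> tr.
  have := HC l y q _ _ lb (contZ (l - k) cwa) (contZ (l - k) (contN cib)) pe pq y0 q0 t tr.
  have -> : J r (fun t => ((l - k) * (w t * a k t)) ^+ 2 + ((l - k) * - (iw t * b k t)) ^+ 2)
     = (l - k) ^+ 2 * D.
    by rewrite -(JZ rr _ cD); apply: eq_J => s _; ring.
  rewrite mulrCA mulrC => H.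
  have e : K * `|l - k| = Num.sqrt (C * D * (l - k) ^+ 2).
    by rewrite sqrtrM ?sqrtr_sqr// mulr_ge0// ltW.
  rewrite e -!sqrtr_sqr; split; apply: ler_wsqrtr.
    by have := sqr_ge0 (q t); lra.
  by have := sqr_ge0 (y t); lra.
have c1 := contD (contM cwa (a_cont l)) (contM cib (b_cont l)).
have c2 := contD (contM cwa (a_cont k)) (contM cib (b_cont k)).
rewrite -(JB rr c1 c2); apply: le_trans (J_norm rr (contB c1 c2)) _.
rewrite mulrAC -(JZ rr _ (contD ca cb)); apply: (le_J rr).
- by apply: cont_comp (contB c1 c2); exact: norm_continuous.
- by apply: contZ; exact: contD.
- move=> s sr; have [yb qb] := Ht s sr.
  have -> : w s * a k s * a l s + iw s * b k s * b l s -
     (w s * a k s * a k s + iw s * b k s * b k s) =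
     w s * a k s * q s + iw s * b k s * y s by rewrite /q /y; ring.
  apply: le_trans (ler_normD _ _) _; rewrite !(normrM _ (_ s)) mulrDr.
  by apply: lerD; rewrite mulrC ler_wpM2r.
Qed.

(** As b_k(r) = 0, the Lagrange identity identifies b_l(r) a_k(r) / (l - k) with the kernel
    integral, which for l tending to k becomes [en] plus [ip], that is 2 ip by equipartition. The
    other term of the diagonal kernel contains the factor b_k(r) = 0, so this value is pi K_r(k,
    k). *)
Lemma diag_derive k : zero k ->
  a k r * derive1 (fun l => b l r) k = 2 * ip (b k) (b k).
Proof.
move=> [k0 bk]; have kn := lt0r_neq0 k0.
pose JJ l := J r (fun t => w t * a k t * a l t + iw t * b k t * b l t).
have JJl l : (l - k) * JJ l = b l r * a k r by rewrite lagrange bk mulr0 subr0.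
have [c c0 Hc] := kernel_lipschitz k.
have JJk : JJ k = 2 * ip (b k) (b k).
  have c1 : cont r (fun t => w t * a k t * a k t) by do 2 apply: contM => //.
  by rewrite /JJ (JD rr c1 (ip_cont (b_cont k) (b_cont k))) -/(en _ _) -ip_b// mulr2n mulrDl mul1r.
have JJcont : JJ l @[l --> k] --> JJ k.
  apply/cvgrPdist_lt => e e0; near=> l.
  have l1 : `|l - k| <= 1 by near: l; apply: cvgr_distC_le => //; exact: cvg_id.
  rewrite distrC; apply: le_lt_trans (Hc l l1) _.
  apply: le_lt_trans (_ : (c + 1) * `|l - k| < e).
    by rewrite ler_wpM2r// lerDl.
  rewrite mulrC -ltr_pdivlMr ?ltr_wpDl//.
  near: l; apply: cvgr_distC_lt; first exact: cvg_id.
  by rewrite divr_gt0// ltr_wpDl.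
(* Otherwise the kernel integral would vanish for every l != k, hence at k by continuity. *)
have ak : a k r != 0.
  apply/eqP => ak; have : JJ k = 0.
    apply: (@cvg_unique _ _ (JJ l @[l --> k^']))%classic => //.
      by apply: cvg_within_filter; exact: JJcont.
    apply: cvg_near_cst; near=> l.
    have := JJl l; rewrite ak mulr0 => /eqP; rewrite mulf_eq0 subr_eq0.
    case/orP => [|/eqP//]; apply: contraTeq => _; near: l; exact: nbhs_dnbhs_neq.
  by rewrite JJk; apply/eqP; rewrite mulf_neq0// gt_eqF// ip_b_gt0.
have der : h^-1 *: (b (h + k) r - b k r) @[h --> 0^'] --> JJ k / a k r.
  have : JJ (h + k) / a k r @[h --> 0^'] --> JJ k / a k r.
    apply: cvgM; last exact: cvg_cst.
    have hk : h + k @[h --> 0] --> k.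
      by rewrite -[X in _ --> X]add0r; apply: cvgD; [exact: cvg_id|exact: cvg_cst].
    by apply: cvg_within_filter; exact: cvg_comp hk JJcont.
  apply: cvg_trans; apply: near_eq_cvg; near=> h.
  have h0 : h != 0 by near: h; exact: nbhs_dnbhs_neq.
  rewrite bk subr0; have := JJl (h + k); rewrite addrK => E.
  have -> : b (h + k) r = h * (JJ (h + k) / a k r) by rewrite mulrA E mulfK.
  by change (JJ (h + k) / a k r = h^-1 * (h * (JJ (h + k) / a k r))); rewrite mulKf.
have -> : derive1 (fun l => b l r) k = JJ k / a k r by exact: cvg_lim der.
by rewrite -JJk mulrCA divff ?mulr1.
Unshelve. all: by end_near. Qed.
End sturm_liouville.

(** * Gaussian laws *)

Section normal_characteristic_function.
Context (R : realType).
Notation leb := (@lebesgue_measure R).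

Lemma Rintegral_derive_eq0 (h h' : R -> R) : continuous h' ->
  (forall x : R, is_derive x 1 h (h' x)) -> leb.-integrable setT (EFin \o h') ->
  h n%:R @[n --> \oo] --> 0 -> h (- n%:R) @[n --> \oo] --> 0 ->
  \int[leb]_x h' x = 0.
Proof.
move=> ch' dh ih hy hNy.
pose I (n : nat) := `[- n%:R, n%:R]%classic : set R.
have mI n : measurable (I n) by exact: measurable_itv.
pose f n := (EFin \o h') \_ (I n).
have mh : measurable_fun setT h' by exact: continuous_measurable_fun.
have H : \int[leb]_(x in I n) h' x @[n --> \oo] --> \int[leb]_x h' x.
  have -> : (fun n => \int[leb]_(x in I n) h' x) = (fun n => \int[leb]_x (h' \_ (I n)) x).
    by apply/funext => n; rewrite [LHS]Rintegral_mkcond.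
  apply: (@Rintegral_dct _ (measurableTypeR R) R leb (fun n => h' \_ (I n)) h' (fun x => `|h' x|)).
  - by move=> n; exact: ((measurable_restrictT h' (mI n)).1 (measurable_funTS mh)).
  - move=> x; apply: cvg_near_cst; near=> n.
    suff Inx : I n x by rewrite patchE mem_set.
    rewrite /I/= in_itv/= -ler_norml; near: n; exact: nbhs_infty_ger.
  - exact: integrable_norm ih.
  - by move=> n x; rewrite patchE; case: ifPn => // _; rewrite normr0.
apply: (@cvg_unique _ _ (\int[leb]_(x in I n) h' x @[n --> \oo])%classic) => //.
have H0 : h n%:R - h (- n%:R) @[n --> \oo] --> 0.
  by rewrite -[X in _ --> X]subr0; exact: cvgB.
apply: cvg_trans H0; apply: near_eq_cvg; near=> n.
have n0 : - n%:R < n%:R :> R.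
  by rewrite gtrN// ltr0n; near: n; exists 1%N.
have ch : continuous h.
  move=> x; apply/differentiable_continuous/derivable1_diffP; exact: ex_derive.
rewrite /Rintegral (@continuous_FTC2 _ h' h _ _ n0)//.
- exact: continuous_subspaceT.
- split; first by move=> x _; exact: ex_derive.
    by apply: cvg_at_right_filter; exact: ch.
  by apply: cvg_at_left_filter; exact: ch.
- by move=> x _; rewrite derive1E derive_val.
Unshelve. all: by end_near. Qed.

Variables (m s : R).
Hypothesis s_gt0 : 0 < s.
Let p := normal_pdf m s.

Let s0 : s != 0. Proof. exact: lt0r_neq0. Qed.

Let pE x : p x = normal_peak s * expR (- (x - m) ^+ 2 / (s ^+ 2 *+ 2)).
Proof. by rewrite /p normal_pdfE. Qed.

Let dbl (x : R) : x *+ 2 = 2 * x. Proof. by rewrite mulr_natl. Qed.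

Let p_ge0 x : 0 <= p x. Proof. exact: normal_pdf_ge0. Qed.

Let p_cont : continuous p. Proof. exact: continuous_normal_pdf. Qed.

Let p_int : leb.-integrable setT (EFin \o p).
Proof. exact: integrable_normal_pdf. Qed.

Let p_der (x : R) : is_derive x 1 p (- ((x - m) / s ^+ 2 * p x)).
Proof.
rewrite (_ : p = (fun x => normal_peak s * expR (- (x - m) ^+ 2 / (s ^+ 2 *+ 2)))); last first.
  by apply/funext => y; rewrite pE.
apply: is_derive_eq.
rewrite !(scaler0, addr0, add0r, subr0, scaler1) /GRing.scale/=.
by rewrite (dbl (s ^+ 2)); field.
Qed.

Lemma integrable_center_normal_pdf :
  leb.-integrable setT (EFin \o (fun x => `|x - m| * p x)).
Proof.
(* Widening the deviation by sqrt 2 halves the exponent. The half split off, exp (- q), absorbs |x -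
   m| because |x - m| <= s (1 + q) <= s exp q. *)
pose s' := Num.sqrt 2 * s.
have s'0 : s' != 0 by rewrite mulf_neq0// gt_eqF// sqrtr_gt0.
pose K := s * (normal_peak s / normal_peak s').
have pk : 0 < normal_peak s' by exact: normal_peak_gt0.
have pks : 0 < normal_peak s by exact: normal_peak_gt0.
have iK := integrableZl measurableT K (integrable_normal_pdf m s').
apply: le_integrable iK => //.
  apply/measurable_EFinP/measurable_funM; last exact: continuous_measurable_fun.
  apply: measurableT_comp => //; exact: measurable_funB.
move=> x _; rewrite lee_fin ger0_norm ?mulr_ge0// (le_trans _ (ler_norm _))//.
rewrite normal_pdfE// pE /normal_fun /K.
have s2 : s' ^+ 2 = 2 * s ^+ 2 by rewrite exprMn sqr_sqrtr.
have -> : s * (normal_peak s / normal_peak s') *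
    (normal_peak s' * expR (- (x - m) ^+ 2 / (s' ^+ 2 *+ 2))) =
    normal_peak s * (s * expR (- (x - m) ^+ 2 / (s' ^+ 2 *+ 2))).
  by field; rewrite gt_eqF.
rewrite mulrCA ler_pM2l//.
set q := (x - m) ^+ 2 / (s' ^+ 2 *+ 2).
have -> : - (x - m) ^+ 2 / (s ^+ 2 *+ 2) = - q - q.
  by rewrite /q (dbl (s' ^+ 2)) (dbl (s ^+ 2)) s2; field.
have -> : - (x - m) ^+ 2 / (s' ^+ 2 *+ 2) = - q by rewrite /q mulNr.
rewrite expRD mulrA ler_pM2r ?expR_gt0//.
rewrite expRN ler_pdivrMr ?expR_gt0//.
apply: le_trans (_ : s * (1 + q) <= _); last by rewrite ler_pM2l// expR_ge1Dx.
have -> : s * (1 + q) = (4 * s ^+ 2 + `|x - m| ^+ 2) / (4 * s).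
  by rewrite /q (dbl (s' ^+ 2)) s2 real_normK ?num_real//; field.
rewrite ler_pdivlMr ?mulr_gt0//.
have := sqr_ge0 (`|x - m| - 2 * s); nra.
Qed.

Let p_cvg0 (f : nat -> R) : (forall K, \forall n \near \oo, K < `|f n - m|) ->
  p (f n) @[n --> \oo] --> 0.
Proof.
move=> fy; apply/cvgr0Pnorm_lt => e e0.
pose K := s * normal_peak s / e.
have pks : 0 < normal_peak s by exact: normal_peak_gt0.
near=> n.
have Kn : K < `|f n - m| by near: n; exact: fy.
have fn0 : 0 < `|f n - m|.
  by apply: lt_trans Kn; rewrite divr_gt0// mulr_gt0.
rewrite ger0_norm// -(ltr_pM2r fn0).
apply: le_lt_trans (_ : s * normal_peak s < _); last first.
  by rewrite (mulrC e) -ltr_pdivrMr.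
rewrite pE mulNr expRN mulrAC ler_pdivrMr ?expR_gt0//.
set q := (f n - m) ^+ 2 / _.
apply: le_trans (_ : s * normal_peak s * (1 + q) <= _); last first.
  by rewrite ler_pM2l ?mulr_gt0// expR_ge1Dx.
have -> : s * normal_peak s * (1 + q) =
    normal_peak s * ((2 * s ^+ 2 + `|f n - m| ^+ 2) / (2 * s)).
  by rewrite /q (dbl (s ^+ 2)) real_normK ?num_real//; field.
rewrite ler_pM2l// ler_pdivlMr ?mulr_gt0//.
have := sqr_ge0 (`|f n - m| - s); nra.
Unshelve. all: by end_near. Qed.

Section phase.
Variable c : R.
(** The phase [c] lets one real integral carry both the real and the imaginary part of the
    characteristic function. *)
Let f t x := cos (t * (x - m) + c) * p x.
Let F t := \int[leb]_x f t x.

Let f_int t : leb.-integrable setT (EFin \o f t).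
Proof.
apply: le_integrable p_int => //.
  apply/measurable_EFinP/measurable_funM; last exact: continuous_measurable_fun.
  apply: continuous_measurable_fun => x; apply: continuous_comp; last exact: continuous_cos.
  apply: cvgD; last exact: cvg_cst.
  by apply: cvgM; [exact: cvg_cst|apply: cvgB; [exact: cvg_id|exact: cvg_cst]].
move=> x _; rewrite lee_fin normrM (ger0_norm (p_ge0 x)) ler_piMl//.
by rewrite ler_norml cos_geN1 cos_le1.
Qed.

Let f_der (x t : R) : is_derive t 1 (f ^~ x) (- (sin (t * (x - m) + c) * ((x - m) * p x))).
Proof.
apply: is_derive_eq.
rewrite !(scaler0, addr0, add0r, subr0, scaler1) /GRing.scale/=; ring.
Qed.

(** Differentiation under the integral produces the integral of [g]. The function [h] vanishes at
    infinity and its derivative is s^2 t f + g, so the two integrals are opposite. *)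
Let F_der (t : R) : is_derive t 1 F (- (s ^+ 2 * t * F t)).
Proof.
have It : `](t - 1), (t + 1)[%classic t by rewrite /= in_itv/= ltrBlDr !ltrDl ltr01.
have d1 x y : `](t - 1), (t + 1)[%classic x -> setT y -> derivable (f ^~ y) x 1.
  by move=> _ _; have := f_der y x => -[].
have d2 x y : `](t - 1), (t + 1)[%classic x -> setT y ->
   `|partial1of2 f x y| <= `|y - m| * p y.
  move=> _ _; rewrite /partial1of2 derive1E; have [_ ->] := f_der y x.
  rewrite normrN !normrM (ger0_norm (p_ge0 y)) ler_piMl ?mulr_ge0//.
  by rewrite ler_norml sin_geN1 sin_le1.
have G0 y : 0 <= `|y - m| * p y by rewrite mulr_ge0.
have H := differentiation_under_integral measurableT It (fun x _ => f_int x) d1 G0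
  integrable_center_normal_pdf d2.
have D := derivable_under_integral measurableT It (fun x _ => f_int x) d1 G0
  integrable_center_normal_pdf d2.
rewrite -/F in H D.
suff <- : derive1 F t = - (s ^+ 2 * t * F t).
  by rewrite derive1E; exact/derivableP.
rewrite H.
have mc : continuous (fun x : R => t * (x - m) + c).
  move=> x; apply: cvgD; last exact: cvg_cst.
  by apply: cvgM; [exact: cvg_cst|apply: cvgB; [exact: cvg_id|exact: cvg_cst]].
pose h x := s ^+ 2 * (sin (t * (x - m) + c) * p x).
pose g x := - (sin (t * (x - m) + c) * ((x - m) * p x)).
have gE x : partial1of2 f t x = g x.
  by rewrite /partial1of2 derive1E; have [_ ->] := f_der x t.
have cg : continuous g.
  move=> x; apply: cvgN; apply: cvgM.
    by apply: continuous_comp; [exact: mc|exact: continuous_sin].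
  by apply: cvgM; [apply: cvgB; [exact: cvg_id|exact: cvg_cst]|exact: p_cont].
have ig : leb.-integrable setT (EFin \o g).
  apply: le_integrable integrable_center_normal_pdf => //.
    by apply/measurable_EFinP; exact: continuous_measurable_fun.
  move=> x _; rewrite lee_fin -gE (le_trans (d2 t x It I))//.
  by rewrite (le_trans _ (ler_norm _)).
have cf : continuous (f t).
  move=> x; apply: cvgM; last exact: p_cont.
  by apply: continuous_comp; [exact: mc|exact: continuous_cos].
pose h' x := s ^+ 2 * t * f t x + g x.
have dh (x : R) : is_derive x 1 h (h' x).
  have dp := p_der x; apply: is_derive_eq.
  rewrite !(scaler0, addr0, add0r, subr0, scaler1) /GRing.scale/= /h' /g /f.
  by field.
have ih' : leb.-integrable setT (EFin \o h').
  have := integrableD measurableT (integrableZl measurableT (s ^+ 2 * t) (f_int t)) ig.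
  by apply: eq_integrable.
have hb x : `|h x| <= s ^+ 2 * p x.
  rewrite /h normrM ger0_norm ?sqr_ge0// ler_wpM2l ?sqr_ge0// normrM (ger0_norm (p_ge0 x)).
  by rewrite ler_piMl// ler_norml sin_geN1 sin_le1.
have hcvg (e : nat -> R) : (forall K, \forall n \near \oo, K < `|e n - m|) ->
    h (e n) @[n --> \oo] --> 0.
  move=> /p_cvg0 pe; apply: norm_cvg0.
  apply: (@squeeze_cvgr _ _ _ _ (fun=> 0) (fun n => s ^+ 2 * p (e n))).
  - by apply: nearW => n; rewrite normr_ge0 hb.
  - exact: cvg_cst.
  - by rewrite -[X in _ --> X](mulr0 (s ^+ 2)); apply: cvgM => //; exact: cvg_cst.
have near_m (K : R) : \forall n \near \oo, K < n%:R - `|m|.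
  near=> n; rewrite ltrBrDr; near: n; exact: nbhs_infty_gtr.
have := @Rintegral_derive_eq0 h h' _ dh ih' (hcvg _ _) (hcvg _ _).
move=> /(_ _ _ _)/wrap[].
- by move=> x; apply: cvgD; [apply: cvgM; [exact: cvg_cst|exact: cf]|exact: cg].
- move=> K; near=> n; apply: lt_le_trans (_ : n%:R - `|m| <= _).
    by near: n; exact: near_m.
  by have := lerB_dist (n%:R : R) m; rewrite normr_nat.
- move=> K; near=> n; apply: lt_le_trans (_ : n%:R - `|m| <= _).
    by near: n; exact: near_m.
  by have := lerB_dist (- n%:R : R) m; rewrite normrN normr_nat.
have iz : leb.-integrable setT (EFin \o (fun x => s ^+ 2 * t * f t x)).
  by have := integrableZl measurableT (s ^+ 2 * t) (f_int t); exact: eq_integrable.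
rewrite /h' (RintegralD measurableT iz ig).
rewrite (RintegralZl _ measurableT (f_int t)).
rewrite addrC => /eqP; rewrite addr_eq0 => /eqP <-.
by apply: eq_Rintegral => x _; rewrite gE.
Unshelve. all: by end_near. Qed.

Lemma normal_pdf_cos t : \int[leb]_x (cos (t * (x - m) + c) * normal_pdf m s x) =
  cos c * expR (- (s ^+ 2 * t ^+ 2 / 2)).
Proof.
pose G t := F t * expR (s ^+ 2 * t ^+ 2 / 2).
have dG (x : R) : is_derive x 1 G 0.
  have dF := F_der x; apply: is_derive_eq.
  by rewrite !(scaler0, addr0, add0r, subr0, scaler1) /GRing.scale/=; field.
have := is_derive_0_is_cst t 0 dG.
rewrite /G expr0n/= mulr0 mul0r expR0 mulr1.
have -> : F 0 = cos c.
  rewrite /F /f; under eq_Rintegral do rewrite mul0r add0r.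
  rewrite RintegralZl// /Rintegral integral_normal_pdf mulr1//.
by rewrite -/(F t) expRN => <-; rewrite mulfK// gt_eqF ?expR_gt0.
Qed.

End phase.

End normal_characteristic_function.

(** The sets whose indicator lies in [G] form a Dynkin class, and the rays ]a, +oo[ are a generating
    family stable under intersection. It serves both for laws on the line and for density in L^2. *)
Lemma indic_dynkin (R : realType) (G : set (R -> R)) : G (fun=> 1) ->
  (forall c f g, G f -> G g -> G (fun x => c * f x + g x)) ->
  (forall a : R, G (\1_`]a, +oo[%classic)) ->
  (forall (f_ : nat -> R -> R) f, (forall n, G (f_ n)) -> (forall n x, `|f_ n x| <= 1) ->
    (forall x, f_ n x @[n --> \oo] --> f x) -> G f) ->
  forall S : set (measurableTypeR R), measurable S -> G (\1_S).
Proof.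
move=> G1 GZD Gray Gcvg S; rewrite RGenOInfty.measurableE => mS.
apply: (@dynkin_induction _ (measurableTypeR R) _ (fun S => G (\1_S))
  (RGenOInfty.measurableE R) _ _ _ _ _ S mS).
- move=> _ _ [a ->] [b ->]; exists (Num.max a b).
  by apply/seteqP; split=> y /=; rewrite !in_itv/= !andbT gt_max => /andP.
- by move: G1; congr G; apply/funext => y; rewrite indicT.
- by move=> _ [a ->]; exact: Gray.
- move=> S' mS' gS; have := GZD (-1) _ _ gS G1.
  congr G; apply/funext => y; rewrite !indicE in_setC.
  by case: (y \in S'); rewrite /= ?mulr1 ?addNr ?mulr0 ?add0r.
- move=> F mF tF gF.
  (* By disjointness a point lies in at most one [F k], so the partial sums take values 0 or 1 and
     are eventually constant. *)
  have ind y : exists2 v : nat -> R, v n @[n --> \oo] --> (\1_(\bigcup_k F k) y : R) &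
      forall n, \sum_(k < n) \1_(F k) y = v n /\ `|v n| <= 1.
    have [[k0 Fk0]|Fk] := pselect (exists k, F k y); last first.
      exists (fun=> 0).
        rewrite indicE memNset; first exact: cvg_cst.
        by move=> [k _ ky]; apply: Fk; exists k.
      move=> n; rewrite normr0 ler01 big1// => k _.
      by rewrite indicE memNset// => ky; apply: Fk; exists k.
    have Fk k : \1_(F k) y = (k == k0)%:R :> R.
      rewrite indicE; congr (nat_of_bool _)%:R; apply/idP/eqP => [|->]; last exact: mem_set.
      by move=> /set_mem ky; apply: (tF k k0 I I); exists y.
    exists (fun n => (k0 < n)%N%:R).
      rewrite indicE mem_set; last by exists k0.
      by apply: cvg_near_cst; near=> n; have -> // : (k0 < n)%N; near: n; exists k0.+1.
    move=> n; split; last by case: (k0 < n)%N; rewrite ?normr1 ?normr0 ?lexx ?ler01.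
    elim: n => [|n ih]; first by rewrite big_ord0.
    rewrite big_ord_recr/= ih Fk ltnS [in RHS]leq_eqVlt (eq_sym k0).
    by have [->|nk] := eqVneq n k0; rewrite ?ltnn ?add0r ?addr0.
  apply: (Gcvg (fun n y => \sum_(k < n) \1_(F k) y)).
  - elim=> [|n ih].
      under eq_fun do rewrite big_ord0.
      have := GZD (-1) _ _ G1 G1.
      by congr G; apply/funext => y; rewrite mulN1r addNr.
    under eq_fun do rewrite big_ord_recr/=.
    have := GZD 1 _ _ ih (gF n); congr G; apply/funext => y.
    by rewrite mul1r.
  - by move=> n y; have [v _ H] := ind y; have [-> ] := H n.
  - move=> y; have [v vc H] := ind y.
    by rewrite (funext (fun n => (H n).1) : (fun n => _) = v).
Unshelve. all: by end_near. Qed.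

(** * Trigonometric sums and indicators of half-circles *)

Section trigonometric_functionals.
Context (R : realType).
Implicit Types (h g : R -> R).

(** The phases include the sines, and the product formula makes this span an algebra, so polynomials
    in its elements stay in it. *)
Definition trig : set (R -> R) :=
  lin_span setT (fun (tc : R * R) y => cos (tc.1 * y + tc.2)).

Lemma trig_cos t c : trig (fun y => cos (t * y + c)).
Proof. exact: (@lin_span_base _ _ _ _ setT (fun (tc : R * R) y => cos (tc.1 * y + tc.2)) (t, c) I). Qed.

Lemma trigZD (c : R) h g : trig h -> trig g -> trig (fun y => c * h y + g y).
Proof. exact: lin_spanZD. Qed.

Lemma trig1 : trig (fun=> 1).
Proof.
have := trig_cos 0 0; congr trig; apply/funext => y.
by rewrite mul0r addr0 cos0.
Qed.

Lemma trig0 : trig (fun=> 0).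
Proof.
have := trigZD (-1) trig1 trig1; congr trig; apply/funext => y.
by rewrite mulN1r addNr.
Qed.

Lemma trig_sum n (f : 'I_n -> R -> R) (c : 'I_n -> R) : (forall i, trig (f i)) ->
  trig (fun y => \sum_(i < n) c i * f i y).
Proof.
elim: n f c => [|n ih] f c Hf.
  by under eq_fun do rewrite big_ord0; exact: trig0.
under eq_fun do rewrite big_ord_recl; apply: trigZD; first exact: Hf.
exact: ih.
Qed.

Lemma trigM h g : trig h -> trig g -> trig (fun y => h y * g y).
Proof.
move=> [n [a [j [_ ->]]]] [m [b [k [_ ->]]]].
have -> : (fun y => (\sum_(i < n) a i * cos ((j i).1 * y + (j i).2)) *
      (\sum_(i < m) b i * cos ((k i).1 * y + (k i).2))) =
    (fun y => \sum_(i < n) a i * (\sum_(l < m) b l *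
       (2^-1 * cos (((j i).1 + (k l).1) * y + ((j i).2 + (k l).2)) +
       2^-1 * cos (((j i).1 - (k l).1) * y + ((j i).2 - (k l).2))))).
  apply/funext => y; rewrite mulr_suml; apply: eq_bigr => i _.
  rewrite -mulrA mulr_sumr; congr (_ * _); apply: eq_bigr => l _.
  have -> : ((j i).1 + (k l).1) * y + ((j i).2 + (k l).2) =
    ((j i).1 * y + (j i).2) + ((k l).1 * y + (k l).2) by ring.
  have -> : ((j i).1 - (k l).1) * y + ((j i).2 - (k l).2) =
    ((j i).1 * y + (j i).2) - ((k l).1 * y + (k l).2) by ring.
  move: ((j i).1 * y + _) ((k l).1 * y + _) => p q.
  by rewrite cosD cosB; field.
apply: trig_sum => i; apply: trig_sum => l; apply: trigZD; first exact: trig_cos.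
by have := trigZD 2^-1 (trig_cos ((j i).1 - (k l).1) ((j i).2 - (k l).2)) trig0;
  congr trig; apply/funext => y; rewrite addr0.
Qed.

Lemma trigX h n : trig h -> trig (fun y => h y ^+ n).
Proof.
move=> th; elim: n => [|n ih].
  by under eq_fun do rewrite expr0; exact: trig1.
by under eq_fun do rewrite exprS; exact: trigM.
Qed.

(* Polynomials converging pointwise on [0, 1] to the indicator of [1/2, 1]. *)
Definition step_poly n (u : R) : R := 1 - (1 - u ^+ n) ^+ (n * 2 ^ n).

Lemma step_poly_bound n u : 0 <= u <= 1 -> 0 <= step_poly n u <= 1.
Proof.
move=> /andP[u0 u1]; have un0 : 0 <= u ^+ n by exact: exprn_ge0.
have un1 : u ^+ n <= 1 by exact: exprn_ile1.
have v0 : 0 <= 1 - u ^+ n by lra.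
have v1 : 1 - u ^+ n <= 1 by lra.
have := exprn_ge0 (n * 2 ^ n) v0; have := exprn_ile1 (n * 2 ^ n) v0 v1.
rewrite /step_poly; lra.
Qed.

Lemma cvg_natr_expr (q : R) : 0 <= q -> q < 1 -> n%:R * q ^+ n @[n --> \oo] --> 0.
Proof.
move=> q0 q1; pose s := Num.sqrt q.
have s0 : 0 <= s by exact: sqrtr_ge0.
have s1 : s < 1 by rewrite -sqrtr1 ltr_sqrt.
have sq : s ^+ 2 = q by rewrite sqr_sqrtr.
have bern n : (1 - s) * (n%:R * s ^+ n) <= 1.
  suff : n%:R * (1 - s) * s ^+ n <= 1 - s ^+ n.
    by have := exprn_ge0 n s0; lra.
  elim: n => [|n ih]; first by rewrite !mul0r expr0 subrr.
  have sn0 := exprn_ge0 n s0.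
  rewrite -natr1 exprS; have := ler_wpM2l s0 ih.
  have : (1 - s) * (s * s ^+ n) <= 1 - s.
    by rewrite ler_piMr ?subr_ge0 ?(ltW s1)// -exprS exprn_ile1// ltW.
  nra.
apply: (@squeeze_cvgr _ _ _ _ (fun=> 0) (fun n => (1 - s)^-1 * s ^+ n)).
- apply: nearW => n; rewrite mulr_ge0 ?exprn_ge0//=.
  have -> : n%:R * q ^+ n = n%:R * s ^+ n * s ^+ n by rewrite -sq -exprM mulnC exprM; ring.
  rewrite ler_wpM2r ?exprn_ge0// -[leRHS]mulr1 ler_pdivlMl ?subr_gt0//.
- exact: cvg_cst.
- rewrite -[X in _ --> X](mulr0 (1 - s)^-1); apply: cvgM; first exact: cvg_cst.
  by apply: cvg_expr; rewrite ger0_norm.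
Qed.

(** Below 1/2 Bernoulli's inequality bounds the value by n (2 u)^n. From 1/2 on, 1 - v <= exp (- v)
    bounds its complement to 1 by exp (- n), since n 2^n u^n >= n. *)
Lemma step_poly_cvg (u : R) : 0 <= u <= 1 ->
  step_poly n u @[n --> \oo] --> ((2^-1 <= u)%R%:R : R).
Proof.
move=> /andP[u0 u1]; have [hu|hu] := leP (2^-1 : R) u; last first.
  apply: (@squeeze_cvgr _ _ _ _ (fun=> 0) (fun n => n%:R * (2 * u) ^+ n)).
  - apply: nearW => n; have /andP[-> _] := step_poly_bound n (introT andP (conj u0 u1)).
    rewrite /step_poly /=.
    have un1 : u ^+ n <= 1 by exact: exprn_ile1.
    have bern N : 1 - N%:R * u ^+ n <= (1 - u ^+ n) ^+ N.
      elim: N => [|N ih]; first by rewrite mul0r subr0 expr0.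
      rewrite exprS -natr1; have : 0 <= 1 - u ^+ n by lra.
      move=> v0; have := ler_wpM2l v0 ih; have := exprn_ge0 n u0.
      have : 0 <= N%:R * (u ^+ n * u ^+ n) by rewrite mulr_ge0// mulr_ge0 ?exprn_ge0.
      nra.
    by have := bern (n * 2 ^ n)%N; rewrite natrM natrX exprMn; lra.
  - exact: cvg_cst.
  - by apply: cvg_natr_expr; lra.
have -> : (true%:R : R) = 1 - 0 by rewrite subr0.
apply: cvgB; first exact: cvg_cst.
apply: (@squeeze_cvgr _ _ _ _ (fun=> 0) (fun n => expR (- 1) ^+ n)).
- apply: nearW => n; have un1 : u ^+ n <= 1 by exact: exprn_ile1.
  rewrite exprn_ge0 ?subr_ge0//=.
  apply: le_trans (_ : expR (- u ^+ n) ^+ (n * 2 ^ n) <= _).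
    rewrite lerXn2r ?nnegrE ?subr_ge0 ?expR_ge0//.
    exact: expR_ge1Dx.
  rewrite -!expRM_natl !mulrN !mulr1 ler_expR lerN2.
  rewrite natrM natrX -mulrA ler_peMr// -exprMn exprn_ege1//; lra.
- exact: cvg_cst.
- by apply: cvg_expr; rewrite ger0_norm ?expR_ge0// expR_lt1 oppr_lt0.
Qed.

Lemma cos_lt0_pihalf x : pi / 2 < x -> x <= pi -> cos x < 0 :> R.
Proof.
move=> x1 x2; have : 0 < cos (pi - x) by apply: cos_gt0_pihalf; apply/andP; split; lra.
by rewrite cosB cospi sinpi mul0r addr0 mulN1r oppr_gt0.
Qed.

(* Of the angles [t / 2^k], one falls in ]pi/2, pi] unless [|t| <= pi/2]. *)
Lemma halving_angles (t : R) :
  (`|t| <= pi / 2 -> forall k, 0 <= cos (t / 2 ^+ k)) /\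
  (pi / 2 < `|t| -> exists k, cos (t / 2 ^+ k) < 0).
Proof.
have nE k : `|t / 2 ^+ k| = `|t| / 2 ^+ k.
  by rewrite normrM normfV (ger0_norm (exprn_ge0 k _)).
split=> [tp k|tp].
  rewrite -cos_norm nE; apply: cos_ge0_pihalf; apply/andP; split.
    apply: le_trans (_ : 0 <= _); last by rewrite divr_ge0// exprn_ge0.
    by rewrite oppr_le0 divr_ge0// pi_ge0.
  apply: le_trans tp; rewrite ler_pdivrMr ?exprn_gt0// ler_peMr//.
  by rewrite exprn_ege1// ler1n.
have ex : exists k, `|t| / 2 ^+ k <= pi / 2.
  exists (Num.bound (`|t| / (pi / 2))); rewrite ler_pdivrMr ?exprn_gt0// mulrC.
  have p2 : 0 < pi / 2 :> R by rewrite divr_gt0// pi_gt0.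
  rewrite -ler_pdivrMr//; apply: le_trans (ltW (archi_boundP _)) _.
    by rewrite divr_ge0// ltW.
  by rewrite -natrX ler_nat ltnW// ltn_expl.
case: (ex_minnP ex) => -[|k] Hk kmin.
  by move: Hk; rewrite expr0 divr1 leNgt tp.
have {kmin}Hk' : pi / 2 < `|t| / 2 ^+ k.
  by rewrite ltNge; apply/negP => /kmin; rewrite ltnn.
exists k; rewrite -cos_norm nE; apply: cos_lt0_pihalf => //.
have -> : `|t| / 2 ^+ k = 2 * (`|t| / 2 ^+ k.+1).
  by rewrite exprS; field; rewrite expf_neq0.
lra.
Qed.

Lemma cos_lipschitz (x y : R) : `|cos x - cos y| <= `|x - y|.
Proof.
wlog xy : x y / y <= x.
  by move=> H; have [/H//|/ltW/H] := leP y x; rewrite distrC (distrC y).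
have [z _ ->] := @MVT_segment _ cos (fun z => - sin z) _ _ xy
  (fun z _ => is_derive_cos z) (continuous_subspaceT (@continuous_cos R)).
by rewrite normrM normrN ler_piMl// ler_norml sin_geN1 sin_le1.
Qed.

Lemma sin_le_norm (x : R) : `|sin x| <= `|x|.
Proof.
have := cos_lipschitz (x - pi / 2) (- (pi / 2)).
by rewrite opprK subrK cosN cos_pihalf subr0 cosB cos_pihalf sin_pihalf mulr0 add0r mulr1.
Qed.

End trigonometric_functionals.

(* A law is determined by its trigonometric integrals, even after weighting by
   a bounded variable [W]; the latter is what turns the characteristic function
   of a Gaussian vector into independence, one coordinate at a time. *)
Section uniqueness.
Context d (T : measurableType d) (R : realType) (P : probability T R).
Variables (W Y : T -> R) (K : R) (Q : probability (measurableTypeR R) R) (q : R).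
Hypothesis W_meas : measurable_fun setT W.
Hypothesis W_bound : forall x, `|W x| <= K.
Hypothesis Y_meas : measurable_fun setT Y.
Hypothesis W_cos : forall t c,
  \int[P]_x (W x * cos (t * Y x + c)) = q * \int[Q]_y cos (t * y + c).

Let good (h : R -> R) := [/\ measurable_fun (setT : set (measurableTypeR R)) h,
  exists C : R, forall y, `|h y| <= C &
  \int[P]_x (W x * h (Y x)) = q * \int[Q]_y h y].

Let integrable_bounded d' (U : measurableType d') (m : probability U R) (h : U -> R) (C : R) :
  measurable_fun setT h -> (forall y, `|h y| <= C) -> m.-integrable setT (EFin \o h).
Proof.
move=> mh hC; apply: le_integrable (finite_measure_integrable_cst m C measurableT) => //.
  exact/measurable_EFinP.
by move=> x _ /=; rewrite lee_fin (le_trans (hC x))// ler_norm.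
Qed.

Let WY_meas h : measurable_fun (setT : set (measurableTypeR R)) h ->
  measurable_fun setT (fun x => W x * h (Y x)).
Proof. by move=> mh; apply: measurable_funM => //; exact: measurableT_comp. Qed.

Let WY_bound h (C : R) : (forall y, `|h y| <= C) -> forall x, `|W x * h (Y x)| <= K * C.
Proof. by move=> hC x; rewrite normrM ler_pM. Qed.

Let good_cos t c : good (fun y => cos (t * y + c)).
Proof.
split; last exact: W_cos.
  apply: continuous_measurable_fun => x; apply: continuous_comp; last exact: continuous_cos.
  by apply: cvgD; [apply: cvgM; [exact: cvg_cst|exact: cvg_id]|exact: cvg_cst].
by exists 1 => y; rewrite ler_norml cos_geN1 cos_le1.
Qed.

Let goodZD (a : R) h g : good h -> good g -> good (fun y => a * h y + g y).
Proof.
move=> [mh [C hC] Eh] [mg [D gD] Eg]; split.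
- by apply: measurable_funD => //; exact: measurable_funM.
- exists (`|a| * C + D) => y; apply: le_trans (ler_normD _ _) _.
  by rewrite normrM lerD// ler_wpM2l.
have ih := integrable_bounded Q mh hC.
have ig := integrable_bounded Q mg gD.
have iWh := integrable_bounded P (WY_meas mh) (WY_bound hC).
have iWg := integrable_bounded P (WY_meas mg) (WY_bound gD).
have iaWh : P.-integrable setT (EFin \o (fun x => a * (W x * h (Y x)))).
  by have := integrableZl measurableT a iWh; exact: eq_integrable.
have iah : Q.-integrable setT (EFin \o (fun x => a * h x)).
  by have := integrableZl measurableT a ih; exact: eq_integrable.
rewrite (RintegralD measurableT iah ig) (RintegralZl a measurableT ih).
rewrite mulrDr mulrCA -Eh -Eg -(RintegralZl a measurableT iWh).
rewrite -(RintegralD measurableT iaWh iWg).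
by apply: eq_Rintegral => x _; ring.
Qed.

Let good_trig h : trig h -> good h.
Proof.
move=> [n [a [j [_ ->]]]]; elim: n a j => [|n ih] a j.
  under eq_fun do rewrite big_ord0.
  have := goodZD (-1) (good_cos 0 0) (good_cos 0 0).
  by congr good; apply/funext => y; rewrite mulN1r addNr.
under eq_fun do rewrite big_ord_recl.
by apply: goodZD; [exact: good_cos|exact: ih].
Qed.

Let good_cvg (h_ : nat -> R -> R) h (C : R) : (forall n, good (h_ n)) ->
  (forall n y, `|h_ n y| <= C) -> (forall y, h_ n y @[n --> \oo] --> h y) -> good h.
Proof.
move=> gh hC cvh; have mh n : measurable_fun (setT : set (measurableTypeR R)) (h_ n).
  by case: (gh n).
split.
- exact: measurable_fun_cvg mh (fun x _ => cvh x).
- exists C => y.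
  have cn : `|h_ n y| @[n --> \oo] --> `|h y| by apply: cvg_norm; exact: cvh.
  rewrite -(cvg_lim _ cn)//.
  by apply: limr_le; [exact: cvgP cn|exact: nearW].
have E n : \int[P]_x (W x * h_ n (Y x)) = q * \int[Q]_y h_ n y by case: (gh n).
apply: (@cvg_unique _ _ (\int[P]_x (W x * h_ n (Y x)) @[n --> \oo])%classic) => //.
  apply: (@Rintegral_dct _ _ _ P (fun n x => W x * h_ n (Y x)) _ (fun=> K * C)).
  - by move=> n; exact: WY_meas.
  - by move=> x; apply: cvgM; [exact: cvg_cst|exact: cvh].
  - exact: finite_measure_integrable_cst.
  - by move=> n x; exact: WY_bound.
rewrite (funext E : (fun n => _) = (fun n => q * \int[Q]_y h_ n y)).
apply: cvgM; first exact: cvg_cst.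
apply: (@Rintegral_dct _ _ _ Q h_ h (fun=> C)) => //.
exact: finite_measure_integrable_cst.
Qed.

(** On the interval all the angles tau (y - x) / 2^k have nonnegative cosine; off it one of them has
    a negative one, by [halving_angles]. Products of the indicators of nonnegative cosine, each a
    limit of step polynomials in (1 + cos) / 2, thus converge to the indicator: the halvings remove
    the periodic copies of the interval. *)
Let good_itv (x e : R) : 0 < e -> good (\1_(`[x - e, x + e]%classic : set R)).
Proof.
(* This scale maps the half-width e to pi / 2. *)
move=> e0; pose tau := pi / (2 * e).
have tau0 : 0 < tau by rewrite divr_gt0 ?pi_gt0// mulr_gt0.
pose ang k (y : R) := tau * (y - x) / 2 ^+ k.
pose u k y := (1 + cos (ang k y)) / 2.
have u01 k y : 0 <= u k y <= 1.
  have := cos_geN1 (ang k y); have := cos_le1 (ang k y); rewrite /u => ? ?.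
  by apply/andP; split; lra.
have tu k : trig (u k).
  have := trigZD 2^-1 (trig_cos (tau / 2 ^+ k) (- (tau / 2 ^+ k * x))) (trigZD 2^-1 (trig1 R) (trig0 R)).
  congr trig; apply/funext => y; rewrite /u /ang.
  have -> : tau / 2 ^+ k * y + - (tau / 2 ^+ k * x) = tau * (y - x) / 2 ^+ k by ring.
  by field.
have tstep k n : trig (fun y => step_poly n (u k y)).
  have tX := trigX (n * 2 ^ n) (trigZD (-1) (trigX n (tu k)) (trig1 R)).
  have := trigZD (-1) tX (trig1 R).
  congr trig; apply/funext => y; rewrite /step_poly !mulN1r addrC.
  by congr (1 - _ ^+ _); rewrite addrC.
pose c k y : R := (0 <= cos (ang k y))%R%:R.
have cE k y : c k y = (2^-1 <= u k y)%R%:R.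
  by congr (nat_of_bool _)%:R; rewrite /u; apply/idP/idP; lra.
have gprod K' : good (fun y => \prod_(k < K') c k y).
  apply: (@good_cvg (fun n y => \prod_(k < K') step_poly n (u k y)) _ 1).
  - move=> n; apply: good_trig; elim: K' => [|K' ih].
      by under eq_fun do rewrite big_ord0; exact: trig1.
    by under eq_fun do rewrite big_ord_recr; exact: trigM.
  - move=> n y; have H : forall k : 'I_K', 0 <= step_poly n (u k y) <= 1.
      by move=> k; exact: step_poly_bound.
    rewrite ger0_norm; last by apply: prodr_ge0 => k _; case/andP: (H k).
    by apply: prodr_ile1 => k _; exact: H.
  - move=> y; elim: K' => [|K' ih].
      by under eq_fun do rewrite big_ord0; rewrite big_ord0; exact: cvg_cst.
    under eq_fun do rewrite big_ord_recr/=; rewrite big_ord_recr/=; apply: cvgM => //.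
    by rewrite cE; exact: step_poly_cvg.
apply: (@good_cvg (fun K' y => \prod_(k < K') c k y) _ 1) => //.
  move=> K' y; rewrite ger0_norm; last by apply: prodr_ge0 => k _; rewrite /c.
  by apply: prodr_ile1 => k _; rewrite /c; case: (0 <= cos _); rewrite ?lexx ?ler01.
move=> y; have [H1 H2] := halving_angles (tau * (y - x)).
have nE : `|tau * (y - x)| = pi / 2 * (`|y - x| / e).
  by rewrite normrM gtr0_norm// /tau; field; rewrite gt_eqF.
have pi2 : 0 < pi / 2 :> R by rewrite divr_gt0// pi_gt0.
rewrite indicE mem_setE in_itv/= -ler_distlC.
have [yx|yx] := leP (`|x - y|) e.
  apply: cvg_near_cst; apply: nearW => K'; rewrite big1// => k _.
  rewrite /c H1// nE ler_piMr ?(ltW pi2)// ler_pdivrMr// mul1r distrC//.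
have [k ck] : exists k, cos (tau * (y - x) / 2 ^+ k) < 0.
  by apply: H2; rewrite nE ltr_pMr// ltr_pdivlMr// mul1r distrC.
apply: cvg_near_cst; near=> K'.
have kK : (k < K')%N by near: K'; exists k.+1.
by rewrite (bigD1 (Ordinal kK))//= /c leNgt ck mul0r.
Unshelve. all: by end_near. Qed.

Lemma law_unique (S : set (measurableTypeR R)) : measurable S ->
  \int[P]_x (W x * \1_S (Y x)) = q * fine (Q S).
Proof.
move=> mS; suff [_ _ ->] : good (\1_S) by rewrite /Rintegral integral_indic ?setIT.
apply: indic_dynkin mS.
- exact/good_trig/trig1.
- by move=> c f g; exact: goodZD.
- move=> a.
  (* These closed intervals start at a + 1/(n+1) and have length 2 (n+1): they exclude [a], as the
     open ray does, and exhaust the ray. *)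
  have gi n := @good_itv (a + n.+1%:R^-1 + n.+1%:R) n.+1%:R (ltr0Sn _ _).
  apply: (good_cvg gi) => [n y|y].
    by rewrite indicE; case: (_ \in _); rewrite ?normr1 ?normr0 ?lexx ?ler01.
  rewrite indicE mem_setE in_itv/= andbT; have [ay|ya] := ltP a y; last first.
    apply: cvg_near_cst; apply: nearW => n; rewrite indicE mem_setE in_itv/= addrK.
    rewrite [_ <= y]leNgt (_ : y < _ = true)//.
    by apply: le_lt_trans ya _; rewrite ltrDl invr_gt0.
  have ya0 : 0 < y - a by rewrite subr_gt0.
  apply: cvg_near_cst; near=> n; rewrite indicE mem_setE in_itv/= addrK.
  have -> : a + n.+1%:R^-1 <= y.
    by rewrite -lerBrDl ltW//; near: n; exact: near_infty_natSinv_lt (PosNum ya0).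
  have -> //: y <= a + n.+1%:R^-1 + n.+1%:R + n.+1%:R.
  have : y - a <= n%:R by near: n; exact: nbhs_infty_ger.
  have : 0 <= n.+1%:R^-1 :> R by rewrite invr_ge0.
  by have := ler0n R n; rewrite -natr1; lra.
- by move=> f_ f gf bf; exact: good_cvg gf bf.
Unshelve. all: by end_near. Qed.

End uniqueness.

(** * Moments of a Gaussian variable *)

Section gaussian_span.
Context (R : realType).

Lemma integral_normal_prob (m s : R) (f : R -> R) (C : R) : s != 0 ->
  measurable_fun (setT : set (measurableTypeR R)) f -> (forall x, `|f x| <= C) ->
  \int[normal_prob m s]_x f x = \int[lebesgue_measure]_x (f x * normal_pdf m s x).
Proof.
move=> s0 mf fC; rewrite /Rintegral; congr fine.
have iff : (normal_prob m s).-integrable setT (EFin \o f).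
  apply: le_integrable (finite_measure_integrable_cst (normal_prob m s) C measurableT) => //.
    exact/measurable_EFinP.
  by move=> x _ /=; rewrite lee_fin (le_trans (fC x))// ler_norm.
rewrite -(Radon_Nikodym_change_of_variables (normal_prob_dominates m s) measurableT iff).
under [RHS]eq_integral do rewrite EFinM.
apply: ae_eq_integral => //.
- apply: emeasurable_funM; first exact/measurable_EFinP.
  apply: (measurable_int lebesgue_measure).
  by apply: Radon_Nikodym_integrable; exact: normal_prob_dominates.
- apply: emeasurable_funM; first exact/measurable_EFinP.
  by apply/measurable_EFinP; exact: measurable_normal_pdf.
- apply: ae_eqe_mul2l => /=.
  rewrite Radon_NikodymE//=; first exact: normal_prob_dominates.
  move=> abmu; case: cid => /= h [h1 h2 h3].
  apply: integral_ae_eq => //=.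
  + by apply/measurable_EFinP; exact: measurable_normal_pdf.
  + by move=> E E01 mE; rewrite -h3.
Qed.

Lemma normal_prob_cos (m s t c : R) : 0 < s ->
  \int[normal_prob m s]_y cos (t * y + c) =
  cos (t * m + c) * expR (- (s ^+ 2 * t ^+ 2 / 2)).
Proof.
move=> s0; rewrite (@integral_normal_prob _ _ _ 1) ?gt_eqF//.
- rewrite -(normal_pdf_cos m s0 (t * m + c) t); apply: eq_Rintegral => x _; congr (cos _ * _); ring.
- apply: continuous_measurable_fun => x; apply: continuous_comp; last exact: continuous_cos.
  by apply: cvgD; [apply: cvgM; [exact: cvg_cst|exact: cvg_id]|exact: cvg_cst].
- by move=> x; rewrite ler_norml cos_geN1 cos_le1.
Qed.

Context d (T : measurableType d) (P : probability T R).
Implicit Types Y : T -> R.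

Lemma measurable_cos_affine Y (t c : R) : measurable_fun setT Y ->
  measurable_fun setT (fun x => cos (t * Y x + c)).
Proof.
move=> mY; apply: (measurableT_comp (f := @cos R)).
  by apply: continuous_measurable_fun; exact: continuous_cos.
by apply: measurable_funD => //; exact: measurable_funM.
Qed.

Lemma integrable_bounded Y C : measurable_fun setT Y -> (forall x, `|Y x| <= C) ->
  P.-integrable setT (EFin \o Y).
Proof.
move=> mY YC; apply: le_integrable (finite_measure_integrable_cst P C measurableT) => //.
  exact/measurable_EFinP.
by move=> x _ /=; rewrite lee_fin (le_trans (YC x))// ler_norm.
Qed.

Lemma integrable_cos Y (t c : R) : measurable_fun setT Y ->
  P.-integrable setT (EFin \o (fun x => cos (t * Y x + c))).
Proof.
move=> mY; apply: (@integrable_bounded _ 1); first exact: measurable_cos_affine.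
by move=> x; rewrite ler_norml cos_geN1 cos_le1.
Qed.

Lemma normal_law_cos (m s t c : R) Y : 0 < s -> measurable_fun setT Y ->
  normal_law P m s Y ->
  \int[P]_x cos (t * Y x + c) = cos (t * m + c) * expR (- (s ^+ 2 * t ^+ 2 / 2)).
Proof.
move=> s0 mY lY; rewrite -normal_prob_cos//.
pose Y' : {mfun T >-> measurableTypeR R} := 
  @mfun_Sub _ _ T (measurableTypeR R) Y (mem_set mY).
have mc : measurable_fun (setT : set (measurableTypeR R)) (fun y : R => (cos (t * y + c))%:E).
  apply/measurable_EFinP; apply: continuous_measurable_fun => x.
  apply: continuous_comp; last exact: continuous_cos.
  by apply: cvgD; [apply: cvgM; [exact: cvg_cst|exact: cvg_id]|exact: cvg_cst].
rewrite /Rintegral; congr fine.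
transitivity (\int[distribution P Y']_y (cos (t * y + c))%:E)%E.
  by rewrite (integral_distribution mc)//; exact: integrable_cos.
by apply: eq_measure_integral => A mA _; exact: lY.
Qed.

(** Constants are covered by s = 0, so both branches of [gaussian] lead to one formula, from which
    [cos_moments] reads the moments. *)
Lemma gaussian_cos Y : measurable_fun setT Y -> gaussian P Y ->
  exists m s : R, forall t c,
    \int[P]_x cos (t * Y x + c) = cos (t * m + c) * expR (- (s ^+ 2 * t ^+ 2 / 2)).
Proof.
move=> mY [m [s [s0]]]; case: eqP => [_ Ym|/eqP sn lY].
  exists m, 0 => t c; rewrite expr0n/= !mul0r oppr0 expR0 mulr1.
  rewrite -[RHS](Rintegral_prob_cst P) /Rintegral; congr fine.
  apply: ae_eq_integral => //.
  - by apply/measurable_EFinP; exact: measurable_cos_affine.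
  - by apply: filterS Ym => x -> _.
by exists m, s => t c; apply: normal_law_cos => //; rewrite lt_neqAle eq_sym sn.
Qed.

Lemma cvg_sqr (u : nat -> R) (l : R) : u n @[n --> \oo] --> l ->
  u n ^+ 2 @[n --> \oo] --> l ^+ 2.
Proof.
move=> ul; rewrite (funext (fun n => expr2 (u n)) : (fun n => _) = _) expr2.
exact: cvgM.
Qed.

Lemma sin_quot_bound (t y : R) : 0 < t -> `|sin (t * y) / t - y| <= t * y ^+ 2.
Proof.
move=> t0; have tn := lt0r_neq0 t0.
have H u : `|sin u - u| <= u ^+ 2 :> R.
  wlog u0 : u / 0 <= u.
    move=> H; have [/H//|/ltW u0] := leP 0 u.
    by have := H (- u); rewrite sinN -opprD normrN sqrrN; apply; rewrite oppr_ge0.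
  have cs : continuous (fun z : R => sin z - z).
    by move=> z; apply: cvgB; [exact: continuous_sin|exact: cvg_id].
  have [z /andP[z0 zu]] := @MVT_segment _ (fun z => sin z - z) (fun z => cos z - 1) _ _ u0
    (fun z _ => is_deriveB (is_derive_sin z) (is_derive_id z 1))
    (continuous_subspaceT cs).
  rewrite sin0 !subr0 => ->; rewrite normrM (ger0_norm u0) expr2 ler_wpM2r//.
  have := cos_lipschitz z 0; rewrite cos0 subr0 => /le_trans; apply.
  by move: z0 zu; rewrite !bnd_simp => z0 zu; rewrite ger0_norm.
have -> : sin (t * y) / t - y = (sin (t * y) - t * y) / t by field.
rewrite normrM normfV (gtr0_norm t0) ler_pdivrMr//.
by apply: le_trans (H _) _; rewrite exprMn; nra.
Qed.

Lemma cvg_sin_quot (y : R) : sin (n.+1%:R^-1 * y) / n.+1%:R^-1 @[n --> \oo] --> y.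
Proof.
apply/subr_cvg0/norm_cvg0P.
apply: (@squeeze_cvgr _ _ _ _ (fun=> 0) (fun n => n.+1%:R^-1 * y ^+ 2)).
- by apply: nearW => n; rewrite normr_ge0/= sin_quot_bound.
- exact: cvg_cst.
- by rewrite -[X in _ --> X](mul0r (y ^+ 2)); apply: cvgMr_tmp; exact: cvg_harmonic.
Qed.

(** The quotients 2 (1 - cos (tau Y)) / tau^2 are squares of sin (tau Y / 2) / (tau / 2), hence lie
    between 0 and Y^2 and tend to Y^2. Fatou's lemma gives integrability of Y^2, then dominated
    convergence gives its value. *)
Lemma cos_moments Y (m s : R) : measurable_fun setT Y ->
  (forall t c, \int[P]_x cos (t * Y x + c) =
     cos (t * m + c) * expR (- (s ^+ 2 * t ^+ 2 / 2))) ->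
  [/\ rL2 P Y, \int[P]_x Y x = m & dot P Y Y = m ^+ 2 + s ^+ 2].
Proof.
move=> mY H; pose tau n : R := n.+1%:R^-1.
have tau0 n : 0 < tau n by rewrite invr_gt0.
have taun n : tau n != 0 by rewrite gt_eqF.
have tauc : tau n @[n --> \oo] --> 0 by exact: cvg_harmonic.
have sinE (t y : R) : t != 0 -> 2 * (1 - cos (t * y)) / t ^+ 2 = (sin (t / 2 * y) / (t / 2)) ^+ 2.
  move=> t0; have -> : t * y = (t / 2 * y) *+ 2 by rewrite -mulr_natr; field.
  by rewrite cos_mulr2n cos2sin2; field.
pose g n x := 2 * (1 - cos (tau n * Y x)) / tau n ^+ 2.
have gY n x : 0 <= g n x <= Y x ^+ 2.
  rewrite /g sinE// sqr_ge0/= -[leRHS]real_normK ?num_real// -[leLHS]real_normK ?num_real//.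
  rewrite ler_pXn2r ?nnegrE//.
  rewrite normrM normfV (gtr0_norm (x := tau n / 2)) ?divr_gt0// ler_pdivrMr ?divr_gt0//.
  apply: le_trans (sin_le_norm _) _.
  by rewrite normrM (gtr0_norm (x := tau n / 2)) ?divr_gt0// mulrC.
have sc (y : R) : (fun n => sin (tau n / 2 * y) / (tau n / 2)) @ \oo --> y.
  apply/subr_cvg0/norm_cvg0P.
  apply: (@squeeze_cvgr _ _ _ _ (fun=> 0) (fun n => tau n / 2 * y ^+ 2)).
  - by apply: nearW => n; rewrite normr_ge0/= sin_quot_bound ?divr_gt0.
  - exact: cvg_cst.
  - rewrite -[X in _ --> X](mul0r (y ^+ 2)); apply: cvgMr_tmp.
    by rewrite -[X in _ --> X](mul0r 2^-1); apply: cvgMr_tmp.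
have sc2 (y : R) : 2 * (1 - cos (tau n * y)) / tau n ^+ 2 @[n --> \oo] --> y ^+ 2.
  under eq_fun do rewrite sinE//.
  by apply: cvg_sqr; exact: sc.
have gc x : g n x @[n --> \oo] --> Y x ^+ 2 by exact: sc2.
have mg n : measurable_fun setT (g n).
  apply: measurable_funM => //; apply: measurable_funM => //; apply: measurable_funB => //.
  have := measurable_cos_affine (tau n) 0 mY.
  by under eq_fun do rewrite addr0.
have ic n : P.-integrable setT (EFin \o (fun x => cos (tau n * Y x))).
  have := integrable_cos (tau n) 0 mY.
  by under [X in _ \o X]eq_fun do rewrite addr0.
pose a n := 2 * (1 - cos (tau n * m) * expR (- (s ^+ 2 * tau n ^+ 2 / 2))) / tau n ^+ 2.
have ig n : P.-integrable setT (EFin \o g n).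
  apply: (@integrable_bounded _ (2 * 2 / tau n ^+ 2)) => // x.
  rewrite /g normrM (ger0_norm (x := (tau n ^+ 2)^-1)) ?invr_ge0 ?sqr_ge0//.
  rewrite ler_wpM2r ?invr_ge0 ?sqr_ge0// normrM ger0_norm// ler_wpM2l//.
  have := cos_geN1 (tau n * Y x); have := cos_le1 (tau n * Y x) => ? ?.
  by rewrite ger0_norm; lra.
have Eg n : \int[P]_x g n x = a n.
  have := H (tau n) 0; rewrite addr0; under eq_Rintegral do rewrite addr0.
  move=> E; rewrite /a -E.
  have i1 : P.-integrable setT (EFin \o (fun=> 1 : R)).
    exact: finite_measure_integrable_cst.
  have -> : 1 - \int[P]_x cos (tau n * Y x) = \int[P]_x (1 - cos (tau n * Y x)).
    by rewrite (RintegralB measurableT i1 (ic n)) Rintegral_prob_cst.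
  have i2 : P.-integrable setT (EFin \o (fun x => 1 - cos (tau n * Y x))).
    by apply: eq_integrable (integrableB measurableT i1 (ic n)).
  rewrite mulrAC -(RintegralZl _ measurableT i2).
  by apply: eq_Rintegral => x _; rewrite /g; ring.
have qc : s ^+ 2 * tau n ^+ 2 / 2 @[n --> \oo] --> 0.
  rewrite -[X in _ --> X](mul0r 2^-1); apply: cvgMr_tmp.
  rewrite -[X in _ --> X](mulr0 (s ^+ 2)); apply: cvgM; first exact: cvg_cst.
  have -> : (0 : R) = 0 ^+ 2 by rewrite expr0n.
  exact: cvg_sqr.
have ac : a n @[n --> \oo] --> m ^+ 2 + s ^+ 2.
  have aE n : a n = 2 * (1 - cos (tau n * m)) / tau n ^+ 2 + cos (tau n * m) *
      (2 * (1 - expR (- (s ^+ 2 * tau n ^+ 2 / 2))) / tau n ^+ 2).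
    by rewrite /a; ring.
  rewrite (funext aE : a = _); apply: cvgD; first exact: sc2.
  rewrite -[X in _ --> X]mul1r; apply: cvgM.
    have : cos (tau n * m) @[n --> \oo] --> cos (0 * m).
      by apply: continuous_cvg; [exact: continuous_cos|exact: cvgMr_tmp].
    by rewrite mul0r cos0.
  apply: (@squeeze_cvgr _ _ _ _ (fun n => s ^+ 2 / (1 + s ^+ 2 * tau n ^+ 2 / 2)) (fun=> s ^+ 2)).
  - apply: nearW => n; set q := s ^+ 2 * tau n ^+ 2 / 2.
    have q0 : 0 <= q by rewrite divr_ge0// mulr_ge0 ?sqr_ge0.
    have qE : s ^+ 2 = 2 * q / tau n ^+ 2 by rewrite /q; field.
    have t2 : 0 < (tau n ^+ 2)^-1 by rewrite invr_gt0 exprn_gt0.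
    have e1 := expR_ge1Dx (- q).
    have e2 : expR (- q) <= (1 + q)^-1.
      by rewrite expRN lef_pV2 ?posrE ?expR_gt0 ?expR_ge1Dx//; lra.
    rewrite {1 2}qE; apply/andP; split; last first.
      by rewrite ler_pM2r// ler_pM2l//; lra.
    rewrite mulrAC ler_pM2r// -mulrA ler_pM2l//.
    have -> : q / (1 + q) = 1 - (1 + q)^-1 by field; rewrite gt_eqF//; lra.
    lra.
  - rewrite -[X in _ --> X]divr1; apply: cvgM; first exact: cvg_cst.
    apply: cvgV; first exact: oner_neq0.
    by rewrite -[X in _ --> X]addr0; apply: cvgD; [exact: cvg_cst|exact: qc].
  - exact: cvg_cst.
have lY : rL2 P Y.
  apply: L2I => //; apply/integrableP; split.
    by apply/measurable_EFinP; exact: measurable_funM.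
  apply: le_lt_trans (_ : (m ^+ 2 + s ^+ 2)%:E < +oo)%E; last by rewrite ltry.
  have -> : (\int[P]_x `|(Y x * Y x)%:E| = \int[P]_x limn_einf (fun n => (g n x)%:E))%E.
    apply: eq_integral => x _.
    have /cvg_limn_einf_sup[-> _] : (g n x)%:E @[n --> \oo] --> (Y x ^+ 2)%:E.
      by apply: cvg_EFin; [exact: nearW|exact: gc].
    by rewrite gee0_abs// lee_fin -expr2 sqr_ge0.
  apply: le_trans (fatou P measurableT _ _) _.
  - by move=> n; exact/measurable_EFinP.
  - by move=> n x _; rewrite lee_fin; case/andP: (gY n x).
  have -> : (fun n => \int[P]_x (g n x)%:E)%E = (fun n => (a n)%:E).
    by apply/funext => n; rewrite -Eg /Rintegral fineK//; exact: integrable_fin_num (ig n).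
  have /cvg_limn_einf_sup[-> _] // : (a n)%:E @[n --> \oo] --> (m ^+ 2 + s ^+ 2)%:E.
  by apply: cvg_EFin; [exact: nearW|exact: ac].
have iY2 := L2_integrable_mul lY lY.
split=> //.
- have H1 : \int[P]_x (sin (tau n * Y x) / tau n) @[n --> \oo] --> \int[P]_x Y x.
    apply: (@Rintegral_dct _ _ _ P _ _ (fun x => `|Y x|)).
    + move=> n; apply: measurable_funM => //.
      apply: (measurableT_comp (f := @sin R)); last exact: measurable_funM.
      by apply: continuous_measurable_fun; exact: continuous_sin.
    + by move=> x; exact: cvg_sin_quot.
    + exact: integrable_norm (L2_integrable lY).
    + move=> n x; rewrite normrM normfV (gtr0_norm (tau0 n)) ler_pdivrMr//.
      by apply: le_trans (sin_le_norm _) _; rewrite normrM (gtr0_norm (tau0 n)) mulrC.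
  apply: (@cvg_unique _ _ (\int[P]_x (sin (tau n * Y x) / tau n) @[n --> \oo])%classic) => //.
  have E n : \int[P]_x (sin (tau n * Y x) / tau n) =
      sin (tau n * m) / tau n * expR (- (s ^+ 2 * tau n ^+ 2 / 2)).
    (* The mean is obtained from the phase - pi / 2, through the quotients sin (tau Y) / tau. *)
    have cs (z : R) : cos (z + - (pi / 2)) = sin z.
      by rewrite cosB cos_pihalf sin_pihalf mulr0 add0r mulr1.
    have := H (tau n) (- (pi / 2)); rewrite cs; under eq_Rintegral do rewrite cs.
    move=> E; rewrite mulrAC -E mulrC -(RintegralZl _ measurableT).
      by apply: eq_Rintegral => x _; rewrite mulrC.
    have := integrable_cos (tau n) (- (pi / 2)) mY.
    by under [X in _ \o X]eq_fun do rewrite cs.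
  rewrite (funext E : (fun n => _) = _) /= -[X in _ --> X]mulr1; apply: cvgM; first exact: cvg_sin_quot.
  have : expR (- (s ^+ 2 * tau n ^+ 2 / 2)) @[n --> \oo] --> expR (- 0).
    by apply: continuous_cvg; [exact: continuous_expR|exact: cvgN].
  by rewrite oppr0 expR0.
- have iY2' : P.-integrable setT (EFin \o (fun x => Y x ^+ 2)).
    exact: eq_integrable iY2.
  have H2 : \int[P]_x g n x @[n --> \oo] --> \int[P]_x (Y x ^+ 2).
    apply: (@Rintegral_dct _ _ _ P _ _ (fun x => Y x ^+ 2)) => //.
    by move=> n x; have /andP[g0 g1] := gY n x; rewrite ger0_norm.
  rewrite /dot; under eq_Rintegral do rewrite -expr2.
  apply: (@cvg_unique _ _ (\int[P]_x g n x @[n --> \oo])%classic) => //.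
  by rewrite (funext Eg : (fun n => _) = _).
Qed.

End gaussian_span.

(** * Closed span of a centred Gaussian process *)

Section gaussian_closure.
Context d (T : measurableType d) (R : realType) (P : probability T R).
Variables (J : Type) (X : J -> T -> R).
Hypothesis X_meas : forall j, measurable_fun setT (X j).
Hypothesis X_gauss : gaussian_process P X.
Hypothesis X_centred : forall j, \int[P]_x X j x = 0.

Lemma gp_L2 j : rL2 P (X j).
Proof.
have [|m [s H]] := @gaussian_cos _ _ _ P (X j) (X_meas j).
  by apply: X_gauss; exact: lin_span_base.
by have [] := cos_moments (X_meas j) H.
Qed.

Let span_L2 h : lin_span setT X h -> rL2 P h.
Proof. by case=> n [c [j [_ ->]]]; apply: L2_sum => k _; apply: L2Z; exact: gp_L2. Qed.

Let dot1 f : dot P f (fun=> 1) = \int[P]_x f x.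
Proof. by apply: eq_Rintegral => x _; rewrite mulr1. Qed.

Let span_mean h : lin_span setT X h -> \int[P]_x h x = 0.
Proof.
case=> n [c [j [_ ->]]]; rewrite -dot1 dot_suml; last 2 first.
- by move=> i; apply: L2Z; exact: gp_L2.
- exact: L2_cst.
rewrite big1// => k _; rewrite dotZl; [|exact: gp_L2|exact: L2_cst].
by rewrite dot1 X_centred mulr0.
Qed.

Let span_cos h t c : lin_span setT X h ->
  \int[P]_x cos (t * h x + c) = cos c * expR (- (dot P h h * t ^+ 2 / 2)).
Proof.
move=> hh; have mh := L2_measurable (span_L2 hh).
have [m [s H]] := gaussian_cos mh (X_gauss hh).
have [_ m0 ->] := cos_moments mh H; rewrite span_mean// in m0.
by rewrite H -m0 mulr0 add0r expr0n add0r.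
Qed.

Definition gspan : set (T -> R) := closed_rspan P setT X.

Lemma gspan_L2 Y : gspan Y -> rL2 P Y. Proof. by case. Qed.

Lemma gspanZD (c : R) Y Z : gspan Y -> gspan Z -> gspan (fun x => c * Y x + Z x).
Proof. by apply: closed_rspanZD => j _; exact: gp_L2. Qed.

Lemma gspan_closed Y : rL2 P Y ->
  (forall eps, 0 < eps -> exists2 Z, gspan Z & dist P Y Z < eps) -> gspan Y.
Proof. by apply: closed_rspan_closed => j _; exact: gp_L2. Qed.

Lemma gspan0 : gspan (fun=> 0).
Proof.
apply: closed_rspan_lin => [j _|]; first exact: gp_L2.
exists 0%N, (fun=> 0), (fun i : 'I_0 => False_rect J (notF (ltn_ord i))); split => //.
by apply/funext => x; rewrite big_ord0.
Qed.

Lemma gspan_sum (I : Type) (s : seq I) (c : I -> R) (Y : I -> T -> R) :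
  (forall i, gspan (Y i)) -> gspan (fun x => \sum_(i <- s) c i * Y i x).
Proof.
move=> gY; elim: s => [|i s ih].
  by under eq_fun do rewrite big_nil; exact: gspan0.
by under eq_fun do rewrite big_cons; exact: gspanZD.
Qed.

Let approx Y : gspan Y -> exists2 h : nat -> T -> R,
  (forall n, lin_span setT X (h n)) & dist P Y (h n) @[n --> \oo] --> 0.
Proof.
move=> /(closed_rspanP _ (fun j _ => gp_L2 j))[lY H].
have /choice[h hP] : forall n, exists h, lin_span setT X h /\ dist P Y h < n.+1%:R^-1.
  by move=> n; have [|h ? ?] := H n.+1%:R^-1; [rewrite invr_gt0|exists h].
exists h; first by move=> n; case: (hP n).
apply: (@squeeze_cvgr _ _ _ _ (fun=> 0) (fun n => n.+1%:R^-1)).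
- by apply: nearW => n; rewrite dist_ge0/= ltW//; case: (hP n).
- exact: cvg_cst.
- exact: cvg_harmonic.
Qed.

Lemma gspan_mean Y : gspan Y -> \int[P]_x Y x = 0.
Proof.
move=> gY; have [h hh hc] := approx gY; have lY := gspan_L2 gY.
apply/normr0_eq0/eqP; rewrite eq_le normr_ge0 andbT.
suff H : \forall n \near \oo, `|\int[P]_x Y x| <= dist P Y (h n).
  exact: ler_cvg_to (cvg_cst _) hc H.
apply: nearW => n; have lh := span_L2 (hh n).
have := dotB_dist lY lh (L2_cst P 1).
by rewrite !dot1 (span_mean (hh n)) subr0 Rintegral_prob_cst sqrtr1 mulr1.
Qed.

(** Cosine is 1-Lipschitz and the L^1 distance is at most the L^2 distance, so the integrals pass to
    the limit along approximants from the linear span; their variances converge too. *)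
Lemma gspan_cos Y t c : gspan Y ->
  \int[P]_x cos (t * Y x + c) = cos c * expR (- (dot P Y Y * t ^+ 2 / 2)).
Proof.
move=> gY; have [h hh hc] := approx gY; have lY := gspan_L2 gY.
have mY := L2_measurable lY.
have lh n := span_L2 (hh n); have mh n := L2_measurable (lh n).
apply: (@cvg_unique _ _ (\int[P]_x cos (t * h n x + c) @[n --> \oo])%classic) => //=.
  apply/subr_cvg0/norm_cvg0P.
  apply: (@squeeze_cvgr _ _ _ _ (fun=> 0) (fun n => `|t| * dist P Y (h n))).
  - apply: nearW => n; rewrite normr_ge0/=.
    have iB := integrableB measurableT (integrable_cos P t c (mh n)) (integrable_cos P t c mY).
    have iB' : P.-integrable setT (EFin \o (fun x => cos (t * h n x + c) - cos (t * Y x + c))).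
      by apply: eq_integrable iB.
    have lB := L2B lY (lh n).
    rewrite -(RintegralB measurableT (integrable_cos P t c (mh n)) (integrable_cos P t c mY)).
    apply: le_trans (le_normr_Rintegral measurableT iB') _.
    have iN : P.-integrable setT (EFin \o (fun x => `|Y x - h n x|)).
      exact: integrable_norm (L2_integrable lB).
    apply: le_trans (_ : \int[P]_x (`|t| * `|Y x - h n x|) <= _).
      apply: le_Rintegral => //.
      + exact: integrable_norm iB'.
      + by apply: eq_integrable (integrableZl measurableT `|t| iN).
      + move=> x _; apply: le_trans (cos_lipschitz _ _) _.
        by rewrite opprD addrACA subrr addr0 -mulrBr normrM distrC.
    rewrite (RintegralZl _ measurableT iN) ler_wpM2l//.
    exact: expectation_abs_le.
  - exact: cvg_cst.
  - by rewrite -[X in _ --> X](mulr0 `|t|); apply: cvgM => //; exact: cvg_cst.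
rewrite (funext (fun n => span_cos t c (hh n)) : (fun n => _) = _).
apply: cvgM; first exact: cvg_cst.
apply: continuous_cvg; first exact: continuous_expR.
apply: cvgN; do 2 apply: cvgMr_tmp.
have sqc : Num.sqrt (dot P (h n) (h n)) @[n --> \oo] --> Num.sqrt (dot P Y Y).
  apply/subr_cvg0/norm_cvg0P.
  apply: (@squeeze_cvgr _ _ _ _ (fun=> 0) (fun n => dist P Y (h n))) => //.
    apply: nearW => n; rewrite normr_ge0/= ler_distlC.
    have e1 : (fun x => h n x + (Y x - h n x)) = Y by apply/funext => x; rewrite addrC subrK.
    have e2 : (fun x => Y x + (h n x - Y x)) = h n by apply/funext => x; rewrite addrC subrK.
    have := sqrt_dotD (lh n) (L2B lY (lh n)); rewrite e1 -/(dist P Y (h n)).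
    have := sqrt_dotD lY (L2B (lh n) lY); rewrite e2 -/(dist P (h n) Y) distC.
    by move=> ? ?; apply/andP; split; lra.
  exact: cvg_cst.
have := cvg_sqr sqc; rewrite sqr_sqrtr ?dot_ge0//.
by under eq_fun do rewrite sqr_sqrtr ?dot_ge0//.
Qed.

Lemma gspan_normal Y : gspan Y -> 0 < dot P Y Y ->
  normal_law P 0 (Num.sqrt (dot P Y Y)) Y.
Proof.
move=> gY v0 S mS; have mY := L2_measurable (gspan_L2 gY).
have := @law_unique _ _ _ P (fun=> 1) Y 1 (normal_prob 0 (Num.sqrt (dot P Y Y))) 1.
move=> /(_ (measurable_cst _) _ mY _ _ mS)/wrap[].
- by move=> _; rewrite normr1.
- move=> t c; rewrite normal_prob_cos ?sqrtr_gt0// mulr0 add0r mul1r sqr_sqrtr ?dot_ge0//.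
  by rewrite -gspan_cos//; apply: eq_Rintegral => x _; rewrite mul1r.
rewrite mul1r => E.
have mYS : measurable (Y @^-1` S) by rewrite -[X in measurable X]setTI; exact: mY.
rewrite -[LHS]fineK ?fin_num_measure// -[RHS]fineK ?fin_num_measure// -E; congr EFin.
rewrite /Rintegral; under eq_integral do rewrite mul1r.
have -> : (\int[P]_x (\1_S (Y x))%:E = \int[P]_x (\1_(Y @^-1` S) x)%:E)%E by [].
by rewrite integral_indic// setIT.
Qed.

(** Orthogonality makes the variance of a linear combination a sum, so its cosine integral factors;
    [law_unique] turns this into a factorisation over events. *)
Lemma gspan_independent (v : R) (xi : nat -> T -> R) : 0 < v ->
  (forall n, gspan (xi n)) ->
  (forall m n, dot P (xi m) (xi n) = v * (m == n)%:R) ->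
  forall (s : seq nat) (S : nat -> set (measurableTypeR R)), uniq s ->
    (forall n, measurable (S n)) ->
    P (\bigcap_(n in [set` s]) (xi n @^-1` S n)) =
      (\prod_(n <- s) P (xi n @^-1` S n))%E.
Proof.
move=> v0 gxi oxi s S us mS.
have mxi n := L2_measurable (gspan_L2 (gxi n)).
have mpre n : measurable (xi n @^-1` S n).
  by rewrite -[X in measurable X]setTI; exact: (mxi n measurableT _ (mS n)).
pose Q := normal_prob (0 : R) (Num.sqrt v).
have Qc t c : \int[Q]_y cos (t * y + c) = cos c * expR (- (v * t ^+ 2 / 2)).
  by rewrite normal_prob_cos ?sqrtr_gt0// mulr0 add0r sqr_sqrtr// ltW.
pose I (s1 : seq nat) x : R := \prod_(n <- s1) \1_(S n) (xi n x).
have mI s1 : measurable_fun setT (I s1).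
  rewrite /I; elim: s1 => [|k s1 ih]; first by under eq_fun do rewrite big_nil; exact: measurable_cst.
  under eq_fun do rewrite big_cons; apply: measurable_funM => //.
  exact: (measurable_indic (mpre k)).
have bI s1 x : `|I s1 x| <= 1.
  rewrite /I; elim: s1 => [|k s1 ih]; first by rewrite big_nil normr1.
  rewrite big_cons normrM mulr_ile1// indicE; by case: (_ \in _); rewrite ?normr1 ?normr0 ?lexx ?ler01.
(* Indices in [s1] already stand as indicators, those in [s2] still in a joint cosine. Each
   induction step trades one cosine for an indicator. *)
have key s1 : forall s2 (t : nat -> R) c, uniq (s1 ++ s2) ->
    \int[P]_x (I s1 x * cos (\sum_(n <- s2) t n * xi n x + c)) =
    (\prod_(n <- s1) fine (Q (S n))) * (cos c * expR (- (v * (\sum_(n <- s2) t n ^+ 2) / 2))).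
  elim: s1 => [|k s1 ih] s2 t c.
    move=> /= us2; pose Z x := \sum_(n <- s2) t n * xi n x.
    have gZ : gspan Z by exact: gspan_sum.
    have := gspan_cos 1 c gZ; rewrite expr1n mulr1 big_nil mul1r.
    have -> : dot P Z Z = v * \sum_(n <- s2) t n ^+ 2.
      have lt n : rL2 P (fun x => t n * xi n x) by apply: L2Z; exact: gspan_L2.
      have tt m n : dot P (fun x => t m * xi m x) (fun x => t n * xi n x) =
          t m * (t n * (v * (m == n)%:R)).
        have lm := gspan_L2 (gxi m); have ln := gspan_L2 (gxi n).
        by rewrite (dotZl _ lm (lt n)) (dotZr _ ln lm) oxi.
      rewrite /Z dot_suml//; last exact: gspan_L2.
      rewrite mulr_sumr; apply: eq_big_seq => n ns2.
      rewrite dot_sumr// (bigD1_seq n)//= big1 ?addr0 => [|m mn].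
        by rewrite tt eqxx mulr1; ring.
      by rewrite tt eq_sym (negbTE mn) !mulr0.
    move=> <-; apply: eq_Rintegral => x _.
    by rewrite /I big_nil mul1r mul1r.
  rewrite cat_cons cons_uniq mem_cat negb_or => /andP[/andP[ks1 ks2] us12].
  pose A x := \sum_(n <- s2) t n * xi n x + c.
  have mA : measurable_fun setT A.
    apply: measurable_funD => //; apply: measurable_sum => n; exact: measurable_funM.
  pose W x := I s1 x * cos (A x).
  have mW : measurable_fun setT W.
    apply: measurable_funM => //; apply: (measurableT_comp (f := @cos R)) => //.
    by apply: continuous_measurable_fun; exact: continuous_cos.
  have bW x : `|W x| <= 1 by rewrite normrM mulr_ile1// cos_max.
  pose q := (\prod_(n <- s1) fine (Q (S n))) * (cos c * expR (- (v * (\sum_(n <- s2) t n ^+ 2) / 2))).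
  have Wc tau e : \int[P]_x (W x * cos (tau * xi k x + e)) = q * \int[Q]_y cos (tau * y + e).
    (* By the product formula W cos (tau xi_k + e) is half the sum of two joint cosines, with
       coefficient tau or - tau on the index k; [ih] applies to both. *)
    pose t' sg n := if n == k then sg * tau else t n.
    have us12' : uniq (s1 ++ k :: s2).
      rewrite cat_uniq cons_uniq ks2 /= negb_or ks1/= andbC.
      by move: us12; rewrite cat_uniq => /and3P[-> -> ->].
    have E sg x : \sum_(n <- k :: s2) t' sg n * xi n x = sg * (tau * xi k x) + \sum_(n <- s2) t n * xi n x.
      rewrite big_cons /t' eqxx mulrA; congr (_ + _); apply: eq_big_seq => n ns2.
      by rewrite ifN//; apply: contraNneq ks2 => <-.
    have E2 sg : sg ^+ 2 = 1 -> \sum_(n <- k :: s2) t' sg n ^+ 2 = tau ^+ 2 + \sum_(n <- s2) t n ^+ 2.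
      move=> sg2; rewrite big_cons /t' eqxx exprMn sg2 mul1r; congr (_ + _).
      by apply: eq_big_seq => n ns2; rewrite ifN//; apply: contraNneq ks2 => <-.
    have H1 := ih (k :: s2) (t' 1) (c + e) us12'.
    have H2 := ih (k :: s2) (t' (-1)) (c - e) us12'.
    rewrite E2 ?expr1n// in H1; rewrite E2 ?sqrrN ?expr1n// in H2.
    have iI z : measurable_fun setT z -> P.-integrable setT (EFin \o (fun x => I s1 x * cos (z x))).
      move=> mz; apply: (@integrable_bounded _ _ _ P _ 1).
        apply: measurable_funM => //; apply: (measurableT_comp (f := @cos R)) => //.
        by apply: continuous_measurable_fun; exact: continuous_cos.
      by move=> x; rewrite normrM mulr_ile1// cos_max.
    have ms sg e' : measurable_fun setT (fun x => \sum_(n <- k :: s2) t' sg n * xi n x + e').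
      by apply: measurable_funD => //; apply: measurable_sum => n; exact: measurable_funM.
    have i1 := iI _ (ms 1 (c + e)); have i2 := iI _ (ms (-1) (c - e)).
    rewrite Qc /q.
    have -> : \int[P]_x (W x * cos (tau * xi k x + e)) =
       2^-1 * \int[P]_x (I s1 x * cos (\sum_(n <- k :: s2) t' 1 n * xi n x + (c + e))) +
       2^-1 * \int[P]_x (I s1 x * cos (\sum_(n <- k :: s2) t' (-1) n * xi n x + (c - e))).
      rewrite -mulrDr -(RintegralD measurableT i1 i2) -(RintegralZl _ measurableT); last first.
        by apply: eq_integrable (integrableD measurableT i1 i2).
      apply: eq_Rintegral => x _; rewrite !E /W /A mul1r mulN1r.
      have -> : tau * xi k x + \sum_(n <- s2) t n * xi n x + (c + e) =
        (\sum_(n <- s2) t n * xi n x + c) + (tau * xi k x + e) by ring.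
      have -> : - (tau * xi k x) + \sum_(n <- s2) t n * xi n x + (c - e) =
        (\sum_(n <- s2) t n * xi n x + c) - (tau * xi k x + e) by ring.
      move: (_ + c) (tau * _ + e) => a b.
      by rewrite cosD cosB; field.
    rewrite H1 H2 cosD cosB.
    have -> : - (v * (tau ^+ 2 + \sum_(n <- s2) t n ^+ 2) / 2) =
       - (v * (\sum_(n <- s2) t n ^+ 2) / 2) + - (v * tau ^+ 2 / 2) by ring.
    by rewrite expRD; field.
  have := @law_unique _ _ _ P W (xi k) 1 Q q mW bW (mxi k) Wc (S k) (mS k).
  rewrite big_cons /q => H; rewrite -mulrA [RHS]mulrC -H.
  by apply: eq_Rintegral => x _; rewrite /I big_cons /W /A /I; ring.
have PE n : P (xi n @^-1` S n) = Q (S n).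
  have := @gspan_normal (xi n) (gxi n); rewrite oxi eqxx mulr1 => /(_ v0 _ (mS n)).
  exact.
have := key s [::] (fun=> 0) 0; rewrite cats0 => /(_ us).
rewrite big_nil mulr0 mul0r oppr0 expR0 cos0 !mulr1 => H.
have -> : (\prod_(n <- s) P (xi n @^-1` S n))%E = (\prod_(n <- s) fine (Q (S n)))%:E.
  elim: (s) => [|n s' ih]; first by rewrite !big_nil.
  by rewrite !big_cons ih EFinM PE fineK// fin_num_measure.
have mcap : measurable (\bigcap_(n in [set` s]) (xi n @^-1` S n)).
  by apply: bigcap_measurableType => n _; exact: mpre.
rewrite -[LHS]fineK ?fin_num_measure// -H; congr EFin.
transitivity (\int[P]_x (\1_(\bigcap_(n in [set` s]) (xi n @^-1` S n)) x : R)).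
  by rewrite /Rintegral integral_indic// setIT.
apply: eq_Rintegral => x _; rewrite big_nil add0r cos0 mulr1 /I indicE.
have [xs|xs] := pselect (forall n, n \in s -> S n (xi n x)).
  rewrite mem_set//= big_seq big1// => n ns.
  by rewrite indicE mem_set//; exact: xs.
rewrite memNset/=; last by move=> H'; apply: xs => n ns; exact: H'.
have [n ns nS] : exists2 n, n \in s & ~ S n (xi n x).
  by apply: contrapT => H'; apply: xs => n ns; apply: contrapT => nS; apply: H'; exists n.
by rewrite (bigD1_seq n)//= indicE memNset// mul0r.
Qed.

End gaussian_closure.

(** * Wiener integrals *)

Section riemann_stieltjes.
Context (R : realType).
Variable r : R.
Hypothesis r_gt0 : 0 < r.
Implicit Types (f h : R -> R).

Let r_ge0 : 0 <= r. Proof. exact: ltW. Qed.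

(** Dyadic levels are nested, so consecutive sums are compared cell by cell and their distances
    decay geometrically, as [L2_complete] requires. *)
Definition node n (i : nat) : R := r * i%:R / 2 ^+ n.

Definition lipschitz L h :=
  forall s t, 0 <= s <= r -> 0 <= t <= r -> `|h t - h s| <= L * `|t - s|.

Lemma node_0 n : node n 0 = 0. Proof. by rewrite /node mulr0 mul0r. Qed.

Lemma node_last n : node n (2 ^ n) = r.
Proof. by rewrite /node natrX mulfK// expf_neq0. Qed.

Lemma node_incr n i : node n i.+1 - node n i = r / 2 ^+ n.
Proof. by rewrite /node -natr1; ring. Qed.

Lemma node_le n i j : (i <= j)%N -> node n i <= node n j.
Proof.
by move=> ij; rewrite /node ler_pM2r ?invr_gt0 ?exprn_gt0// ler_pM2l// ler_nat.
Qed.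

Lemma node_itv n i : (i <= 2 ^ n)%N -> 0 <= node n i <= r.
Proof.
move=> i2; apply/andP; split; first by rewrite -(node_0 n) node_le.
by rewrite -[leRHS](node_last n) node_le.
Qed.

Lemma node_double n i : node n.+1 i.*2 = node n i.
Proof. by rewrite /node -muln2 natrM exprS; field; rewrite expf_neq0. Qed.

Lemma big_nat_double (V : zmodType) (F : nat -> V) m :
  \sum_(0 <= i < m.*2) F i = \sum_(0 <= i < m) (F i.*2 + F i.*2.+1).
Proof.
elim: m => [|m ih]; first by rewrite !big_geq.
by rewrite doubleS !big_nat_recr//= ih addrA.
Qed.

Lemma cvg_dyadic (c : R) : c / 2 ^+ n @[n --> \oo] --> 0.
Proof.
rewrite -[X in _ --> X](mulr0 c); apply: cvgM; first exact: cvg_cst.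
by under eq_fun do rewrite -exprVn; apply: cvg_expr; rewrite ger0_norm// invf_lt1// ltr1n.
Qed.

(** The integrator is stopped at t because pairing the increments of M with M_t produces it in this
    form. On a cell h varies by at most L r / 2^n, which makes the total error O(2^-n). *)
Lemma riemann_stieltjes L h f t : 0 <= L -> cont r h -> lipschitz L h -> cont r f ->
  0 <= t <= r ->
  \sum_(0 <= i < 2 ^ n) h (node n i) *
    (J (Num.min (node n i.+1) t) f - J (Num.min (node n i) t) f) @[n --> \oo] -->
  J t (fun s => h s * f s).
Proof.
move=> L0 ch hL cf tr; have /andP[t0 tr'] := tr.
have [H H0 Hf] := cont_bound r_ge0 cf.
have chf := contM ch cf.
apply/subr_cvg0/norm_cvg0P.
apply: (@squeeze_cvgr _ _ _ _ (fun=> 0) (fun n => L * r * H * r / 2 ^+ n)); last 2 first.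
- exact: cvg_cst.
- exact: cvg_dyadic.
apply: nearW => n; rewrite normr_ge0/=.
pose m i := Num.min (node n i) t.
have E : J t (fun s => h s * f s) =
    \sum_(0 <= i < 2 ^ n) (J (m i.+1) (fun s => h s * f s) - J (m i) (fun s => h s * f s)).
  rewrite (telescope_sumr (fun i => J (m i) (fun s => h s * f s)))// /m node_last node_0.
  by rewrite (min_idPr tr') (min_idPl t0) J_0 subr0.
rewrite E -sumrB; apply: le_trans (ler_norm_sum _ _ _) _.
have -> : L * r * H * r / 2 ^+ n = \sum_(0 <= i < 2 ^ n) (L * (r / 2 ^+ n) * H * (r / 2 ^+ n)).
  by rewrite sumr_const_nat subn0 -[RHS]mulr_natr natrX; field; rewrite expf_neq0.
rewrite big_nat [leRHS]big_nat; apply: ler_sum => i /andP[_ i2].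
have mi : m i <= m i.+1 by rewrite /m le_min ge_min node_le// ge_min lexx orbT.
have mi0 : 0 <= m i by rewrite /m le_min t0 andbT; case/andP: (node_itv (ltnW i2)).
have mr : m i.+1 <= r by rewrite /m ge_min tr' orbT.
have mi1 : 0 <= m i.+1 <= r by rewrite mr (le_trans mi0).
have mi2 : 0 <= m i <= r by rewrite mi0 (le_trans mi).
have cg : cont r (fun s => (h (node n i) - h s) * f s).
  by apply: contM => //; apply: contB => //; exact: cont_cst.
have Jg s : 0 <= s <= r -> J s (fun s => (h (node n i) - h s) * f s) =
    h (node n i) * J s f - J s (fun s => h s * f s).
  move=> sr; rewrite -(JZ sr _ cf) -(JB sr (contZ _ cf) chf).
  by apply: eq_J => x _; ring.
have -> : h (node n i) * (J (Num.min (node n i.+1) t) f - J (Num.min (node n i) t) f) -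
    (J (m i.+1) (fun s => h s * f s) - J (m i) (fun s => h s * f s)) =
    J (m i.+1) (fun s => (h (node n i) - h s) * f s) -
    J (m i) (fun s => (h (node n i) - h s) * f s).
  by rewrite !Jg// /m; ring.
have len : m i.+1 - m i <= r / 2 ^+ n.
  rewrite -(node_incr n i) /m; have := node_le n (leqnSn i).
  have [?|?] := leP (node n i.+1) t; have [?|?] := leP (node n i) t; lra.
apply: le_trans (_ : L * (r / 2 ^+ n) * H * (m i.+1 - m i) <= _); last first.
  apply: ler_wpM2l => //; rewrite mulr_ge0 ?(ltW H0)// mulr_ge0// divr_ge0// exprn_ge0//.
(* A cell beyond t is stopped at both ends and contributes nothing; otherwise its left end is the
   node itself. *)
have [tn|nt] := leP t (node n i).
  have -> : m i.+1 = m i.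
    by rewrite /m (min_idPr tn) (min_idPr (le_trans tn (node_le n (leqnSn i)))).
  by rewrite !subrr normr0 mulr0.
apply: (J_incr_bound mi0 mi mr cg) => x /andP[x1 x2].
have xr : 0 <= x <= r by rewrite (le_trans mi0 x1) (le_trans x2 mr).
rewrite normrM; apply: ler_pM => //; last exact: Hf.
apply: le_trans (hL _ _ xr (node_itv (ltnW i2))) _; apply: ler_wpM2l => //.
move: x1 x2; rewrite /m (min_idPl (ltW nt)) le_min => x1 /andP[x2 _].
by rewrite distrC ger0_norm ?subr_ge0// -(node_incr n i) lerD2r.
Qed.

End riemann_stieltjes.

Section wiener.
Context d (T : measurableType d) (R : realType) (P : probability T R).
Variables (r c : R) (w : R -> R) (M : R -> T -> R).
Hypothesis r_gt0 : 0 < r.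
Hypothesis c_ge0 : 0 <= c.
Hypothesis w_cont : cont r w.
Hypothesis w_ge0 : forall t, 0 <= t <= r -> 0 <= w t.
Hypothesis M_L2 : forall t, 0 <= t -> rL2 P (M t).
Hypothesis M_dot : forall s t, 0 <= s <= r -> 0 <= t <= r ->
  dot P (M s) (M t) = c * J (Num.min s t) w.
Implicit Types (h : R -> R) (xi : T -> R).

Let r_ge0 : 0 <= r. Proof. exact: ltW. Qed.

Let node_ge0 n i : 0 <= node r n i.
Proof. by rewrite -(node_0 r n) node_le. Qed.

Let node_L2 n i : rL2 P (M (node r n i)).
Proof. exact/M_L2/node_ge0. Qed.

Let incr n i x := M (node r n i.+1) x - M (node r n i) x.

Let incr_L2 n i : rL2 P (incr n i).
Proof. by apply: L2B; apply: M_L2; exact: node_ge0. Qed.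

Definition wsum n h x := \sum_(0 <= i < 2 ^ n) h (node r n i) * incr n i x.

Lemma wsum_L2 n h : rL2 P (wsum n h).
Proof. by apply: L2_sum => i _; exact/L2Z/incr_L2. Qed.

Let incr_dot_M n i u : (i < 2 ^ n)%N -> 0 <= u <= r ->
  dot P (incr n i) (M u) = c * (J (Num.min (node r n i.+1) u) w - J (Num.min (node r n i) u) w).
Proof.
move=> i2 ur; have u0 : 0 <= u by case/andP: ur.
rewrite (dotBl (node_L2 _ _) (node_L2 _ _) (M_L2 u0)).
by rewrite !M_dot ?mulrBr// node_itv// ltnW.
Qed.

Let incr_orth n i j : (i < j)%N -> (j < 2 ^ n)%N -> dot P (incr n i) (incr n j) = 0.
Proof.
move=> ij j2; rewrite [X in dot P _ X]/incr (dotBr (node_L2 _ _) (node_L2 _ _) (incr_L2 _ _)).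
have i2 := ltn_trans ij j2.
rewrite !incr_dot_M ?node_itv//; last exact: ltnW.
have m k l : (k <= l)%N -> Num.min (node r n k) (node r n l) = node r n k.
  by move=> kl; apply/min_idPl/node_le.
by rewrite !m ?subrr// ?ltnS ltnW// ltnW.
Qed.

Let incr_sqr n i : (i < 2 ^ n)%N ->
  dot P (incr n i) (incr n i) = c * (J (node r n i.+1) w - J (node r n i) w).
Proof.
move=> i2; rewrite [X in dot P _ X]/incr (dotBr (node_L2 _ _) (node_L2 _ _) (incr_L2 _ _)).
rewrite !incr_dot_M ?node_itv//; last exact: ltnW.
have ni := node_le r_gt0 n (leqnSn i).
by rewrite !minxx (min_idPr ni) (min_idPl ni); ring.
Qed.

Lemma wsum_dot_M n h u : 0 <= u <= r ->
  dot P (wsum n h) (M u) = c * \sum_(0 <= i < 2 ^ n) h (node r n i) *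
    (J (Num.min (node r n i.+1) u) w - J (Num.min (node r n i) u) w).
Proof.
move=> ur; have u0 : 0 <= u by case/andP: ur.
rewrite (dot_suml _ (fun i => L2Z _ (incr_L2 _ i)) (M_L2 u0)).
rewrite mulr_sumr big_nat [RHS]big_nat; apply: eq_bigr => i /andP[_ i2].
by rewrite (dotZl _ (incr_L2 _ _) (M_L2 u0)) incr_dot_M//; ring.
Qed.

(** On the left half of each cell both levels evaluate h at the same node, so those terms cancel. *)
Lemma wsum_step n h x : wsum n.+1 h x - wsum n h x =
  \sum_(0 <= i < 2 ^ n) (h (node r n.+1 i.*2.+1) - h (node r n.+1 i.*2)) *
    incr n.+1 i.*2.+1 x.
Proof.
rewrite /wsum expnS mul2n big_nat_double -sumrB; apply: eq_bigr => i _.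
by rewrite /incr -doubleS !node_double; ring.
Qed.

(* The refinement step only involves the increments of [M] over the right
   halves of the intervals, weighted by the oscillation of [h]. *)
Let step_sqr n h L : 0 <= L -> lipschitz r L h ->
  dist P (wsum n.+1 h) (wsum n h) <= (L * r * Num.sqrt (c * J r w)) / (2 ^ n.+1)%:R.
Proof.
move=> L0 hL.
have E : (L * r * Num.sqrt (c * J r w)) / (2 ^ n.+1)%:R =
    Num.sqrt ((L * (r / 2 ^+ n.+1)) ^+ 2 * (c * J r w)).
  rewrite [RHS]sqrtrM ?sqr_ge0// sqrtr_sqr ger0_norm; last first.
    by rewrite mulr_ge0// divr_ge0// exprn_ge0.
  by rewrite natrX; ring.
rewrite E /dist ler_wsqrtr//.
rewrite (funext (wsum_step n h)).
pose k i := (h (node r n.+1 i.*2.+1) - h (node r n.+1 i.*2)).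
have i2 i : (i < 2 ^ n)%N -> (i.*2.+1 < 2 ^ n.+1)%N.
  by move=> i2; rewrite expnS mul2n -doubleS leq_double.
have lk i : rL2 P (fun x => k i * incr n.+1 i.*2.+1 x) by exact/L2Z/incr_L2.
rewrite dot_suml//; last by apply: L2_sum => i _; exact: lk.
have -> : \sum_(0 <= i < 2 ^ n) dot P (fun x => k i * incr n.+1 i.*2.+1 x)
    (fun x => \sum_(0 <= j < 2 ^ n) k j * incr n.+1 j.*2.+1 x) =
    \sum_(0 <= i < 2 ^ n) k i ^+ 2 *
      (c * (J (node r n.+1 i.*2.+2) w - J (node r n.+1 i.*2.+1) w)).
  rewrite !big_mkord; apply: eq_bigr => i _.
  rewrite dot_sumr// big_mkord (bigD1 i)//= big1 ?addr0.
    by rewrite dotZl ?dotZr ?incr_L2 ?L2Z ?incr_L2// incr_sqr ?i2//; ring.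
  move=> j ji; rewrite dotZl ?dotZr ?L2Z ?incr_L2//.
  have [ij|ij|/val_inj ij] := ltngtP i j; last by rewrite ij eqxx in ji.
    by rewrite incr_orth ?mulr0// ?ltnS ?ltn_double ?i2.
  by rewrite dotC incr_orth ?mulr0// ?ltnS ?ltn_double ?i2.
have wi n' i j : (i <= j <= 2 ^ n')%N -> 0 <= J (node r n' j) w - J (node r n' i) w.
  move=> /andP[ij j2]; rewrite subr_ge0; apply: J_le_subset w_cont w_ge0.
  - exact: node_ge0.
  - exact: node_le.
  - by case/andP: (node_itv r_gt0 j2).
apply: (@le_trans _ _ (\sum_(0 <= i < 2 ^ n) (L * (r / 2 ^+ n.+1)) ^+ 2 *
      (c * (J (node r n i.+1) w - J (node r n i) w)))).
  rewrite big_nat [leRHS]big_nat; apply: ler_sum => i /andP[_ ii].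
  apply: ler_pM.
  - exact: sqr_ge0.
  - by rewrite mulr_ge0// wi// leqnSn/=; exact: i2.
  - rewrite -[leLHS]real_normK ?num_real// ler_pXn2r ?nnegrE ?mulr_ge0 ?divr_ge0 ?exprn_ge0//.
    apply: le_trans (hL _ _ _ _) _.
    + by rewrite node_itv// ltnW// (ltn_trans _ (i2 _ ii)).
    + by rewrite node_itv// ltnW// i2.
    + by rewrite node_incr ger0_norm// divr_ge0// exprn_ge0.
  (* The right half-cell is enlarged to the whole cell, so that the sum telescopes to [J r w]. *)
  - apply: ler_wpM2l => //; rewrite -doubleS node_double lerD2l lerN2 -(node_double r n i).
    apply: J_le_subset w_cont w_ge0; rewrite ?node_ge0 ?node_le//.
    by case/andP: (node_itv r_gt0 (ltnW (i2 _ ii))).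
rewrite -!mulr_sumr (telescope_sumr (fun i => J (node r n i) w))//.
by rewrite node_last node_0 J_0 subr0.
Qed.

(** A relation, since the limit is determined only almost everywhere. *)
Definition wiener h xi := rL2 P xi /\ dist P (wsum n h) xi @[n --> \oo] --> 0.

Lemma wiener_exists h L : 0 <= L -> lipschitz r L h -> exists xi, wiener h xi.
Proof.
move=> L0 hL.
have [xi lxi cxi] := L2_complete (fun n => wsum_L2 n h) (fun n => step_sqr n L0 hL).
by exists xi.
Qed.

Lemma wiener_dot_M h L xi u : 0 <= L -> lipschitz r L h -> cont r h -> wiener h xi ->
  0 <= u <= r -> dot P xi (M u) = c * J u (fun s => h s * w s).
Proof.
move=> L0 hL ch [lxi cxi] ur; have u0 : 0 <= u by case/andP: ur.
have H := cvg_dist_dot (fun n => wsum_L2 n h) lxi (M_L2 u0) cxi.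
apply: cvg_unique H _ => //=.
under eq_fun do rewrite wsum_dot_M//.
apply: cvgM; first exact: cvg_cst.
exact: riemann_stieltjes hL w_cont ur.
Qed.

(** Only one factor is discretised: by [wiener_dot_M], pairing [wsum n h] with [xi'] gives a Riemann
    sum for the integrator h' w. *)
Lemma wiener_dot h L xi h' L' xi' : 0 <= L -> lipschitz r L h -> cont r h -> wiener h xi ->
  0 <= L' -> lipschitz r L' h' -> cont r h' -> wiener h' xi' ->
  dot P xi xi' = c * J r (fun s => w s * h s * h' s).
Proof.
move=> L0 hL ch wxi L0' hL' ch' wxi'.
have [lxi cxi] := wxi; have [lxi' cxi'] := wxi'.
have H := cvg_dist_dot (fun n => wsum_L2 n h) lxi lxi' cxi.
apply: cvg_unique H _ => //=.
have E n : dot P (wsum n h) xi' = c * \sum_(0 <= i < 2 ^ n) h (node r n i) *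
    (J (Num.min (node r n i.+1) r) (fun s => h' s * w s) -
     J (Num.min (node r n i) r) (fun s => h' s * w s)).
  rewrite dot_suml//; last by move=> i; exact/L2Z/incr_L2.
  rewrite mulr_sumr big_nat [RHS]big_nat; apply: eq_bigr => i /andP[_ i2].
  have n1 := node_itv r_gt0 i2; have n2 := node_itv r_gt0 (ltnW i2).
  rewrite !(min_idPl _); try by [case/andP: n1|case/andP: n2].
  rewrite (dotZl _ (incr_L2 _ _) lxi') dotC (dotBr (node_L2 _ _) (node_L2 _ _) lxi').
  by rewrite !(wiener_dot_M L0' hL' ch' wxi')//; ring.
rewrite (funext E); apply: cvgM; first exact: cvg_cst.
have -> : J r (fun s => w s * h s * h' s) = J r (fun s => h s * (h' s * w s)).
  by apply: eq_J => s _; ring.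
by apply: (riemann_stieltjes r_gt0 L0 ch hL (contM ch' w_cont)); rewrite r_ge0 lexx.
Qed.

(** It puts the Wiener integrals into the closed Gaussian span, being limits of combinations of
    values of M. *)
Lemma wiener_closed (S : set (T -> R)) h xi : wiener h xi ->
  S (fun=> 0) ->
  (forall (k : R) Y Z, S Y -> S Z -> S (fun x => k * Y x + Z x)) ->
  (forall Y, rL2 P Y -> (forall eps, 0 < eps -> exists2 Z, S Z & dist P Y Z < eps) -> S Y) ->
  (forall t, 0 <= t -> S (M t)) -> S xi.
Proof.
move=> [lxi cxi] S0 SZD Sc SM; apply: Sc => // eps e0.
have /cvgrPdist_lt/(_ _ e0)[N _ HN] := cxi.
exists (wsum N h); last first.
  have := HN N (leqnn N); rewrite /= sub0r normrN => H.
  by rewrite distC; apply: le_lt_trans H; exact: ler_norm.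
rewrite /wsum; elim: (index_iota 0 (2 ^ N)) => [|i s ih].
  by under eq_fun do rewrite big_nil.
under eq_fun do rewrite big_cons.
suff Si : S (incr N i) by exact: (SZD _ _ _ Si ih).
have -> : incr N i = (fun x => -1 * M (node r N i) x + M (node r N i.+1) x).
  by apply/funext => x; rewrite /incr; ring.
by apply: (SZD); apply: SM; exact: node_ge0.
Qed.

End wiener.

(** * The covariance of the bridge *)

Lemma prim_lipschitz (R : realType) (r : R) (F f : R -> R) : 0 < r -> prim r F f ->
  exists2 L, 0 <= L & lipschitz r L F.
Proof.
move=> r0 pF; have [cf FE] := pF; have [L L0 HL] := cont_bound (ltW r0) cf.
exists L => [|s t]; first exact: ltW.
wlog st : s t / s <= t.
  move=> H sr tr; have [st|/ltW ts] := leP s t; first exact: H.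
  by rewrite distrC [`|t - s|]distrC; exact: H.
move=> sr' tr'; have /andP[s0 sr] := sr'; have /andP[t0 tr] := tr'.
rewrite (FE _ sr') (FE _ tr') [`|t - s|]ger0_norm ?subr_ge0//.
have -> : F 0 + J t f - (F 0 + J s f) = J t f - J s f by ring.
apply: J_incr_bound cf _ => // x /andP[sx xt].
by apply: HL; rewrite (le_trans s0 sx) (le_trans xt tr).
Qed.

Lemma dot_quad d (T : measurableType d) (R : realType) (mu : {measure set T -> \bar R})
    (f g : T -> R) (x y : R) : rL2 mu f -> rL2 mu g ->
  dot mu (fun z => x * f z + y * g z) (fun z => x * f z + y * g z) =
  x ^+ 2 * dot mu f f + 2 * (x * y) * dot mu f g + y ^+ 2 * dot mu g g.
Proof.
move=> lf lg; have lx := L2Z x lf; have ly := L2Z y lg; have lxy := L2D lx ly.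
rewrite (dotDl lx ly lxy) !(dotDr lx ly)// (dotZl _ lf lx) (dotZl _ lf ly) (dotZl _ lg lx).
rewrite (dotZl _ lg ly) (dotZr _ lf lf) (dotZr _ lg lf) (dotZr _ lf lg) (dotZr _ lg lg).
by rewrite (dotC _ g f); ring.
Qed.

Section bridge_covariance.
Context d (T : measurableType d) (R : realType) (P : probability T R).
Variables (r c : R) (w alpha : R -> R) (a b : R -> R -> R) (M : R -> T -> R).
Hypothesis r_gt0 : 0 < r.
Hypothesis c_gt0 : 0 < c.
Hypothesis w_cont : cont r w.
Hypothesis w_gt0 : forall t, 0 <= t <= r -> 0 < w t.
Hypothesis alpha_prim : prim r alpha w.
Hypothesis alpha0 : alpha 0 = 0.
Hypothesis a_prim : forall k, prim r (a k) (fun t => - (k * (b k t / w t))).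
Hypothesis b_prim : forall k, prim r (b k) (fun t => k * (a k t * w t)).
Hypothesis a0 : forall k, a k 0 = 1.
Hypothesis b0 : forall k, b k 0 = 0.
Hypothesis M_L2 : forall t, 0 <= t -> rL2 P (M t).
Hypothesis M_dot : forall s t, 0 <= s <= r -> 0 <= t <= r ->
  dot P (M s) (M t) = c * alpha (Num.min s t).
Implicit Types (k l s t : R).

Let r_ge0 : 0 <= r. Proof. exact: ltW. Qed.

Let rr : 0 <= r <= r. Proof. by rewrite r_ge0 lexx. Qed.

Let w_ge0 t : 0 <= t <= r -> 0 <= w t. Proof. by move=> /w_gt0/ltW. Qed.

Let a_cont k : cont r (a k). Proof. exact: prim_cont (a_prim k). Qed.
Arguments a_cont : clear implicits.

Let alphar := alpha_gt0 r_gt0 w_cont w_gt0 alpha_prim alpha0.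

Let M_dotJ s t : 0 <= s <= r -> 0 <= t <= r ->
  dot P (M s) (M t) = c * J (Num.min s t) w.
Proof.
move=> sr tr; rewrite M_dot// (alphaE alpha_prim alpha0)//.
by have [] := leP s t.
Qed.

Let lips k : exists L, 0 <= L /\ lipschitz r L (a k).
Proof. by have [L L0 HL] := prim_lipschitz r_gt0 (a_prim k); exists L. Qed.

Lemma wieners_exist : exists xi, forall k, wiener P r M (a k) (xi k).
Proof.
suff /choice[xi H] : forall k, exists Y, wiener P r M (a k) Y by exists xi.
move=> k; have [L [L0 HL]] := lips k.
exact: (wiener_exists r_gt0 (ltW c_gt0) w_cont w_ge0 M_L2 M_dotJ L0 HL).
Qed.

Variable xi : R -> T -> R.
Hypothesis xiP : forall k, wiener P r M (a k) (xi k).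

Let xi_L2 k : rL2 P (xi k). Proof. by have [] := xiP k. Qed.

Definition mbridge t x := M t x - alpha t / alpha r * M r x.

Local Notation ip := (ip r w).
Local Notation zero := (zero r b).
Local Notation zeros := (zeros r b).
Local Notation green := (green r alpha).
Local Notation rest := (rest r w alpha b).

Lemma mbridge_L2 t : 0 <= t -> rL2 P (mbridge t).
Proof. by move=> t0; apply: L2B; [exact: M_L2|apply: L2Z; exact: M_L2]. Qed.

Let mbridge_dotl t Y : 0 <= t -> rL2 P Y ->
  dot P (mbridge t) Y = dot P (M t) Y - alpha t / alpha r * dot P (M r) Y.
Proof. by move=> t0 lY; rewrite dotBl ?dotZl//; try exact: M_L2; apply: L2Z; exact: M_L2. Qed.

Lemma mbridge_dot s t : 0 <= s <= r -> 0 <= t <= r ->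
  dot P (mbridge s) (mbridge t) = c * green s t.
Proof.
move=> sr tr; have /andP[s0 sr'] := sr; have /andP[t0 tr'] := tr.
rewrite mbridge_dotl//; last exact: mbridge_L2.
rewrite !(dotC P (M _) (mbridge t)) (mbridge_dotl t0 (M_L2 s0)) (mbridge_dotl t0 (M_L2 r_ge0)) !M_dot//.
rewrite (min_idPl tr') (min_idPr sr') minxx.
rewrite (minC t s) (alpha_min w_cont w_gt0 alpha_prim alpha0)// /green.
by field; rewrite gt_eqF.
Qed.

(** The pairing with M_t is c times the integral of a_k w over [0, t], that is c b_k(t) / k; the
    term from M_r drops out because b_k(r) = 0. *)
Lemma mbridge_dot_xi k t : zero k -> 0 <= t <= r ->
  dot P (mbridge t) (xi k) = c * (b k t / k).
Proof.
move=> [k0 bk] tr; have /andP[t0 tr'] := tr; have [L [L0 HL]] := lips k.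
have bE s : 0 <= s <= r -> b k s = k * J s (fun u => a k u * w u).
  move=> sr; rewrite (primE (b_prim k) sr) b0 add0r (JZ sr)//.
  by apply: contM.
rewrite mbridge_dotl// !(dotC P (M _) (xi k)).
rewrite !(wiener_dot_M r_gt0 w_cont M_L2 M_dotJ L0 HL (a_cont k) (xiP k))//.
have := bE _ rr; rewrite bk => /esym/eqP; rewrite mulf_eq0 gt_eqF//= => /eqP ->.
by rewrite bE//; field; rewrite !gt_eqF.
Qed.

(** By the isometry this is c times the [en] product of a_k and a_l. For k = l equipartition
    applies; otherwise [solves_en] reduces it to the orthogonality of b_k and b_l. *)
Lemma xi_dot k l : zero k -> zero l ->
  dot P (xi k) (xi l) = c * ip (b k) (b k) * (k == l)%:R.
Proof.
move=> zk zl; have [k0 bk] := zk; have [l0 bl] := zl.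
have [L [L0 HL]] := lips k; have [L' [L0' HL']] := lips l.
rewrite (wiener_dot r_gt0 w_cont M_L2 M_dotJ L0 HL (a_cont k) (xiP k) L0' HL' (a_cont l) (xiP l)).
rewrite -mulrA; congr (_ * _); rewrite -/(en r w (a k) (a l)).
have kn := lt0r_neq0 k0; have ln := lt0r_neq0 l0.
have [<-|kl] := eqVneq k l.
  by rewrite mulr1 (ip_b r_gt0 w_cont w_gt0 a_prim b_prim b0).
have sk := zero_solves r_gt0 a_prim b_prim b0 bk.
have sl := zero_solves r_gt0 a_prim b_prim b0 bl.
have := solves_en r_gt0 w_cont w_gt0 sk sl.
have bc m : cont r (b m) by exact: prim_cont (b_prim m).
rewrite (ipZr r_gt0 w_cont w_gt0)// (zero_orth r_gt0 w_cont w_gt0 a_prim b_prim b0 zk zl kl) mulr0.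
have -> : en r w (fun t => k * a k t) (fun t => l * a l t) = k * l * en r w (a k) (a l).
  rewrite /en -(JZ rr); last by apply: contM => //; apply: contM.
  by apply: eq_J => x _; ring.
by move=> /esym/eqP; rewrite mulf_eq0 mulf_eq0 (negbTE kn) (negbTE ln)/= => /eqP ->; rewrite mulr0.
Qed.

Let N k := ip (b k) (b k).

Let N_gt0 k : zero k -> 0 < N k.
Proof.
move=> [k0 bk]; apply: (ip_b_gt0 r_gt0 w_cont w_gt0 a_prim b_prim a0 b0 bk).
exact: lt0r_neq0.
Qed.

(** The coefficient is the quotient of the two previous pairings, so the sum is the orthogonal
    projection of the bridge. *)
Definition remainder (F : seq R) t x :=
  mbridge t x - \sum_(k <- F) b k t / (k * N k) * xi k x.

Lemma remainder_L2 F t : 0 <= t -> rL2 P (remainder F t).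
Proof.
move=> t0; apply: L2B; first exact: mbridge_L2.
by apply: L2_sum => k _; exact: L2Z.
Qed.

Let remainder_dotl F t Y : 0 <= t -> rL2 P Y -> dot P (remainder F t) Y =
  dot P (mbridge t) Y - \sum_(k <- F) b k t / (k * N k) * dot P (xi k) Y.
Proof.
move=> t0 lY; rewrite dotBl//.
- rewrite dot_suml//; last by move=> k; exact: L2Z.
  by congr (_ - _); apply: eq_bigr => k _; rewrite dotZl.
- exact: mbridge_L2.
- by apply: L2_sum => k _; exact: L2Z.
Qed.

Lemma remainder_dot_xi F l t : zeros F -> l \in F -> 0 <= t <= r ->
  dot P (remainder F t) (xi l) = 0.
Proof.
move=> [uF zF] lF tr; have /andP[t0 tr'] := tr.
rewrite remainder_dotl// (mbridge_dot_xi (zF _ lF) tr).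
rewrite (bigD1_seq l)//= big_seq_cond big1 => [|k /andP[kF kl]]; last first.
  by rewrite (xi_dot (zF _ kF) (zF _ lF)) (negbTE kl) !mulr0.
rewrite addr0 (xi_dot (zF _ lF) (zF _ lF)) eqxx mulr1 -/(N l); field.
by have [l0 _] := zF _ lF; rewrite !gt_eqF//; exact/N_gt0/zF.
Qed.

(** The remainder is orthogonal to the variables of [F], so one of the two factors may be replaced
    by the bridge. *)
Lemma remainder_dot F s t : zeros F -> 0 <= s <= r -> 0 <= t <= r ->
  dot P (remainder F s) (remainder F t) = c * rest F s t.
Proof.
move=> zF sr tr; have /andP[s0 sr'] := sr; have /andP[t0 tr'] := tr.
rewrite dotC (remainder_dotl _ t0 (remainder_L2 F s0)) big_seq_cond big1 => [|k /andP[kF _]]; last first.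
  by rewrite dotC (remainder_dot_xi zF kF sr) mulr0.
rewrite subr0 dotC (remainder_dotl _ s0 (mbridge_L2 t0)) mbridge_dot//.
have -> : rest F s t = green s t - \sum_(k <- F) b k s * b k t / (k ^+ 2 * N k) by [].
rewrite [RHS]mulrBr; congr (_ - _).
rewrite mulr_sumr big_seq [RHS]big_seq; apply: eq_bigr => k kF.
have zk := zF.2 _ kF; have [k0 _] := zk.
by rewrite dotC mbridge_dot_xi// -/(N k); field; rewrite !gt_eqF// N_gt0.
Qed.

Lemma bridge_rest_psd F s t (x x' : R) : zeros F -> 0 <= s <= r -> 0 <= t <= r ->
  0 <= x ^+ 2 * rest F s s + 2 * (x * x') * rest F s t + x' ^+ 2 * rest F t t.
Proof.
move=> zF sr tr; rewrite -(pmulr_rge0 _ c_gt0).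
have ls : rL2 P (remainder F s) by apply: remainder_L2; case/andP: sr.
have lt : rL2 P (remainder F t) by apply: remainder_L2; case/andP: tr.
have := dot_ge0 P (fun y => x * remainder F s y + x' * remainder F t y).
rewrite (dot_quad _ _ ls lt) !remainder_dot//.
by congr (0 <= _); ring.
Qed.

End bridge_covariance.

(** * Completeness of the eigenfunctions *)

Section L2_total.
Context (R : realType) (mu : {measure set (measurableTypeR R) -> \bar R}).
Variable S : set (R -> R).
Hypothesis SZD : forall (c : R) f g, S f -> S g -> S (fun x => c * f x + g x).
Hypothesis S_closed : forall f, rL2 mu f ->
  (forall eps, 0 < eps -> exists2 g, S g & dist mu f g < eps) -> S f.

Let S_dominated (f_ : nat -> R -> R) (f g : R -> R) :
  (forall n, S (f_ n)) -> (forall n, measurable_fun (T := measurableTypeR R) setT (f_ n)) -> rL2 mu g ->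
  (forall n x, `|f_ n x| <= g x) -> (forall x, f_ n x @[n --> \oo] --> f x) -> S f.
Proof.
move=> Sf mf lg fg ff.
have mfl : measurable_fun (T := measurableTypeR R) setT f.
  exact: measurable_fun_cvg mf (fun x _ => ff x).
have fg' x : `|f x| <= g x.
  rewrite -(cvg_lim _ (cvg_norm (ff x)))//; apply: limr_le.
    by apply/cvg_ex; eexists; exact: cvg_norm (ff x).
  exact: nearW.
have lf : rL2 mu f.
  by apply: (L2_le mfl lg) => x; rewrite (le_trans (fg' x))// ler_norm.
have lfn n : rL2 mu (f_ n).
  by apply: (L2_le (mf n) lg) => x; rewrite (le_trans (fg n x))// ler_norm.
apply: S_closed => // eps e0.
have : dot mu (fun x => f x - f_ n x) (fun x => f x - f_ n x) @[n --> \oo] --> 0.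
  have <- : \int[mu]_x 0 = 0 :> R by rewrite /Rintegral integral0.
  apply: (@Rintegral_dct _ _ _ mu _ _ (fun x => 4 * (g x * g x))).
  - by move=> n; apply: measurable_funM; apply: measurable_funB.
  - move=> x; rewrite -(mulr0 0); apply: cvgM; rewrite -(subrr (f x));
    by apply: cvgB => //; exact: cvg_cst.
  - have := integrableZl measurableT 4 (L2_integrable_mul lg lg).
    by apply: eq_integrable => // x _; rewrite /= EFinM.
  - move=> n x; rewrite normrM (_ : 4 = 2 * 2); last by ring.
    have H : `|f x - f_ n x| <= 2 * g x.
      by rewrite (le_trans (ler_normB _ _))// mulrDl !mul1r lerD.
    by rewrite mulrACA ler_pM.
move=> /cvgrPdist_lt/(_ (eps ^+ 2) (exprn_gt0 2 e0))[N _ HN].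
exists (f_ N) => //; rewrite /dist -[ltRHS]gtr0_norm// -sqrtr_sqr ltr_sqrt ?exprn_gt0//.
by have := HN N (leqnn N); rewrite /= sub0r normrN; apply: le_lt_trans; exact: ler_norm.
Qed.

Variable h : R -> R.
Hypothesis lh : rL2 mu h.
Hypothesis h_gt0 : forall x, 0 < h x.
Hypothesis Sh : S h.
Hypothesis S_ray : forall a, S (fun x => \1_(`]a, +oo[%classic) x * h x).

Let mh : measurable_fun (T := measurableTypeR R) setT h. Proof. exact: L2_measurable lh. Qed.

Let S0 : S (fun=> 0).
Proof.
have := SZD (-1) Sh Sh; congr S; apply/funext => x.
by rewrite mulN1r addNr.
Qed.

Let SZ c f : S f -> S (fun x => c * f x).
Proof.
move=> Sf; have := SZD c Sf S0; congr S; apply/funext => x.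
by rewrite addr0.
Qed.

Let S_indic (A : set (measurableTypeR R)) : measurable A -> S (fun x => \1_A x * h x).
Proof.
move=> mA.
suff [] : measurable_fun (T := measurableTypeR R) setT (\1_A : R -> R) /\
  S (fun x => \1_A x * h x) by [].
apply: (indic_dynkin (G := fun f => measurable_fun (T := measurableTypeR R) setT f /\
   S (fun x => f x * h x))) mA.
- split; first exact: measurable_cst.
  by move: Sh; congr S; apply/funext => x; rewrite mul1r.
- move=> c f g [mf Sf] [mg Sg]; split.
    by apply: measurable_funD => //; apply: measurable_funM => //; exact: measurable_cst.
  have := SZD c Sf Sg; congr S; apply/funext => x.
  by rewrite mulrDl mulrA.
- by move=> a; split => //; apply: measurable_indic; exact: measurable_itv.
- move=> f_ f fS f1 ff; have mf n := (fS n).1.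
  split; first exact: measurable_fun_cvg mf (fun x _ => ff x).
  apply: (S_dominated (fun n => (fS n).2)) lh _ _.
  + by move=> n; exact: measurable_funM.
  + by move=> n x; rewrite normrM (gtr0_norm (h_gt0 x)) ler_piMl// ltW.
  + by move=> x; apply: cvgM => //; exact: cvg_cst.
Qed.

(** f / h is the increasing limit of simple functions; each of them times h is a combination of
    indicators times h and is dominated by f. *)
Let S_ge0 f : rL2 mu f -> (forall x, 0 <= f x) -> S f.
Proof.
move=> lf f0; have mf := L2_measurable lf.
have mu' : measurable_fun (T := measurableTypeR R) setT (fun x => (f x / h x)%:E).
  apply/measurable_EFinP; apply: measurable_funM => //.
  have -> : (fun x => (h x)^-1) = (fun x => h x `^ (-1)).
    by apply/funext => x; rewrite powR_inv1// ltW.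
  exact: measurableT_comp (measurable_powR _) mh.
have u0 x : setT x -> (0 <= (f x / h x)%:E)%E.
  by move=> _; rewrite lee_fin divr_ge0// ltW.
pose v n x := nnsfun_approx measurableT mu' n x.
have vc x : v n x @[n --> \oo] --> f x / h x.
  exact: fine_cvg (cvg_nnsfun_approx measurableT mu' u0 (I : setT x)).
have vle n x : v n x <= f x / h x.
  have vnd : nondecreasing_seq (v^~ x).
    by move=> p q /(nd_nnsfun_approx measurableT mu')/lefP; apply.
  have vcv : cvgn (v^~ x) by apply/cvg_ex; eexists; exact: vc.
  by have := nondecreasing_cvgn_le vnd vcv n; rewrite (cvg_lim _ (vc x)).
have v0 n x : 0 <= v n x by [].
apply: (@S_dominated (fun n x => v n x * h x) _ f) => //.
- move=> n; have -> : (fun x => v n x * h x) =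
      (fun x => \sum_(y <- finmap.enum_fset (fset_set (range (v n)))) y * (\1_(v n @^-1` [set y]) x * h x)).
    apply/funext => x; rewrite /v fimfunE fsbig_finite//= mulr_suml.
    by apply: eq_bigr => y _; rewrite mulrA.
  elim: (finmap.enum_fset _) => [|y s ih].
    by under eq_fun do rewrite big_nil.
  under eq_fun do rewrite big_cons.
  by apply: SZD => //; exact: S_indic.
- by move=> n; apply: measurable_funM.
- move=> n x; rewrite ger0_norm ?mulr_ge0// ?(ltW (h_gt0 x))//.
  by rewrite -ler_pdivlMr.
- move=> x; rewrite -[X in _ --> X](@divfK _ (h x)) ?gt_eqF//.
  by apply: cvgM => //; exact: cvg_cst.
Qed.

(** The weight h accompanies the rays because the Green functions divided by sqrt w yield step
    functions only up to the factor 1 / sqrt w; being positive, it can be divided out. *)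
Lemma L2_total : rL2 mu `<=` S.
Proof.
move=> f lf; have mf := L2_measurable lf.
have mn : measurable_fun (T := measurableTypeR R) setT (fun x => `|f x|).
  exact: measurableT_comp.
have ln : rL2 mu (fun x => `|f x|) by apply: (L2_le mn lf) => x; rewrite normr_id.
have pos x : 0 <= `|f x| + f x by rewrite -lerBlDr sub0r -normrN ler_norm.
have neg x : 0 <= `|f x| - f x by rewrite subr_ge0 ler_norm.
have := SZD (- 2^-1) (S_ge0 (L2B ln lf) neg) (SZ 2^-1 (S_ge0 (L2D ln lf) pos)).
by congr S; apply/funext => x; field.
Qed.

End L2_total.

Section restricted_lebesgue.
Context (R : realType) (r : R).
Hypothesis r_gt0 : 0 < r.
Notation leb := (@lebesgue_measure R).
Notation mur := (mrestr leb (measurable_itv `[0, r])).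
Local Notation D := (`[0%R, r]%classic : set (measurableTypeR R)).
Local Notation mfun f := (measurable_fun (T := measurableTypeR R) setT f).
Implicit Types f g : R -> R.

Let mD : measurable D.
Proof. exact: measurable_itv. Qed.

Let rr : 0 <= r <= r. Proof. by rewrite ltW/=. Qed.

Lemma integral_mrestr (f : measurableTypeR R -> \bar R) : measurable_fun setT f ->
  (\int[mur]_x f x = \int[leb]_(x in D) f x)%E.
Proof.
move=> mf; have mf' : measurable_fun setT (f \_ D).
  exact/(measurable_restrictT f mD)/measurable_funTS.
rewrite (ae_eq_integral (f \_ D))//; last first.
  exists (~` D); split; first exact: measurableC.
    by rewrite /= /mrestr setICl measure0.
  move=> x /= H xr; apply: H => _; rewrite patchE ifT//; exact: mem_set.
rewrite -integral_mkcond; apply: eq_measure_integral => A mA AD.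
by rewrite /= /mrestr setIidl.
Qed.

Lemma restr_measurable f : cont r f -> mfun (f \_ D).
Proof.
move=> cf; apply/(measurable_restrictT f mD)/measurable_EFinP.
exact: measurable_int (cont_integrable rr cf).
Qed.

Section agree.
Variables (f g : R -> R).
Hypothesis mf : mfun f.
Hypothesis cg : cont r g.
Hypothesis fg : forall x, 0 <= x <= r -> f x = g x.

Lemma agree_L2 : rL2 mur f.
Proof.
apply: L2I => //; apply/integrableP; split.
  by apply/measurable_EFinP; exact: measurable_funM.
rewrite integral_mrestr; last first.
  by apply/measurableT_comp => //; apply/measurable_EFinP; exact: measurable_funM.
have /integrableP[_] := cont_integrable rr (contM cg cg).
congr (_ < _)%E; apply: eq_integral => x; rewrite inE/= in_itv/= => xr.
by rewrite fg.
Qed.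

End agree.

Lemma agree_dot f g f' g' : mfun f -> mfun f' ->
  (forall x, 0 <= x <= r -> f x = g x) -> (forall x, 0 <= x <= r -> f' x = g' x) ->
  dot mur f f' = J r (fun x => g x * g' x).
Proof.
move=> mf mf' fg fg'; rewrite /dot /Rintegral integral_mrestr; last first.
  by apply/measurable_EFinP; exact: measurable_funM.
congr fine; apply: eq_integral => x; rewrite inE/= in_itv/= => xr.
by rewrite fg// fg'.
Qed.

(** The approximations of step functions below miss their targets only on a short interval [u, v],
    by a bounded amount. *)
Lemma dist_mrestr f g k u v : mfun f -> mfun g -> 0 <= k -> u <= v ->
  (forall x, 0 <= x <= r -> u <= x <= v -> `|f x - g x| <= k) ->
  (forall x, 0 <= x <= r -> ~~ (u <= x <= v) -> f x = g x) ->
  dist mur f g <= k * Num.sqrt (v - u).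
Proof.
move=> mf mg k0 uv fk f0.
have -> : k * Num.sqrt (v - u) = Num.sqrt (k ^+ 2 * (v - u)).
  by rewrite sqrtrM ?sqr_ge0// sqrtr_sqr ger0_norm.
rewrite /dist ler_wsqrtr// /dot /Rintegral.
have mfg : mfun (fun x => (f x - g x) * (f x - g x)).
  by apply: measurable_funM; exact: measurable_funB.
rewrite integral_mrestr; last exact/measurable_EFinP.
have H : (\int[leb]_(x in D) ((f x - g x) * (f x - g x))%:E <= (k ^+ 2 * (v - u))%:E)%E.
  apply: (@le_trans _ _ (\int[leb]_(x in D) ((k ^+ 2)%:E * (\1_(`[u, v]%classic) x)%:E))%E).
    apply: ge0_le_integral => //.
    - by move=> x _; rewrite lee_fin -expr2 sqr_ge0.
    - exact/measurable_funTS/measurable_EFinP.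
    - by apply: measurable_funTS; apply: measurable_funeM; apply/measurable_EFinP.
    - move=> x /=; rewrite in_itv/= => xr; rewrite -EFinM lee_fin indicE mem_setE in_itv/=.
      case: (boolP (u <= x <= v)) => uxv; last by rewrite f0// subrr !mulr0.
      by rewrite mulr1 -expr2 -real_normK ?num_real// lerXn2r ?nnegrE// fk.
  rewrite ge0_integralZl//; last 2 first.
  - by apply: measurable_funTS; apply/measurable_EFinP; apply: measurable_indic; exact: measurable_itv.
  - by rewrite lee_fin sqr_ge0.
  have mI : measurable (`[u, v]%classic : set (measurableTypeR R)) by exact: measurable_itv.
  rewrite integral_indic//.
  rewrite (EFinM (k ^+ 2)); apply: lee_wpmul2l; first by rewrite lee_fin sqr_ge0.
  apply: (@le_trans _ _ (leb `[u, v]%classic)).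
    by apply: le_measure; rewrite ?inE//; exact: measurableI.
  rewrite lebesgue_measure_itv/= lte_fin; case: ltP => // _.
  by rewrite lee_fin subr_ge0.
have H0 : (0 <= \int[leb]_(x in D) ((f x - g x) * (f x - g x))%:E)%E.
  by apply: integral_ge0 => x _; rewrite lee_fin -expr2 sqr_ge0.
rewrite -lee_fin fineK// ge0_fin_numE//.
exact: le_lt_trans H (ltry _).
Qed.


End restricted_lebesgue.

(** * Orthonormality and totality of the normalised eigenfunctions *)

Section enumeration.
Context (R : realType).
Variables (r : R) (w alpha : R -> R) (a b : R -> R -> R) (lam : nat -> R).
Hypothesis r_gt0 : 0 < r.
Hypothesis w_cont : cont r w.
Hypothesis w_gt0 : forall t, 0 <= t <= r -> 0 < w t.
Hypothesis alpha_prim : prim r alpha w.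
Hypothesis alpha0 : alpha 0 = 0.
Hypothesis a_prim : forall k, prim r (a k) (fun t => - (k * (b k t / w t))).
Hypothesis b_prim : forall k, prim r (b k) (fun t => k * (a k t * w t)).
Hypothesis a0 : forall k, a k 0 = 1.
Hypothesis b0 : forall k, b k 0 = 0.
Hypothesis rest_psd : forall F s t (x x' : R), zeros r b F ->
  0 <= s <= r -> 0 <= t <= r ->
  0 <= x ^+ 2 * rest r w alpha b F s s + 2 * (x * x') * rest r w alpha b F s t +
       x' ^+ 2 * rest r w alpha b F t t.
Hypothesis lam_incr : forall n, lam n < lam n.+1.
Hypothesis lam_range : range lam = [set k | zero r b k].

Definition first N := [seq lam n | n <- iota 0 N].

Let lam_lt : {homo lam : m n / (m < n)%N >-> m < n}.
Proof. exact: homo_ltn lt_trans lam_incr. Qed.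

Let lam_inj : injective lam.
Proof.
move=> m n; have [/lam_lt|/lam_lt|//] := ltngtP m n => H e;
  by rewrite e ltxx in H.
Qed.

Lemma lam_zero n : zero r b (lam n).
Proof. by have : range lam (lam n) by []; rewrite lam_range. Qed.

Lemma first_zeros N : zeros r b (first N).
Proof.
split; first by rewrite map_inj_uniq ?iota_uniq.
by move=> k /mapP[n _ ->]; exact: lam_zero.
Qed.

Lemma first_below N k : k < lam N -> zero r b k -> k \in first N.
Proof.
move=> kN zk; have : range lam k by rewrite lam_range.
move=> [n _ nk]; rewrite -nk; apply: map_f; rewrite mem_iota/= add0n.
by rewrite ltnNge; apply/negP => Nn; move: kN; rewrite -nk ltNge (homo_leq (@le_refl _ _) le_trans (fun m => ltW (lam_incr m))).
Qed.

Lemma lam_unbounded L : \forall N \near \oo, L <= lam N.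
Proof.
have [F [zF FL]] := zeros_below r_gt0 w_cont w_gt0 alpha_prim a_prim b_prim a0 b0 rest_psd L.
have [N LN] : exists N, L <= lam N.
  apply: contrapT => H.
  have sub : {subset first (size F).+1 <= F}.
    move=> k /mapP[n _ ->]; apply: FL; last exact: lam_zero.
    by rewrite ltNge; apply/negP => Ln; apply: H; exists n.
  have := uniq_leq_size (first_zeros (size F).+1).1 sub.
  by rewrite size_map size_iota ltnn.
exists N => // n /= Nn; apply: le_trans LN _.
exact: (homo_leq (@le_refl _ _) le_trans (fun m => ltW (lam_incr m))).
Qed.

Lemma rest_uniform : forall eps, 0 < eps -> \forall N \near \oo, forall t, 0 <= t <= r ->
  rest r w alpha b (first N) t t <= eps.
Proof.
move=> eps e0.
have [C C0 HC] := rest_small r_gt0 w_cont w_gt0 alpha_prim alpha0 a_prim b_prim a0 b0 rest_psd.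
pose L := Num.max r^-1 ((C / eps) ^+ 2).
have L0 : 0 < L by rewrite lt_max invr_gt0 r_gt0.
near=> N => t tr; have LN : L <= lam N by near: N; exact: lam_unbounded.
apply: le_trans (HC _ (lam N) _ (first_zeros N) (@first_below N) _ tr) _.
  by apply: le_trans LN; rewrite le_max lexx.
have l0 : 0 < lam N by exact: lt_le_trans LN.
rewrite ler_pdivrMr ?sqrtr_gt0// mulrC -ler_pdivrMr//.
have Ce : 0 <= C / eps by rewrite divr_ge0// ltW.
rewrite -[leLHS](ger0_norm Ce) -sqrtr_sqr; apply: ler_wsqrtr.
by apply: le_trans LN; rewrite le_max lexx orbT.
Unshelve. all: by end_near. Qed.

Lemma rest_sqr F s t : zeros r b F -> 0 <= s <= r -> 0 <= t <= r ->
  rest r w alpha b F s t ^+ 2 <= rest r w alpha b F s s * rest r w alpha b F t t.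
Proof.
move=> zF sr tr; apply: discriminant_le; first exact: (rest_ge0 rest_psd).
by move=> x; have := rest_psd 1 x zF sr tr; rewrite expr1n !mul1r.
Qed.

Variable nu : nat -> R.
Hypothesis nu_norm : forall n, nu n ^+ 2 * ip r w (b (lam n)) (b (lam n)) = 1.

Notation leb := (@lebesgue_measure R).
Notation mur := (mrestr leb (measurable_itv `[0%R, r])).
Local Notation D := (`[0%R, r]%classic : set (measurableTypeR R)).
Local Notation mfun f := (measurable_fun (T := measurableTypeR R) setT f).

Let rr : 0 <= r <= r. Proof. by rewrite ltW/=. Qed.

Let sw t := (Num.sqrt (w t))^-1.

Let sw_gt0 t : 0 <= t <= r -> 0 < sw t.
Proof. by move=> tr; rewrite invr_gt0 sqrtr_gt0 w_gt0. Qed.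

Let sw_sqr t : 0 <= t <= r -> sw t * sw t = iw w t.
Proof.
by move=> tr; rewrite /sw /iw -invfM -expr2 sqr_sqrtr// ltW// w_gt0.
Qed.

Let sw_cont : cont r sw.
Proof.
apply: contV => [t tr|]; first by rewrite gt_eqF// sqrtr_gt0 w_gt0.
by apply: cont_comp w_cont => x; exact: sqrt_continuous.
Qed.

Let b_cont k : cont r (b k). Proof. exact: prim_cont (b_prim k). Qed.
Arguments b_cont : clear implicits.

(** Division by sqrt w carries [ip] to the inner product of L^2[0, r]. *)
Let wt (y : R -> R) : R -> R := (fun t => y t / Num.sqrt (w t)) \_ D.

Let wtE y t : 0 <= t <= r -> wt y t = y t * sw t.
Proof. by move=> tr; rewrite /wt patchE ifT// mem_setE in_itv. Qed.

Let wt_out y t : ~~ (0 <= t <= r) -> wt y t = 0.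
Proof. by move=> tr; rewrite /wt patchE ifF// mem_setE in_itv/=; exact: negbTE. Qed.

Let wt_cont y : cont r y -> cont r (fun t => y t * sw t).
Proof. by move=> cy; exact: contM. Qed.

Let wt_meas y : cont r y -> mfun (wt y).
Proof. by move=> cy; apply: restr_measurable => //; exact: wt_cont. Qed.

Let wt_L2 y : cont r y -> rL2 mur (wt y).
Proof. by move=> cy; apply: (agree_L2 r_gt0 (wt_meas cy) (wt_cont cy)) => x /wtE ->. Qed.

Let wt_dot y z : cont r y -> cont r z -> dot mur (wt y) (wt z) = ip r w y z.
Proof.
move=> cy cz; rewrite (agree_dot (wt_meas cy) (wt_meas cz) (wtE y) (wtE z)).
by apply: eq_J => t tr; rewrite /= mulrACA sw_sqr// mulrC mulrA.
Qed.

Definition kl_basis n : R -> R := (fun t => nu n * (b (lam n) t / Num.sqrt (w t))) \_ D.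

Let basisE n : kl_basis n = (fun x => nu n * wt (b (lam n)) x).
Proof. by apply/funext => x; rewrite /kl_basis /wt !patchE; case: ifP => // _; rewrite mulr0. Qed.

Lemma kl_basis_L2 n : rL2 mur (kl_basis n).
Proof. by rewrite basisE; apply: L2Z; apply: wt_L2; exact: b_cont. Qed.

Let nu_neq0 n : nu n != 0.
Proof.
apply/eqP => n0; have := nu_norm n; rewrite n0 expr0n mul0r => /esym/eqP.
by rewrite oner_eq0.
Qed.

Lemma kl_basis_orth m n : \int[mur]_x (kl_basis m x * kl_basis n x) = (m == n)%:R.
Proof.
have lw k := wt_L2 (b_cont k).
rewrite -/(dot mur (kl_basis m) (kl_basis n)) !basisE.
rewrite (dotZl _ (lw _) (L2Z _ (lw _))) (dotZr _ (lw _) (lw _)) (wt_dot (b_cont _) (b_cont _)).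
have [<-|mn] := eqVneq m n; first by rewrite mulrA -expr2 nu_norm.
rewrite (zero_orth r_gt0 w_cont w_gt0 a_prim b_prim b0 (lam_zero m) (lam_zero n)) ?mulr0//.
by apply: contra mn => /eqP/lam_inj ->.
Qed.

Local Notation S := (closed_rspan mur setT kl_basis).

Let SZD c f g : S f -> S g -> S (fun x => c * f x + g x).
Proof. by apply: closed_rspanZD => n _; exact: kl_basis_L2. Qed.

Let S_closed f : rL2 mur f ->
  (forall eps, 0 < eps -> exists2 g, S g & dist mur f g < eps) -> S f.
Proof. by apply: closed_rspan_closed => n _; exact: kl_basis_L2. Qed.

Let S_basis n : S (wt (b (lam n))).
Proof.
have H : S (kl_basis n).
  by apply: closed_rspan_lin; [move=> k _; exact: kl_basis_L2|exact: lin_span_base].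
have H0 : S (fun=> 0).
  have := SZD (-1) H H; congr S; apply/funext => x.
  by rewrite mulN1r addNr.
have := SZD (nu n)^-1 H H0; rewrite basisE; congr S; apply/funext => x.
by rewrite addr0 mulKf.
Qed.

Let S0 : S (fun=> 0).
Proof.
have := SZD (-1) (S_basis 0) (S_basis 0); congr S; apply/funext => x.
by rewrite mulN1r addNr.
Qed.

Let SZ c f : S f -> S (fun x => c * f x).
Proof.
move=> Sf; have := SZD c Sf S0; congr S; apply/funext => x.
by rewrite addr0.
Qed.

(** At fixed s the error of the finite eigenfunction expansion is [rest], uniformly small by
    [rest_sqr] and [rest_uniform], hence small for [ip]. *)
Let S_green s : 0 <= s <= r -> S (wt (green r alpha s)).
Proof.
move=> sr; have cg := green_cont (s := s) r_gt0 alpha_prim.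
apply: S_closed; first exact: wt_L2.
move=> eps e0; have gg := gam_gt0 r_gt0 w_cont w_gt0.
(* A kernel bounded by [del] has [ip] norm at most del sqrt gam = eps / 2. *)
pose del := eps / (2 * Num.sqrt (gam r w)).
have del0 : 0 < del by rewrite divr_gt0// mulr_gt0// sqrtr_gt0.
have [N _ HN] := rest_uniform del0; have {}HN := HN N (leqnn N).
pose y t := \sum_(k <- first N) b k s * b k t / (k ^+ 2 * ip r w (b k) (b k)).
have cy : cont r y.
  apply: cont_sum => k; under eq_fun do rewrite mulrAC.
  by apply: contZ; exact: b_cont.
exists (wt y).
  have -> : wt y = (fun x => \sum_(k <- first N)
      (b k s / (k ^+ 2 * ip r w (b k) (b k))) * wt (b k) x).
    apply/funext => x; have [xr|xr] := boolP (0 <= x <= r).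
      rewrite wtE// /y mulr_suml; apply: eq_bigr => k _.
      by rewrite wtE//; ring.
    by rewrite wt_out// big1// => k _; rewrite wt_out// mulr0.
  rewrite /first; elim: (iota 0 N) => [|n u ih].
    by move: S0; congr S; apply/funext => x; rewrite big_nil.
  have := SZD (b (lam n) s / (lam n ^+ 2 * ip r w (b (lam n)) (b (lam n)))) (S_basis n) ih.
  by congr S; apply/funext => x; rewrite /= big_cons.
have dE : dist mur (wt (green r alpha s)) (wt y) =
    Num.sqrt (ip r w (rest r w alpha b (first N) s) (rest r w alpha b (first N) s)).
  have cr : cont r (rest r w alpha b (first N) s) by exact: rest_cont.
  rewrite -(wt_dot cr cr) /dist.
  suff -> : (fun x => wt (green r alpha s) x - wt y x) = wt (rest r w alpha b (first N) s) by [].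
  apply/funext => x; have [xr|xr] := boolP (0 <= x <= r).
    by rewrite !wtE// -mulrBl.
  by rewrite !wt_out// subrr.
rewrite dE.
have H t : 0 <= t <= r -> rest r w alpha b (first N) s t ^+ 2 <= del ^+ 2.
  move=> tr; apply: le_trans (rest_sqr (first_zeros N) sr tr) _.
  have z := first_zeros N; rewrite expr2.
  exact: ler_pM (rest_ge0 rest_psd z sr) (rest_ge0 rest_psd z tr) (HN s sr) (HN t tr).
have := ip_sup_le r_gt0 w_cont w_gt0 (rest_cont r_gt0 alpha_prim b_prim (F := first N) (s := s)) H.
move=> /ler_wsqrtr/le_lt_trans; apply.
have g0 : 0 < Num.sqrt (gam r w) by rewrite sqrtr_gt0.
rewrite (sqrtrM _ (sqr_ge0 del)) sqrtr_sqr (gtr0_norm del0) /del.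
move: (Num.sqrt _) g0 => g g0.
have -> : eps / (2 * g) * g = eps / 2 by field; rewrite gt_eqF.
by rewrite ltr_pdivrMr// ltr_pMr// ltr1n.
Qed.

(** The value 1 off [0, r], a null set for the restricted measure, makes h positive everywhere, as
    [L2_total] asks. *)
Let h x := if 0 <= x <= r then sw x else 1.

Let hE x : 0 <= x <= r -> h x = sw x. Proof. by rewrite /h => ->. Qed.

Let h_gt0 x : 0 < h x.
Proof. by rewrite /h; case: ifPn => // xr; exact: sw_gt0. Qed.

Let h_meas : mfun h.
Proof.
have -> : h = (fun x => wt (fun=> 1) x + \1_(~` D) x).
  apply/funext => x; rewrite /h indicE in_setC mem_setE in_itv/=.
  have [xr|xr] := boolP (0 <= x <= r); first by rewrite wtE// mul1r addr0.
  by rewrite wt_out// add0r.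
apply: measurable_funD; first by apply: wt_meas; exact: cont_cst.
by apply: measurable_indic; apply: measurableC; exact: measurable_itv.
Qed.

Let h_L2 : rL2 mur h. Proof. exact: (agree_L2 r_gt0 h_meas sw_cont) hE. Qed.

Let q := (fun x => alpha x / alpha r) \_ D.

Let alphar := alpha_gt0 r_gt0 w_cont w_gt0 alpha_prim alpha0.

Let alpha_le s t : 0 <= s -> s <= t -> t <= r -> alpha s <= alpha t.
Proof. exact: (alpha_incr_ge w_cont w_gt0 alpha_prim alpha0). Qed.

Let qE x : 0 <= x <= r -> q x = alpha x / alpha r.
Proof. by move=> xr; rewrite /q patchE ifT// mem_setE in_itv. Qed.

Let q_meas : mfun q.
Proof.
apply: restr_measurable => //; under eq_fun do rewrite mulrC.
by apply: contZ; exact: prim_cont alpha_prim.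
Qed.

Let q_bound x : 0 <= q x <= 1.
Proof.
have [xr|xr] := boolP (0 <= x <= r); last first.
  by rewrite /q patchE ifF ?lexx ?ler01// mem_setE in_itv/=; exact: negbTE.
have /andP[x0 xr'] := xr.
rewrite qE// ler_pdivrMr// mul1r alpha_le// andbT divr_ge0 ?(ltW alphar)//.
by rewrite -alpha0 alpha_le.
Qed.

Let ray (s x : R) : R := (\1_(`]s, +oo[%classic) : R -> R) x.

Let rayE s x : ray s x = (s < x)%R%:R.
Proof. by rewrite /ray indicE mem_setE in_itv/= andbT. Qed.

Let ray_meas s : mfun (ray s).
Proof. by apply: measurable_indic; exact: measurable_itv. Qed.

Let h_mul_L2 (f : R -> R) : mfun f -> (forall x, `|f x| <= 1) -> rL2 mur (fun x => f x * h x).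
Proof.
move=> mf f1; apply: L2_le h_L2 _; first exact: measurable_funM.
by move=> x; rewrite normrM ler_piMl.
Qed.

(** An L^2 error of order sqrt del is the cost of a bounded discrepancy on an interval of length
    del. *)
Let S_lim (f : R -> R) (c e : R) : 0 < c -> 0 < e -> rL2 mur f ->
  (forall del, 0 < del -> del <= e -> exists2 g, S g & dist mur f g <= c * Num.sqrt del) ->
  S f.
Proof.
move=> c0 e0 lf H; apply: S_closed => // eps eps0.
pose del := Num.min e ((eps / (2 * c)) ^+ 2).
have ec : 0 < eps / (2 * c) by rewrite divr_gt0// mulr_gt0.
have [|| g Sg fg] := H del; rewrite ?ge_min ?lexx//.
  by rewrite lt_min e0 exprn_gt0.
exists g => //; apply: le_lt_trans fg _.
apply: (@le_lt_trans _ _ (c * (eps / (2 * c)))).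
  apply: ler_wpM2l; first exact: ltW.
  by rewrite -[leRHS](gtr0_norm ec) -sqrtr_sqr ler_wsqrtr// ge_min lexx orbT.
have -> : c * (eps / (2 * c)) = eps / 2 by field; rewrite gt_eqF.
by rewrite ltr_pdivrMr// ltr_pMr// ltr1n.
Qed.

Let S_meas (f : R -> R) : S f -> mfun f.
Proof. by move=> [lf _]; exact: L2_measurable lf. Qed.

Let sw_bound : exists2 K, 0 < K & forall x, 0 <= x <= r -> sw x <= K.
Proof.
have [K K0 HK] := cont_bound (ltW r_gt0) sw_cont; exists K => // x xr.
exact: le_trans (ler_norm _) (HK _ xr).
Qed.

Let psi s x := (ray s x - q x) * h x.

Let psi_L2 s : rL2 mur (psi s).
Proof.
apply: h_mul_L2 => [|x]; first exact: measurable_funB.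
have := q_bound x; rewrite rayE ler_norml; case: (s < x) => /=; lra.
Qed.

(* [(green (s + del) - green s) / (alpha (s + del) - alpha s)] tends to
   [1_]s, r] - alpha / alpha r] as [del] tends to 0. *)
Let S_psi s : 0 <= s < r -> S (psi s).
Proof.
move=> /andP[s0 sr]; have [K K0 HK] := sw_bound.
apply: (S_lim K0 _ (psi_L2 s) (e := r - s)); first by rewrite subr_gt0.
move=> del del0; rewrite lerBrDl => dr.
pose u := s + del; have su : s < u by rewrite ltrDl.
have sD : 0 <= s <= r by rewrite s0 ltW.
have u0 : 0 <= u by rewrite (le_trans s0) ?ltW.
have uD : 0 <= u <= r by rewrite u0.
have [c c0 Hc] := cont_pos_min (ltW r_gt0) w_cont w_gt0.
have asu : 0 < alpha u - alpha s.
  rewrite !(alphaE alpha_prim alpha0)//.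
  have H : c * (u - s) <= J u w - J s w.
    apply: (J_incr_ge s0 (ltW su) dr w_cont) => x /andP[sx xu].
    by apply: Hc; rewrite (le_trans s0 sx) (le_trans xu).
  by apply: lt_le_trans H; rewrite mulr_gt0 ?subr_gt0.
pose g x := (alpha u - alpha s)^-1 * (-1 * wt (green r alpha s) x + wt (green r alpha u) x).
have Sg : S g by apply: SZ; apply: SZD; exact: S_green.
exists g => //.
have -> : del = u - s by rewrite /u; ring.
(* The quotient of the minima is 0 for x <= s, 1 for x >= u and in [0, 1] between, so it differs
   from the indicator of the ray only on [s, u]; the product terms of the Green functions contribute
   exactly alpha_x / alpha_r. *)
pose z x := (Num.min (alpha u) (alpha x) - Num.min (alpha s) (alpha x)) / (alpha u - alpha s).
have gE x : 0 <= x <= r -> psi s x - g x = (ray s x - z x) * sw x.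
  move=> xr; rewrite /psi hE// qE// /g !wtE// /green /z; field.
  by rewrite !gt_eqF.
have zlow x : 0 <= x <= s -> z x = 0.
  move=> /andP[x0 xs]; have axs := alpha_le x0 xs (ltW sr).
  have asu' : alpha s <= alpha u by rewrite -subr_ge0 ltW.
  by rewrite /z (min_idPr axs) (min_idPr (le_trans axs asu')) subrr mul0r.
have zhigh x : u <= x <= r -> z x = 1.
  move=> /andP[ux xr]; have aux := alpha_le u0 ux xr.
  have asu' : alpha s <= alpha u by rewrite -subr_ge0 ltW.
  by rewrite /z (min_idPl aux) (min_idPl (le_trans asu' aux)) divff// gt_eqF.
have zb x : 0 <= z x <= 1.
  rewrite /z ler_pdivrMr// mul1r ler_pdivlMr// mul0r.
  have [H1|H1] := leP (alpha u) (alpha x); have [H2|H2] := leP (alpha s) (alpha x); lra.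
apply: dist_mrestr; rewrite ?ltW//.
- exact: L2_measurable (psi_L2 s).
- exact: S_meas.
- move=> x xr _; rewrite gE// normrM (gtr0_norm (sw_gt0 xr)) -[leRHS]mul1r.
  apply: ler_pM; rewrite ?HK//; first exact/ltW/sw_gt0.
  by have := zb x; rewrite rayE ler_norml; case: (s < x) => /=; lra.
- move=> x xr; rewrite negb_and -!ltNge => /orP xsu.
  apply/eqP; rewrite -subr_eq0 gE// rayE; have /andP[x0 xr'] := xr.
  case: xsu => [xs|ux].
    by rewrite zlow ?x0 ?ltW// ltNge ltW//= subrr mul0r.
  by rewrite zhigh ?xr' ?ltW// (lt_trans su ux) subrr mul0r.
Qed.

(** As s tends to r, psi_s tends to - q h, because the ray from r - del meets [0, r] in length del.
    Adding q h back turns each psi_s into a ray. *)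
Let S_q : S (fun x => q x * h x).
Proof.
have [K K0 HK] := sw_bound.
apply: (S_lim K0 r_gt0) => [|del del0 dr].
  by apply: h_mul_L2 => // x; have := q_bound x; rewrite ler_norml; lra.
have drD : 0 <= r - del < r by rewrite subr_ge0 dr gtrBl.
exists (fun x => -1 * psi (r - del) x); first by apply: SZ; exact: S_psi.
rewrite [X in Num.sqrt X](_ : del = r - (r - del)); last by ring.
have E x : q x * h x - -1 * psi (r - del) x = ray (r - del) x * h x.
  by rewrite /psi; ring.
apply: dist_mrestr; rewrite ?lerBlDr ?lerDl ?ltW//.
- exact: measurable_funM.
- by apply: measurable_funM => //; exact: L2_measurable (psi_L2 _).
- move=> x xr _; rewrite E rayE hE// normrM (gtr0_norm (sw_gt0 xr)) -[leRHS]mul1r.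
  apply: ler_pM; rewrite ?HK//; first exact/ltW/sw_gt0.
  by case: (_ < x); rewrite ?normr1 ?normr0 ?ler01.
- move=> x /andP[x0 xr]; rewrite xr andbT -ltNge => xd.
  by apply/eqP; rewrite -subr_eq0 E rayE ltNge ltW// mul0r.
Qed.

(** The ray from 0 misses the point 0, which is null; so it can stand for the rays from negative
    points and for h itself. *)
Let S_off0 (f g : R -> R) : rL2 mur f -> S g -> (forall x, 0 < x <= r -> f x = g x) -> S f.
Proof.
move=> lf Sg fg; have mf := L2_measurable lf.
have c0 : 0 < 1 + `|f 0 - g 0| by rewrite ltr_wpDr.
apply: (S_lim c0 ltr01 lf) => del _ _.
exists g => //; apply: (@le_trans _ _ ((1 + `|f 0 - g 0|) * Num.sqrt (0 - 0))).
  apply: dist_mrestr => //.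
  - exact: S_meas.
  - by move=> x _ x0; rewrite -(le_anti x0) lerDr.
  - by move=> x /andP[x0 xr] xn; apply: fg; rewrite xr andbT lt_neqAle x0 andbT eq_le.
by rewrite subrr sqrtr0 mulr0 mulr_ge0// ltW.
Qed.

Let S_ray s : S (fun x => ray s x * h x).
Proof.
have lr s' : rL2 mur (fun x => ray s' x * h x).
  by apply: h_mul_L2 => // x; rewrite rayE; case: (_ < x); rewrite ?normr1 ?normr0 ?ler01.
have H s' : 0 <= s' < r -> S (fun x => ray s' x * h x).
  move=> s'r; have := SZD 1 (S_psi s'r) S_q; congr S; apply/funext => x.
  by rewrite /psi; ring.
have [s0|s0] := ltP s 0.
  apply: (S_off0 (lr s) (H 0 _)); first by rewrite lexx.
  by move=> x /andP[x0 xr]; rewrite !rayE x0 (lt_trans s0 x0).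
have [sr|rs] := ltP s r; first by apply: H; rewrite s0.
apply: (S_off0 (lr s) S0) => x /andP[x0 xr].
by rewrite rayE ltNge (le_trans xr rs) mul0r.
Qed.

Let S_h : S h.
Proof.
apply: (S_off0 h_L2 (S_ray 0)) => x /andP[x0 xr].
by rewrite rayE x0 mul1r.
Qed.

Lemma kl_basis_total : closed_rspan mur setT kl_basis = rL2 mur.
Proof.
apply/seteqP; split; first by move=> f [].
exact: (L2_total SZD S_closed h_L2 h_gt0 S_h S_ray).
Qed.

End enumeration.

(** * The real system of the chain *)

Section complex_system.
Context (R : realType).
Notation leb := (@lebesgue_measure R).

Let cont_part (p : R[i] -> R) (f : R -> R[i]) r :
  (forall x y, p (x - y) = p x - p y) -> (forall x, `|p x|%:C <= `|x|) ->
  {within `[0, +oo[, continuous (f : R -> (R[i] : numFieldType))} ->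
  cont r (fun t => p (f t)).
Proof.
move=> pB pn /continuous_subspaceW cf; apply/contP => t tr.
have {}cf : {within `[0, r], continuous (f : R -> (R[i] : numFieldType))}.
  by apply: cf => x /=; rewrite !in_itv/= => /andP[->].
move/subspace_continuousP : cf => /(_ t).
rewrite /= in_itv/= => /(_ tr) cf.
apply/cvgrPdist_lt => e e0.
have e0' : 0 < (e%:C : (R[i] : numFieldType)) by rewrite ltcR.
have := (@cvgrPdist_lt (R[i] : numFieldType) (R[i] : numFieldType) _ _ _ _ _).1 cf _ e0'.
move=> H; near=> s.
rewrite -pB -ltcR; apply: le_lt_trans (pn _) _; near: s; exact: H.
Unshelve. all: by end_near.
Qed.

Let im_le (x : R[i]) : `|complex.Im x|%:C <= `|x|.
Proof. by rewrite normc_def lecR -sqrtr_sqr ler_wsqrtr// lerDr sqr_ge0. Qed.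

Let reB (x y : R[i]) : complex.Re (x - y) = complex.Re x - complex.Re y.
Proof. by case: x; case: y. Qed.

Let imB (x y : R[i]) : complex.Im (x - y) = complex.Im x - complex.Im y.
Proof. by case: x; case: y. Qed.

Let re_div (x : R[i]) (y : R) : complex.Re (x / y%:C) = complex.Re x / y.
Proof. by rewrite -fmorphV; case: x => u v /=; rewrite mulr0 subr0. Qed.

Let im_div (x : R[i]) (y : R) : complex.Im (x / y%:C) = complex.Im x / y.
Proof. by rewrite -fmorphV; case: x => u v /=; rewrite mulr0 add0r. Qed.

Let re_mul (x : R[i]) (y : R) : complex.Re (x * y%:C) = complex.Re x * y.
Proof. by case: x => u v /=; rewrite mulr0 subr0. Qed.

Let im_mul (x : R[i]) (y : R) : complex.Im (x * y%:C) = complex.Im x * y.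
Proof. by case: x => u v /=; rewrite mulr0 add0r. Qed.

Variables (alpha dalpha : R -> R) (A B : R -> R[i] -> R[i]) (r : R).
Hypothesis chain : de_branges_chain alpha dalpha A B.
Hypothesis r_gt0 : 0 < r.

Let r_ge0 : 0 <= r. Proof. exact: ltW. Qed.

Lemma chain_dalpha_cont : cont r dalpha.
Proof.
have [[_ _ cw _ _] _ _ _ _] := chain.
by apply: continuous_subspaceW cw => x /=; rewrite !in_itv/= => /andP[->].
Qed.

Lemma chain_dalpha_gt0 t : 0 <= t <= r -> 0 < dalpha t.
Proof. by have [[_ _ _ _ w0] _ _ _ _] := chain; move=> /andP[/w0]. Qed.

Lemma chain_alpha0 : alpha 0 = 0. Proof. by have [[]] := chain. Qed.

Lemma chain_alpha_prim : prim r alpha dalpha.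
Proof.
have [[_ ca _ da _] _ _ _ _] := chain; apply: prim_of_derive => //.
- by apply: continuous_subspaceW ca => x /=; rewrite !in_itv/= => /andP[->].
- exact: chain_dalpha_cont.
- by move=> t /andP[t0 _]; exact: da.
Qed.

Let w_cont := chain_dalpha_cont.

Let iw_cont : cont r (fun t => (dalpha t)^-1).
Proof. by apply: contV => // t /chain_dalpha_gt0/lt0r_neq0. Qed.

Let part_cont k : [/\ cont r (fun t => complex.Re (A t k%:C)),
  cont r (fun t => complex.Im (A t k%:C)), cont r (fun t => complex.Re (B t k%:C)) &
  cont r (fun t => complex.Im (B t k%:C))].
Proof.
have [_ [_ /(_ k%:C)[cA cB]] _ _ _] := chain.
have cre := fun f => @cont_part _ f r reB (@normc_ge_Re R).
have cim := fun f => @cont_part _ f r imB im_le.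
split; [exact: (cre (fun t => A t k%:C) cA)|exact: (cim (fun t => A t k%:C) cA)|
  exact: (cre (fun t => B t k%:C) cB)|exact: (cim (fun t => B t k%:C) cB)].
Qed.

(** For real k the coefficients of the integral equations are real, so real and imaginary parts of A
    and B separate into two copies of one system, with initial values 1 and 0 of the A-component. *)
Let system k t : 0 <= t <= r ->
  [/\ complex.Re (A t k%:C) = 1 + J t (fun u => - (k * (complex.Re (B u k%:C) / dalpha u))),
      complex.Im (A t k%:C) = J t (fun u => - (k * (complex.Im (B u k%:C) / dalpha u))),
      complex.Re (B t k%:C) = J t (fun u => k * (complex.Re (A u k%:C) * dalpha u)) &
      complex.Im (B t k%:C) = J t (fun u => k * (complex.Im (A u k%:C) * dalpha u))].
Proof.
move=> tr; have [cra cia crb cib] := part_cont k.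
have [_ _ /(_ t k%:C)H _ _] := chain; have [] := H (proj1 (andP tr)).
set IB := cintegral _ _ _; set IA := cintegral _ _ _.
have -> : IB = J t (fun u => complex.Re (B u k%:C) / dalpha u) +i*
    J t (fun u => complex.Im (B u k%:C) / dalpha u).
  by congr (_ +i* _); apply: eq_Rintegral => u _; [exact: re_div|exact: im_div].
have -> : IA = J t (fun u => complex.Re (A u k%:C) * dalpha u) +i*
    J t (fun u => complex.Im (A u k%:C) * dalpha u).
  by congr (_ +i* _); apply: eq_Rintegral => u _; [exact: re_mul|exact: im_mul].
have c1 := contM crb iw_cont; have c2 := contM cib iw_cont.
have c3 := contM cra w_cont; have c4 := contM cia w_cont.
move=> EA ->; have -> : A t k%:C = 1 - (1 - A t k%:C) by ring.
rewrite EA !(JN tr); [|exact: contZ..].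
rewrite !(JZ tr)//.
by split => /=; ring.
Qed.

Definition chain_a k t := complex.Re (A t k%:C).
Definition chain_b k t := complex.Re (B t k%:C).

Let zero_in : 0 <= (0 : R) <= r. Proof. by rewrite lexx r_ge0. Qed.

Lemma chain_a0 k : chain_a k 0 = 1.
Proof. by rewrite /chain_a; have [-> _ _ _] := system k zero_in; rewrite J_0 addr0. Qed.

Lemma chain_b0 k : chain_b k 0 = 0.
Proof. by rewrite /chain_b; have [_ _ -> _] := system k zero_in; rewrite J_0. Qed.

Lemma chain_a_prim k : prim r (chain_a k) (fun t => - (k * (chain_b k t / dalpha t))).
Proof.
have [_ _ crb _] := part_cont k.
split; first by apply: contN; apply: contZ; exact: contM.
by move=> t tr; rewrite chain_a0 /chain_a; have [-> _ _ _] := system k tr.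
Qed.

Lemma chain_b_prim k : prim r (chain_b k) (fun t => k * (chain_a k t * dalpha t)).
Proof.
have [cra _ _ _] := part_cont k.
split; first by apply: contZ; exact: contM.
by move=> t tr; rewrite chain_b0 add0r /chain_b; have [_ _ -> _] := system k tr.
Qed.

(** The imaginary parts solve the homogeneous system with zero initial data, so [system_bound] makes
    them vanish. This identifies the zeros of the complex B_r with those of its real part. *)
Lemma chain_b_real k : B r k%:C = (chain_b k r)%:C.
Proof.
have [_ cia _ cib] := part_cont k.
have [c c0 H] := system_bound r_gt0 chain_dalpha_cont chain_dalpha_gt0 (normr_ge0 k).
have i0 : complex.Im (A 0 k%:C) = 0 /\ complex.Im (B 0 k%:C) = 0.
  by have [_ -> _ ->] := system k zero_in; rewrite !J_0.
have pb : prim r (fun t => complex.Im (B t k%:C))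
    (fun t => k * (dalpha t * complex.Im (A t k%:C)) + 0).
  split; first by apply: contD; [apply: contZ; exact: contM|exact: cont_cst].
  move=> t tr; rewrite i0.2 add0r; have [_ _ _ ->] := system k tr.
  by apply: eq_J => u _; ring.
have pa : prim r (fun t => complex.Im (A t k%:C))
    (fun t => - (k * (iw dalpha t * complex.Im (B t k%:C))) + 0).
  split.
    by apply: contD; [apply: contN; apply: contZ; exact: contM|exact: cont_cst].
  move=> t tr; rewrite i0.1 add0r; have [_ -> _ _] := system k tr.
  by apply: eq_J => u _; rewrite /iw; ring.
have rr : 0 <= r <= r by rewrite r_ge0 lexx.
have := H k _ _ _ _ (lexx _) (cont_cst 0) (cont_cst 0) pb pa i0.2 i0.1 r rr.
rewrite (_ : J r _ = 0) ?mulr0; last first.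
  rewrite (eq_J (g := fun=> 0)); last by move=> u _; rewrite expr0n addr0.
  by rewrite (J_cst rr) mul0r.
rewrite /chain_b; case: (B r k%:C) => x y /= H0; congr (_ +i* _).
apply/eqP; rewrite -sqrf_eq0 eq_le sqr_ge0 andbT; apply: le_trans H0.
by rewrite lerDl sqr_ge0.
Qed.

End complex_system.

(** * The Karhunen-Loeve series *)

Section moments.
Context d (T : measurableType d) (R : realType) (P : probability T R).
Implicit Types f g : T -> R.

Lemma expectation_dot f g : rL2 P f -> rL2 P g ->
  'E_P[(fun x => f x * g x)%R]%E = (dot P f g)%:E.
Proof.
move=> lf lg; rewrite unlock /dot /Rintegral fineK//.
exact: integrable_fin_num (L2_integrable_mul lf lg).
Qed.

Lemma expectation_sqr f : rL2 P f -> 'E_P[(fun x => f x ^+ 2)%R]%E = (dot P f f)%:E.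
Proof.
by move=> lf; rewrite -expectation_dot//; congr expectation; apply/funext => x; rewrite expr2.
Qed.

Lemma L2_of_moment f (c : R) : measurable_fun setT f ->
  'E_P[(fun x => f x * f x)%R]%E = c%:E -> rL2 P f.
Proof.
move=> mf fc; apply: L2I => //; apply/integrableP; split.
  by apply/measurable_EFinP; exact: measurable_funM.
move: fc; rewrite unlock => fc.
rewrite (_ : (\int[P]_x _)%E = c%:E) ?ltry// -fc; apply: eq_integral => x _.
by rewrite gee0_abs// lee_fin -expr2 sqr_ge0.
Qed.

Lemma covariance_centred f g : rL2 P f -> rL2 P g ->
  \int[P]_x f x = 0 -> \int[P]_x g x = 0 -> covariance P f g = (dot P f g)%:E.
Proof.
move=> lf lg f0 g0; rewrite unlock -expectation_dot//; congr expectation.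
have E h : \int[P]_x h x = 0 -> fine 'E_P[h]%E = 0 by rewrite unlock.
apply/funext => x.
by rewrite -[LHS]/((f x - fine 'E_P[f]%E) * (g x - fine 'E_P[g]%E)) !E// !subr0.
Qed.

Lemma ae_dist_eq0 f g : rL2 P f -> rL2 P g -> {ae P, forall x, f x = g x} -> dist P f g = 0.
Proof.
move=> lf lg fg; rewrite /dist /dot /Rintegral.
have mfg : measurable_fun setT (fun x => ((f x - g x) * (f x - g x))%:E).
  have mf := L2_measurable lf; have mg := L2_measurable lg.
  by apply/measurable_EFinP; apply: measurable_funM; exact: measurable_funB.
have H : ae_eq P setT (fun x => ((f x - g x) * (f x - g x))%:E) (cst 0%E).
  by move: fg; apply: filterS => x /= fgx _; rewrite fgx subrr mulr0.
by rewrite (ae_eq_integral _ _ _ _ _ H)// integral0 sqrtr0.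
Qed.

End moments.

Section martingale.
Context d (T : measurableType d) (R : realType) (P : probability T R).
Variables (mu : {measure set (measurableTypeR R) -> \bar R}) (X M : R -> {RV P >-> R}).
Variable B : R -> R[i] -> R[i].
Hypothesis siX : si_process mu X.
Hypothesis martM : even_fundamental_martingale mu X B M.

Lemma si_measurable t : measurable_fun setT (X t : T -> R).
Proof. exact: measurable_funP. Qed.

Lemma si_gaussian : gaussian_process P (fun t => X t : T -> R).
Proof. by case: siX. Qed.

Lemma si_centred t : \int[P]_x X t x = 0.
Proof. by case: siX => _ _ /(_ t) + _ _; rewrite unlock /Rintegral => ->. Qed.

Local Notation G := (gspan P (fun t => X t : T -> R)).

(** M_t agrees almost everywhere with an element of the closed span of the even parts, which lie in
    the span of X; equality almost everywhere is distance 0, and the span is closed. *)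
Lemma martingale_gspan t : 0 <= t -> rL2 P (M t) -> G (M t).
Proof.
move=> t0 lM; have [iso [iso1 _ _ _] H] := martM.
have [sB aeM] := H t t0; have [[lY YP] _] := iso1 _ sB.
have Gfull := gspanZD si_measurable si_gaussian.
have GX u : G (X u).
  apply: closed_rspan_lin; last exact: lin_span_base.
  by move=> j _; exact: gp_L2 si_measurable si_gaussian j.
have Geven u : G (even_part X u).
  have -> : even_part X u = (fun x => 2^-1 * X u x + (- 2^-1 * X (- u) x + 0)).
    by apply/funext => x; rewrite /even_part; field.
  apply: (Gfull) => //; apply: (Gfull) => //.
  exact: gspan0 si_measurable si_gaussian.
have leven u : rL2 P (even_part X u) by have [] := Geven u.
have GY : G (iso (B_quot B t)).
  apply: (gspan_closed si_measurable si_gaussian) => // eps e0.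
  have [_ /(_ eps e0)[h hh hd]] :=
    (@closed_rspanP _ _ _ P _ _ (even_part X) _ (fun j _ => leven j)).1 (conj lY YP).
  exists h => //; case: hh => n [c [j [_ ->]]].
  exact: (gspan_sum si_measurable si_gaussian).
apply: (gspan_closed si_measurable si_gaussian) => // eps e0.
by exists (iso (B_quot B t)) => //; rewrite ae_dist_eq0.
Qed.

End martingale.

Theorem theorem4p15 (R : realType) (d : measure_display) (T : measurableType d)
  (P : probability T R)
  (alpha dalpha : R -> R) (A B : R -> R[i] -> R[i])
  (mu : {measure set (measurableTypeR R) -> \bar R})
  (X M : R -> {RV P >-> R}) (r : R)
  (chain : de_branges_chain alpha dalpha A B)
  (siX : si_process mu X)
  (detX : determined_by_chain mu (chainE A B))
  (martM : even_fundamental_martingale mu X B M)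
  (momM : forall s t, 0 <= s -> 0 <= t ->
     'E_P[(fun x => M s x * M t x)%R]%E = (pi * alpha (Num.min s t))%:E)
  (r_gt0 : 0 < r) :
  let Y := fun t x => (Num.sqrt (dalpha t))^-1 * bridge alpha M r t x in
  exists lam : nat -> R,
    [/\ forall n, lam n < lam n.+1,
        range lam = positive_zeros (B r) &
        let omega := fun n => kl_coefficient A B r (lam n) in
        let phi := fun n => kl_function dalpha B (lam n) in
        (* the inverse of the norm of [phi n] in L^2[0, r] *)
        let nu := fun n => Num.sqrt (2 / (pi * diag_kernel A B r (lam n))) in
        exists xi : nat -> {RV P >-> R},
          [/\ mutually_independent xi,
              forall n, normal_law P 0 (Num.sqrt pi) (xi n),
              uniform_ms_series P r Y omega phi (fun n => xi n : T -> R) &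
              karhunen_loeve P r Y
                (fun n => Num.sqrt pi / lam n)
                (fun n t => nu n * phi n t)
                (fun n x => xi n x / Num.sqrt pi)]].
Proof.
move=> Y.
have pi0 : 0 < pi :> R by exact: pi_gt0.
have rr : 0 <= r <= r by rewrite ltW/=.
pose w := dalpha; pose a := chain_a A; pose b := chain_b B.
have w_cont : cont r w by exact: chain_dalpha_cont chain.
have w_gt0 : forall t, 0 <= t <= r -> 0 < w t by exact: chain_dalpha_gt0 chain.
have alpha0 := chain_alpha0 chain.
have alpha_prim : prim r alpha w by exact: chain_alpha_prim chain.
have a_prim : forall k, prim r (a k) (fun t => - (k * (b k t / w t)))
  by exact: chain_a_prim chain r_gt0.
have b_prim : forall k, prim r (b k) (fun t => k * (a k t * w t))
  by exact: chain_b_prim chain r_gt0.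
have a0 : forall k, a k 0 = 1 by exact: chain_a0 chain r_gt0.
have b0 : forall k, b k 0 = 0 by exact: chain_b0 chain r_gt0.
have M_L2 t : 0 <= t -> rL2 P (M t).
  by move=> t0; apply: L2_of_moment (momM t t t0 t0); exact: measurable_funP.
have M_dot s t : 0 <= s <= r -> 0 <= t <= r ->
    dot P (M s) (M t) = pi * alpha (Num.min s t).
  move=> /andP[s0 _] /andP[t0 _]; apply: EFin_inj.
  by rewrite -expectation_dot ?momM//; exact: M_L2.
(* z_k is the integral of A_u(k) dM_u for all real k at once: the positivity drawn from it is what
   allows the zeros to be enumerated next. *)
have [z zP] := wieners_exist r_gt0 pi0 w_cont w_gt0 alpha_prim alpha0 a_prim M_L2 M_dot.
have psd := bridge_rest_psd r_gt0 pi0 w_cont w_gt0 alpha_prim alpha0 a_prim b_prim a0 b0 M_L2 M_dot zP.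
have [lam [lam_incr lam_range]] :=
  zeros_enum r_gt0 w_cont w_gt0 alpha_prim alpha0 a_prim b_prim a0 b0 psd.
have zlam n : zero r b (lam n) := lam_zero lam_range n.
pose N n := ip r w (b (lam n)) (b (lam n)).
have N0 n : 0 < N n.
  by have [l0 bl] := zlam n; exact: (ip_b_gt0 r_gt0 w_cont w_gt0 a_prim b_prim a0 b0 bl (lt0r_neq0 l0)).
exists lam; split => //.
  rewrite lam_range; apply/seteqP; split=> k [k0 bk]; split => //.
    by rewrite (chain_b_real chain r_gt0) -/b bk.
  by move: bk; rewrite (chain_b_real chain r_gt0) -/b => /(congr1 (@complex.Re R)).
move=> omega phi nu.
(* At a zero pi K_r = 2 N_n by [diag_derive], which is the origin of the factor 2 in the
   coefficients. *)
have nuE n : nu n = Num.sqrt (N n)^-1.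
  have [_ bl] := zlam n.
  rewrite /nu; have -> : diag_kernel A B r (lam n) = 2 * N n / pi.
    congr (_ / _); rewrite (_ : realline (B r) (lam n) = 0); last exact: bl.
    by rewrite mulr0 subr0; exact: (diag_derive r_gt0 w_cont w_gt0 a_prim b_prim a0 b0 (zlam n)).
  by rewrite (mulrC pi) divfK ?gt_eqF// invfM mulrA divff ?mul1r// pnatr_eq0.
have nu2 n : nu n ^+ 2 = (N n)^-1 by rewrite nuE sqr_sqrtr// invr_ge0 ltW.
have nu_norm n : nu n ^+ 2 * ip r w (b (lam n)) (b (lam n)) = 1.
  by rewrite nu2 mulVf// gt_eqF.
(* Normalised so that all variances equal pi. *)
pose y n x := nu n * z (lam n) x.
have Xm := si_measurable X; have Xg := si_gaussian siX; have Xc := si_centred siX.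
pose G := gspan P (fun t => X t : T -> R).
have GM t : 0 <= t -> G (M t).
  by move=> t0; exact: (martingale_gspan siX martM t0 (M_L2 _ t0)).
have GZD (c : R) f g : G f -> G g -> G (fun x => c * f x + g x) by exact: gspanZD Xm Xg c f g.
have G0 : G (fun=> 0) by exact: gspan0 Xm Xg.
have Gcl f : rL2 P f -> (forall eps, 0 < eps -> exists2 g, G g & dist P f g < eps) -> G f.
  exact: gspan_closed Xm Xg f.
have Gz k : G (z k) by exact: (wiener_closed r_gt0 (zP k) G0 GZD Gcl GM).
have Gy n : G (y n).
  by have := GZD (nu n) _ _ (Gz (lam n)) G0; congr G; apply/funext => x; rewrite addr0.
have ly n : rL2 P (y n) by have [] := Gy n.
have lz k : rL2 P (z k) by have [] := Gz k.
have ydot m n : dot P (y m) (y n) = pi * (m == n)%:R.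
  rewrite (dotZl _ (lz _) (ly _)) (dotZr _ (lz _) (lz _)).
  rewrite (xi_dot r_gt0 w_cont w_gt0 alpha_prim alpha0 a_prim b_prim b0 M_L2 M_dot zP)//.
  have lam_inj : injective lam.
    by apply: inc_inj; exact: (le_mono (homo_ltn lt_trans lam_incr)).
  rewrite (inj_eq lam_inj); have [<-|_] := eqVneq m n; last by rewrite !mulr0.
  by rewrite !mulr1 mulrCA mulrA -expr2 mulrCA nu_norm mulr1.
have my n : measurable_fun setT (y n) by exact: L2_measurable (ly n).
pose xi n : {RV P >-> R} := @mfun_Sub _ _ T _ (y n) (mem_set (my n)).
have bridge_L2 t : 0 <= t -> rL2 P (bridge alpha M r t) := mbridge_L2 alpha r_gt0 M_L2 (t := t).
have Y_L2 t : 0 <= t <= r -> rL2 P (Y t).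
  by move=> /andP[t0 _]; apply: L2Z; exact: bridge_L2.
pose sw t := (Num.sqrt (w t))^-1.
have sw2 t : 0 <= t <= r -> sw t * sw t = (w t)^-1.
  by move=> tr; rewrite /sw -invfM -expr2 sqr_sqrtr// ltW// w_gt0.
have sw_cont : cont r sw.
  apply: contV => [t tr|]; first by rewrite gt_eqF// sqrtr_gt0 w_gt0.
  by apply: cont_comp w_cont => x; exact: sqrt_continuous.
have Ydot s t : 0 <= s <= r -> 0 <= t <= r ->
    dot P (Y s) (Y t) = pi * (sw s * sw t * green r alpha s t).
  move=> sr tr; have /andP[s0 _] := sr; have /andP[t0 _] := tr.
  rewrite (dotZl _ (bridge_L2 _ s0) (Y_L2 _ tr)) (dotZr _ (bridge_L2 _ t0) (bridge_L2 _ s0)).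
  rewrite (mbridge_dot r_gt0 w_cont w_gt0 alpha_prim alpha0 M_L2 M_dot sr tr).
  by rewrite /sw; ring.
have series : uniform_ms_series P r Y omega phi y.
  move=> eps eps0.
  have [K K0 HK] := cont_bound (ltW r_gt0) (contM sw_cont sw_cont).
  have e0 : 0 < eps / (K * pi) by rewrite divr_gt0// mulr_gt0.
  have := rest_uniform r_gt0 w_cont w_gt0 alpha_prim alpha0 a_prim b_prim a0 b0 psd lam_incr lam_range e0.
  apply: filterS => n Hn t tr; have /andP[t0 _] := tr.
  (* The factor nu occurs in omega and again in y; its square 1 / N is the normalisation in
     [remainder]. *)
  have E x : Y t x - \sum_(i < n) omega i * phi i t * y i x =
      sw t * remainder r w alpha b M z (first lam n) t x.
    rewrite /Y /remainder [RHS]mulrBr; congr (_ - _).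
    rewrite /first big_map -[X in iota 0 X]subn0 big_mkord mulr_sumr; apply: eq_bigr => i _.
    rewrite /omega /phi /kl_coefficient /kl_function /y -/(nu i) -/(b (lam i) t).
    have [l0 _] := zlam i.
    transitivity ((nu i ^+ 2) * ((lam i)^-1 * (b (lam i) t * sw t) * z (lam i) x)).
      by rewrite /sw; ring.
    rewrite nu2 -/(N i); field; rewrite !gt_eqF//.
  rewrite (funext (fun x => congr1 (fun u => u ^+ 2) (E x))) expectation_sqr; last first.
    by apply: L2Z; exact: (remainder_L2 w alpha b r_gt0 M_L2 zP).
  have lrem := remainder_L2 w alpha b r_gt0 M_L2 zP (first lam n) t0.
  rewrite (dotZl _ lrem (L2Z _ lrem)) (dotZr _ lrem lrem).
  rewrite (remainder_dot r_gt0 w_cont w_gt0 alpha_prim alpha0 a_prim b_prim a0 b0 M_L2 M_dot zP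
    (first_zeros lam_incr lam_range n) tr tr) lee_fin.
  have <- : K * (pi * (eps / (K * pi))) = eps.
    by rewrite (mulrA K) (mulrC (K * pi)) divfK// gt_eqF// mulr_gt0.
  rewrite mulrA; apply: ler_pM.
  - by rewrite mulr_ge0// invr_ge0 sqrtr_ge0.
  - rewrite mulr_ge0 ?(ltW pi0)//; apply: (rest_ge0 psd) => //.
    exact: first_zeros lam_incr lam_range n.
  - exact: le_trans (ler_norm _) (HK _ tr).
  - by apply: ler_wpM2l (Hn _ tr); exact: ltW.
have Ymean t : 0 <= t <= r -> \int[P]_x Y t x = 0.
  move=> /andP[t0 _]; apply: (gspan_mean Xm Xg Xc).
  have -> : Y t = (fun x => sw t * (- (alpha t / alpha r) * M r x + M t x) + 0).
    by apply/funext => x; rewrite /Y /bridge /sw; ring.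
  exact: (GZD _ _ _ (GZD _ _ _ (GM _ (ltW r_gt0)) (GM _ t0)) G0).
exists xi; split.
- by move=> s S us mS; exact: (gspan_independent Xm Xg Xc pi0 Gy ydot us mS).
- move=> n; have := gspan_normal Xm Xg Xc (Gy n).
  by rewrite ydot eqxx mulr1; apply.
- exact: series.
split.
- move=> t; rewrite /= in_itv/= => tr.
  (* The variance of Y_s - Y_t in terms of the Green function: continuous in s and 0 at s = t. *)
  pose f s := pi * (sw s * sw s * green r alpha s s) -
    2 * (pi * (sw s * sw t * green r alpha s t)) + pi * (sw t * sw t * green r alpha t t).
  have fE s : 0 <= s <= r -> 'E_P[(fun x => (Y s x - Y t x) ^+ 2)%R]%E = (f s)%:E.
    move=> sr; rewrite expectation_sqr; last by apply: L2B; exact: Y_L2.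
    have -> : (fun x => Y s x - Y t x) = (fun x => 1 * Y s x + (-1) * Y t x).
      by apply/funext => x; ring.
    by rewrite (dot_quad _ _ (Y_L2 _ sr) (Y_L2 _ tr)) !Ydot//; congr EFin; rewrite /f; ring.
  have cf : cont r f.
    have ca := prim_cont r_gt0 alpha_prim.
    have cg : cont r (fun s => green r alpha s s).
      under eq_fun do rewrite green_diag.
      by apply: contB => //; under eq_fun do rewrite mulrC; exact/contZ/contX.
    have cgt : cont r (fun s => green r alpha s t).
      have -> : (fun s => green r alpha s t) = green r alpha t.
        by apply/funext => s; exact: greenC.
      exact: (green_cont (s := t) r_gt0 alpha_prim).
    apply: contD; last exact: cont_cst.
    apply: contB; first by apply: contZ; apply: contM => //; exact: contM.
    apply: contZ; apply: contZ; apply: contM => //; apply: contM => //; exact: cont_cst.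
  have f0 : f t = 0 by rewrite /f; ring.
  have H : (f s)%:E @[s --> within `[0, r] (nbhs t)] --> (f t)%:E.
    by apply: cvg_EFin; [exact: nearW|exact: (contP r f).1 cf t tr].
  rewrite f0 in H; apply: cvg_trans H; apply: near_eq_cvg.
  by rewrite near_withinE; apply: nearW => s /=; rewrite in_itv/= => /fE ->.
- split.
  + exact: (kl_basis_L2 lam r_gt0 w_cont w_gt0 b_prim nu).
  + exact: (kl_basis_orth r_gt0 w_cont w_gt0 a_prim b_prim b0 lam_incr lam_range nu_norm).
  + exact: (kl_basis_total r_gt0 w_cont w_gt0 alpha_prim alpha0 a_prim b_prim a0 b0 psd
      lam_incr lam_range nu_norm).
- move=> n t tr; have [l0 bl] := zlam n.
  have cg : cont r (green r alpha t) by exact: (green_cont (s := t) r_gt0 alpha_prim).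
  have cb : cont r (b (lam n)) by exact: (prim_cont r_gt0 (b_prim (lam n))).
  have ciw : cont r (iw w).
    by apply: contV => // s sr; rewrite gt_eqF// w_gt0.
  (* The Green function reproduces the solution b, whose datum is lam_n^2 b. *)
  have eig : lam n ^+ 2 * ip r w (green r alpha t) (b (lam n)) = b (lam n) t.
    rewrite -(ipZr r_gt0 w_cont w_gt0)//.
    exact: (green_ip r_gt0 w_cont w_gt0 alpha_prim alpha0
      (zero_solves r_gt0 a_prim b_prim b0 bl) tr).
  transitivity (J r (fun s => (pi * sw t * nu n) * (iw w s * green r alpha t s * b (lam n) s))).
    apply: eq_J => s sr; rewrite (covariance_centred (Y_L2 _ sr) (Y_L2 _ tr) (Ymean _ sr) (Ymean _ tr)) Ydot//=.
    rewrite /iw -(sw2 _ sr) (greenC r alpha t s) /phi /kl_function -/(sw s).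
    by rewrite -[realline _ _]/(b (lam n) s); ring.
  rewrite (JZ rr); last by apply: contM => //; exact: contM.
  have alg (p u v k i : R) : k != 0 -> p * u * v * i = p / k * (v * (k * i * u)).
    by move=> k0; field.
  rewrite expr_div_n sqr_sqrtr ?(ltW pi0)//.
  rewrite -/(ip r w (green r alpha t) (b (lam n))) (alg _ _ _ (lam n ^+ 2)) ?eig//.
  by rewrite expf_neq0// gt_eqF.
- move=> m n; have q0 : (Num.sqrt pi : R) != 0 by rewrite gt_eqF// sqrtr_gt0.
  under [X in expectation _ X]eq_fun do rewrite !(mulrC (y _ _)).
  rewrite expectation_dot; [|exact: L2Z..].
  rewrite (dotZl _ (ly _) (L2Z _ (ly _))) (dotZr _ (ly _) (ly _)) ydot.
  rewrite -[X in X * (_ == _)%:R](sqr_sqrtr (ltW pi0)) expr2.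
  by rewrite mulrA mulrA -mulrA; congr EFin; field.
- have q0 : (Num.sqrt pi : R) != 0 by rewrite gt_eqF// sqrtr_gt0.
  move=> eps eps0; have := series eps eps0; apply: filterS => n Hn t tr.
  (* sqrt pi cancels and nu moves from the coefficient to the eigenfunction, so the partial sums are
     those of the first series. *)
  have E x : \sum_(i < n) Num.sqrt pi / lam i * (nu i * phi i t) * (xi i x / Num.sqrt pi) =
      \sum_(i < n) omega i * phi i t * y i x.
    apply: eq_bigr => i _; rewrite -[xi i x]/(y i x) /omega /kl_coefficient -/(nu i).
    have alg (q u v f g : R) : q != 0 -> q * u * (v * f) * (g / q) = u * v * f * g.
      by move=> qn; field.
    exact: alg.
  by have := Hn t tr; under [X in expectation _ X]eq_fun do rewrite -E.
Qed.
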